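(* There is a function $\Lambda:(0,\infty)\times[1,\infty)\to(0,\infty)$ such that the following holds. Let $(\mathcal X,Q,\pi)$ be an irreducible reversible finite Markov chain with $\mathrm{Ric}(\mathcal X,Q,\pi)\ge0$ (non-negative entropic Ricci curvature), and suppose that for some $\alpha>0$ and some $x_0\in\mathcal X$ $$D_\alpha:=\pi\big[e^{\alpha d_{\mathcal W}(\cdot,x_0)^2}\big]<\infty.$$ Then the Poincar\'e inequality $\mathrm{PI}(\lambda)$ holds with $\lambda=\Lambda(\alpha,D_\alpha)$, i.e. with a constant depending only on $\alpha$ and on the value $D_\alpha$.
   Context: Setting. $\mathcal X$ is a finite set and $Q:\mathcal X\times\mathcal X\to[0,\infty)$ is a collection of transition rates with $Q(x,x)=0$, irreducible: any $x,y$ are joined by a sequence $x=x_1,\dots,x_n=y$ with $Q(x_i,x_{i+1})>0$. $\pi$ is the unique (strictly positive) stationary probability measure of the associated continuous time Markov chain, assumed reversible: $Q(x,y)\pi(x)=Q(y,x)\pi(y)$ for all $x,y$. $\pi[f]=\sum_xf(x)\pi(x)$. Transport distance. $\mathcal P(\mathcal X)=\{\rho:\mathcal X\to[0,\infty): \sum_x\rho(x)\pi(x)=1\}$ is the set of probability densities. Let $\theta(s,t)=\int_0^1 s^{1-p}t^p\,dp$ (logarithmic mean) and $\hat\rho(x,y)=\theta(\rho(x),\rho(y))$. For $\rho_0,\rho_1\in\mathcal P(\mathcal X)$, $$\mathcal W(\rho_0,\rho_1)^2=\inf\Big\{\tfrac12\int_0^1\sum_{x,y}(\psi_t(x)-\psi_t(y))^2\hat\rho_t(x,y)Q(x,y)\pi(x)\,dt\Big\},$$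 the infimum being over absolutely continuous curves $\rho:[0,1]\to\mathcal P(\mathcal X)$ with endpoints $\rho_0,\rho_1$ and measurable $\psi:[0,1]\to\mathbb R^{\mathcal X}$ such that for a.e. $t$ and all $x$: $\frac{d}{dt}\rho_t(x)+\sum_y(\psi_t(y)-\psi_t(x))\hat\rho_t(x,y)Q(x,y)=0$. $\mathcal W$ is a metric on $\mathcal P(\mathcal X)$. On $\mathcal X$ one sets $d_{\mathcal W}(x,y)=\mathcal W(\delta_x,\delta_y)$, where $\delta_x$ is identified with the density $\mathbf 1_{\{x\}}/\pi(x)$. Curvature. Let $\mathcal H(\rho)=\sum_x\pi(x)\rho(x)\log\rho(x)$ (with $0\log0=0$). A constant speed geodesic is a curve $(\rho_t)_{t\in[0,1]}$ with $\mathcal W(\rho_s,\rho_t)=|s-t|\mathcal W(\rho_0,\rho_1)$. For $\kappa\in\mathbb R$, $\mathrm{Ric}(\mathcal X,Q,\pi)\ge\kappa$ means that for every constant speed geodesic $(\rho_t)$ in $(\mathcal P(\mathcal X),\mathcal W)$ and $t\in[0,1]$: $\mathcal H(\rho_t)\le(1-t)\mathcal H(\rho_0)+t\mathcal H(\rho_1)-\frac\kappa2t(1-t)\mathcal W(\rho_0,\rho_1)^2$. $\mathrm{PI}(\lambda)$ means: $\mathrm{Var}_\pi(\psi)\le\frac1\lambda\mathcal E(\psi,\psi)$ for all $\psi\in\mathbb R^{\mathcal X}$, where $\mathrm{Var}_\pi(\psi)=\pi[\psi^2]-\pi[\psi]^2$ and $\mathcal E(\psi,\psi)=\frac12\sum_{x,y}(\psi(y)-\psi(x))^2Q(x,y)\pi(x)$.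 *)

(* Defs.v *)
From mathcomp Require Import all_boot all_order all_algebra.
From mathcomp Require Import all_classical all_reals all_analysis.
Import Order.TTheory GRing.Theory Num.Theory.
Import numFieldNormedType.Exports.

Set Implicit Arguments.
Unset Strict Implicit.
Unset Printing Implicit Defensive.

Local Open Scope classical_set_scope.
Local Open Scope ring_scope.

Definition transition_rates (R : realType) (X : finType) (Q : X -> X -> R) :=
  (forall x y, 0 <= Q x y) /\ (forall x, Q x x = 0).

(* [connect] also relates every point to itself, which is the sequence with
   n = 1 in the definition of irreducibility. *)
Definition irreducible (R : realType) (X : finType) (Q : X -> X -> R) :=
  forall x y, connect [rel a b | 0 < Q a b] x y.

(* The last clause is pi L = 0 for the generator
   L f x = \sum_y Q x y * (f y - f x). *)
Definition stationary (R : realType) (X : finType) (Q : X -> X -> R)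
    (pi : X -> R) :=
  [/\ forall x, 0 < pi x,
      \sum_x pi x = 1 &
      forall y, \sum_x pi x * Q x y = pi y * \sum_x Q y x].

Definition reversible (R : realType) (X : finType) (Q : X -> X -> R)
    (pi : X -> R) :=
  forall x y, Q x y * pi x = Q y x * pi y.

Definition markov_chain (R : realType) (X : finType) (Q : X -> X -> R)
    (pi : X -> R) :=
  [/\ transition_rates Q, irreducible Q, stationary Q pi & reversible Q pi].

Definition density (R : realType) (X : finType) (pi : X -> R) :
    set (X -> R) :=
  [set rho | (forall x, 0 <= rho x) /\ \sum_x rho x * pi x = 1].

Definition delta_density (R : realType) (X : finType) (pi : X -> R) (x : X) :
    X -> R :=
  fun y => (y == x)%:R / pi x.

(* At p = 0 and p = 1 the convention 0 `^ 0 = 1 intervenes when s = 0 or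
   t = 0; this is a null set of p, so log_mean s t = 0 in these cases. *)
Definition log_mean (R : realType) (s t : R) : R :=
  (\int[lebesgue_measure]_(p in `[0%R, 1%R]) (s `^ (1 - p) * t `^ p))%R.

Definition hat (R : realType) (X : finType) (rho : X -> R) (x y : X) : R :=
  log_mean (rho x) (rho y).

(* The usual epsilon-delta definition, over finite families of intervals of
   [a, b] with disjoint interiors. *)
Definition absolutely_continuous (R : realType) (a b : R) (f : R -> R) :=
  forall e : R, 0 < e -> exists2 d : R, 0 < d &
    forall (n : nat) (l r : 'I_n -> R),
      (forall i, a <= l i /\ l i <= r i /\ r i <= b) ->
      trivIset setT (fun i => `]l i, r i[%classic) ->
      \sum_i (r i - l i) < d ->
      \sum_i `|f (r i) - f (l i)| < e.

(* Curves on [0, 1] are functions on R of which only the values on [0, 1]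
   matter (t = 0 and t = 1, where [is_derive] would see values outside, are
   negligible). *)
Definition admissible (R : realType) (X : finType) (Q : X -> X -> R)
    (pi rho0 rho1 : X -> R) (rho psi : R -> X -> R) :=
  [/\ (forall t : R, 0 <= t <= 1 -> density pi (rho t)) /\
      (forall x, absolutely_continuous 0 1 (fun t => rho t x)),
      rho 0 = rho0,
      rho 1 = rho1,
      forall x, measurable_fun `[0 : R, 1] (fun t : R => psi t x) &
      {ae @lebesgue_measure R, forall t : R, 0 <= t <= 1 -> forall x,
        is_derive t 1 (fun s : R => rho s x)
          (- \sum_y (psi t y - psi t x) * hat (rho t) x y * Q x y)}].

Definition action (R : realType) (X : finType) (Q : X -> X -> R)
    (pi : X -> R) (rho psi : R -> X -> R) : \bar R :=
  ((2^-1)%:E * \int[lebesgue_measure]_(t in `[0%R, 1%R])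
    (\sum_x \sum_y
       (psi t x - psi t y) ^+ 2 * hat (rho t) x y * Q x y * pi x)%R%:E)%E.

(* The infimum is taken in the extended reals, so that no convention is needed
   for the infimum of an empty set or for curves of infinite action. *)
Definition transport_dist (R : realType) (X : finType) (Q : X -> X -> R)
    (pi rho0 rho1 : X -> R) : \bar R :=
  sqrte (ereal_inf [set action Q pi c.1 c.2 |
    c in [set c | admissible Q pi rho0 rho1 c.1 c.2]]).

Definition point_dist (R : realType) (X : finType) (Q : X -> X -> R)
    (pi : X -> R) (x y : X) : \bar R :=
  transport_dist Q pi (delta_density pi x) (delta_density pi y).

(* [ln 0 = 0] in the library, and 0 * ln 0 = 0 in any case. *)
Definition entropy (R : realType) (X : finType) (pi rho : X -> R) : R :=
  \sum_x pi x * (rho x * ln (rho x)).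

Definition constant_speed_geodesic (R : realType) (X : finType)
    (Q : X -> X -> R) (pi : X -> R) (rho : R -> X -> R) :=
  (forall t : R, 0 <= t <= 1 -> density pi (rho t)) /\
  (forall s t : R, 0 <= s <= 1 -> 0 <= t <= 1 ->
    transport_dist Q pi (rho s) (rho t) =
      (`|s - t|%R%:E * transport_dist Q pi (rho 0%R) (rho 1%R))%E).

Definition ricci_ge (R : realType) (X : finType) (Q : X -> X -> R)
    (pi : X -> R) (kappa : R) :=
  forall rho : R -> X -> R, constant_speed_geodesic Q pi rho ->
  forall t : R, 0 <= t <= 1 ->
    ((entropy pi (rho t))%:E <=
       ((1 - t) * entropy pi (rho 0) + t * entropy pi (rho 1))%R%:E -
       (kappa / 2 * t * (1 - t))%R%:E *
         transport_dist Q pi (rho 0%R) (rho 1%R) ^+ 2)%E.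

Definition expect (R : realType) (X : finType) (pi f : X -> R) : R :=
  \sum_x f x * pi x.

Definition fin_variance (R : realType) (X : finType) (pi psi : X -> R) : R :=
  expect pi (fun x => psi x ^+ 2) - expect pi psi ^+ 2.

Definition dirichlet (R : realType) (X : finType) (Q : X -> X -> R)
    (pi psi : X -> R) : R :=
  2^-1 * \sum_x \sum_y (psi y - psi x) ^+ 2 * Q x y * pi x.

Definition poincare (R : realType) (X : finType) (Q : X -> X -> R)
    (pi : X -> R) (lambda : R) :=
  forall psi : X -> R, fin_variance pi psi <= lambda^-1 * dirichlet Q pi psi.

Definition gauss_moment (R : realType) (X : finType) (Q : X -> X -> R)
    (pi : X -> R) (alpha : R) (x0 : X) : \bar R :=
  (\sum_x expeR (alpha%:E * point_dist Q pi x x0 ^+ 2) * (pi x)%:E)%E.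

(* Main.v *)
(* A non-negatively curved chain contracts entropy towards equilibrium at a speed
   controlled by the transport distance.  Along a geodesic from mu to the
   constant density 1, convexity of the entropy H and the first variation of H at
   mu give the HWI inequality H(mu) <= (m/2) I(mu) + W(mu,1)^2/(2m) for all
   m > 0, where I is the Fisher information.  By joint convexity of W^2 and the
   Gibbs variational principle, the Gaussian moment bounds W(mu,1)^2 by
   (2 H(mu) + 4 ln D)/alpha, so that H(mu) <= m I(mu) as soon as H(mu) is bounded
   below, for some m depending on alpha and D only.  One implicit Euler step
   J = (1 - h L)^-1 of the heat flow satisfies H(J rho) + h I(J rho) <= H(rho);
   hence for h large the normalized indicator rho of a set S with pi(S) <= 1/2 is
   sent to a density of entropy at most H(rho)/8, which cannot be concentrated on
   S.  So the reversible kernel J escapes from every such S with probability at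
   least 1/8, Cheeger's inequality bounds its spectral gap from below, and the
   Dirichlet form of J is at most h times that of the chain. *)

Require Import Defs.
From HB Require Import structures.
From mathcomp Require Import all_boot all_order all_algebra.
From mathcomp Require Import all_classical all_reals all_analysis.
From mathcomp Require Import measurable_realfun lra ring.
Import Order.TTheory GRing.Theory Num.Theory.
Import numFieldNormedType.Exports.
Set Implicit Arguments.
Unset Strict Implicit.
Unset Printing Implicit Defensive.
Local Open Scope classical_set_scope.
Local Open Scope ring_scope.


(** The curvature hypothesis speaks of constant speed geodesics only, and [transport_dist] is a bare
    infimum over curves: its finiteness, triangle inequality, convexity and geodesics all have to be
    derived. Finiteness comes from the Gaussian moment itself, which bounds the distances of the
    points to [x0]. Metric statements are proved for curves of action at most [c] ([reach]) and
    passed to the infimum afterwards. The delicate one is convexity: the flux of a mixture of curves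
    is not of the form an admissible pair requires, and its replacement has to be measurable in
    time.

    Because of the defect 4 ln D, the bound of entropy by Fisher information says nothing at small
    entropy, so no Poincare inequality can be read off by linearizing it near equilibrium.
    Indicators work because pi(S) <= 1/2 makes their entropy at least ln 2. The implicit Euler step
    stands for the heat semigroup because convexity alone yields its dissipation inequality, for
    every h and without differentiating in time; only a linear system has to be solved. *)

(** * Increments of absolutely continuous functions *)

(** Real induction. The step goes from a point [t0] on the left of [t] to a point [t1] on its right,
    so no closedness of [P] is needed: the supremum is crossed from a point of the set close to
    it. *)
Lemma real_creep (R : realType) (a b : R) (P : R -> Prop) : a <= b -> P a ->
  (forall t, a <= t <= b -> exists2 eta : R, 0 < eta &
    forall t0 t1, a <= t0 <= t -> t <= t1 <= b -> t - eta < t0 ->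
      t1 < t + eta -> P t0 -> P t1) ->
  P b.
Proof.
move=> ab Pa step.
pose S := [set t | a <= t <= b /\ P t].
have Sa : S a by split => //; rewrite lexx ab.
have Sub : ubound S b by move=> t [/andP[_ ->]].
have hS : has_sup S by split; [exists a | exists b].
have as_ : a <= sup S by apply: ub_le_sup => //; exists b.
have sb : sup S <= b by apply: ge_sup => //; exists a.
have /step[eta eta0 H] : a <= sup S <= b by rewrite as_ sb.
have [t0 [/andP[at0 t0b] Pt0] tt0] := sup_adherent eta0 hS.
have t0s : t0 <= sup S by apply: ub_le_sup; [exists b | split => //; rewrite at0 t0b].
have [bs|bs] := ltP b (sup S + eta).
  by apply: (H t0 b) => //; rewrite ?at0 ?t0s ?sb ?lexx.
have : S (sup S + eta / 2).
  split; first by apply/andP; split; lra.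
  by apply: (H t0) => //; rewrite ?at0 ?t0s //; [apply/andP; split; lra|lra].
move=> /(ub_le_sup (ex_intro _ b Sub)); lra.
Qed.

(* Listed from right to left. *)
Fixpoint interval_chain (R : realType) (a : R) (U : set R) (t : R)
    (s : seq (R * R)) : Prop :=
  if s is (l, r) :: s' then
    [/\ a <= l, l <= r, r <= t, `[l, r] `<=` U & interval_chain a U l s']
  else True.

Lemma interval_chain_le (R : realType) (a : R) (U : set R) (t t' : R) s :
  t <= t' -> interval_chain a U t s -> interval_chain a U t' s.
Proof.
by case: s => [//|[l r] s /=] tt' [? ? rt ? ?]; split => //; exact: le_trans tt'.
Qed.

Lemma interval_chain_nth (R : realType) (a : R) (U : set R) (t : R) s i :
  interval_chain a U t s -> (i < size s)%N ->
  a <= (nth (0, 0) s i).1 /\ (nth (0, 0) s i).1 <= (nth (0, 0) s i).2 <= t.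
Proof.
elim: s t i => [//|[l r] s IH] t [|i] /= [al lr rt _ ch].
  by move=> _; rewrite al lr rt.
rewrite ltnS => /(IH _ _ ch)[-> /andP[-> /= ]] h; split => //.
exact: le_trans h (le_trans lr rt).
Qed.

Lemma interval_chain_disjoint (R : realType) (a : R) (U : set R) (t : R) s i j :
  interval_chain a U t s -> (i < j < size s)%N ->
  (nth (0, 0) s j).2 <= (nth (0, 0) s i).1.
Proof.
elim: s t i j => [|[l r] s IH] t i [|j] /=; rewrite ?ltn0 ?andbF //.
move=> [al lr rt _ ch]; case: i => [|i] /=; rewrite !ltnS; last exact: IH ch.
by move=> /(interval_chain_nth ch)[_ /andP[]].
Qed.

Lemma interval_chain_measure (R : realType) (a : R) (U : set R) (t : R) s :
  measurable U -> interval_chain a U t s ->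
  ((\sum_(p <- s) (p.2 - p.1))%:E <= lebesgue_measure (U `&` `]-oo, t]))%E.
Proof.
move=> mU; elim: s t => [|[l r] s IH] t /=; first by rewrite big_nil.
move=> [al lr rt lrU /IH h]; rewrite big_cons /= EFinD.
(* Half-open, hence disjoint from []-oo, l]], where the rest of the chain lies; consecutive
   intervals may share an endpoint. *)
have -> : (r - l)%:E = lebesgue_measure (`]l, r] : set R).
  rewrite lebesgue_measure_itv /= lte_fin.
  by case: ltgtP lr => // -> _; rewrite subrr.
apply: (@le_trans _ _ (lebesgue_measure (`]l, r] `|` (U `&` `]-oo, l])))).
  rewrite measureU //=; first by rewrite leeD2l.
    by apply: measurableI.
  apply/seteqP; split => // x /= [] /[!in_itv] /= /andP[lx _] [_ xl].
  by move: (lt_le_trans lx xl); rewrite ltxx.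
apply: le_measure; rewrite ?inE //=.
- by apply: measurableU => //; exact: measurableI.
- exact: measurableI.
move=> x [|[Ux]] /=; rewrite !in_itv /=.
  move=> /andP[lx xr]; split; last exact: le_trans xr rt.
  by apply: lrU; rewrite /= in_itv /= xr ltW.
by move=> xl; split => //; exact: le_trans xl (le_trans lr rt).
Qed.

(** [d] depends neither on the number nor on the position of the intervals, so the smallness of [U]
    alone controls every chain inside it. *)
Lemma ac_interval_chain (R : realType) (a b : R) (f : R -> R) (e : R) :
  absolutely_continuous a b f -> 0 < e -> exists2 d : R, 0 < d &
  forall (U : set R) s, open U -> (lebesgue_measure U < d%:E)%E ->
    interval_chain a U b s -> \sum_(p <- s) `|f p.2 - f p.1| < e.
Proof.
move=> acf /acf[d d0 H]; exists d => // U s oU Ud ch.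
have := H (size s) (fun i => (nth (0, 0) s i).1) (fun i => (nth (0, 0) s i).2).
rewrite !(big_nth (0, 0)) !big_mkord; apply.
- move=> i; have [-> /andP[-> ->]] := interval_chain_nth ch (ltn_ord i).
  by [].
- move=> i j _ _ [x [/=]]; rewrite !in_itv /= => /andP[ix xi] /andP[jx xj].
  apply/val_inj/eqP; case: (ltngtP i j) => // ij.
    have := @interval_chain_disjoint _ _ _ _ _ i j ch.
    rewrite ij ltn_ord => /(_ isT) h.
    by move: (lt_trans (lt_le_trans xj h) ix); rewrite ltxx.
  have := @interval_chain_disjoint _ _ _ _ _ j i ch.
  rewrite ij ltn_ord => /(_ isT) h.
  by move: (lt_trans (lt_le_trans xi h) jx); rewrite ltxx.
- rewrite -lte_fin; apply: le_lt_trans Ud.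
  have mU : measurable U by exact: open_measurable.
  have := interval_chain_measure mU ch.
  rewrite (big_nth (0, 0)) big_mkord => /le_trans; apply.
  apply: le_measure; rewrite ?inE //; first by apply: measurableI.
Qed.

(** The one-sided bounds at [x] add up to a bound over intervals straddling [x], the form that
    [real_creep] asks for. *)
Lemma derive_le_slope (R : realType) (f : R -> R) (x d e : R) :
  is_derive x 1 f d -> d < e -> exists2 eta : R, 0 < eta &
  forall s t, x - eta < s <= x -> x <= t < x + eta ->
    f t - f s <= e * (t - s).
Proof.
move=> [df dfv] de.
have : (fun h => h^-1 *: ((f \o shift x) (h *: 1) - f x)) @ 0^' --> d.
  by rewrite -dfv; exact: df.
move=> /cvgr_lt /(_ _ de).
rewrite near_withinE => /nbhs_ballP[eta /= eta0 H].
exists eta => // s t /andP[xs sx] /andP[xt tx].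
have key h : `|h| < eta -> h != 0 -> h^-1 * (f (h + x) - f x) < e.
  move=> heta h0; have := H h; rewrite /ball /= sub0r normrN => /(_ heta h0).
  by rewrite /= [_ *: 1]mulr1.
have h1 : f t - f x <= e * (t - x).
  have [->|tx0] := eqVneq t x; first by rewrite !subrr mulr0.
  have tx1 : 0 < t - x by rewrite subr_gt0 lt_neqAle eq_sym tx0.
  have := @key (t - x); rewrite subrK gtr0_norm // => /(_ _ _)/ltW.
  by rewrite mulrC ler_pdivrMr //; apply; [lra | rewrite gt_eqF].
have h2 : f x - f s <= e * (x - s).
  have [->|sx0] := eqVneq s x; first by rewrite !subrr mulr0.
  have sx1 : s - x < 0 by rewrite subr_lt0 lt_neqAle sx0.
  have := @key (s - x); rewrite subrK ltr0_norm // => /(_ _ _)/ltW.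
  rewrite mulrC ler_ndivrMr // => h.
  have : e * (s - x) <= f s - f x by apply: h; [lra | rewrite lt_eqF].
  lra.
lra.
Qed.

(* Off a null set the slope of [g] exceeds that of the primitive of [k] by at most
   [e]; that null set is covered by an open set so small that [g] varies by less
   than [e] over any chain of intervals in it. *)
Lemma ac_increment (R : realType) (a b : R) (g k : R -> R) :
  a <= b -> absolutely_continuous a b g ->
  (@lebesgue_measure R).-integrable `[a, b] (EFin \o k) ->
  (forall t, a <= t <= b -> 0 <= k t) ->
  {ae @lebesgue_measure R, forall t, a <= t <= b ->
    exists2 d : R, is_derive t 1 g d & d <= k t} ->
  g b - g a <= \int[lebesgue_measure]_(t in `[a, b]) k t.
Proof.
move=> ab acg ik k0 dg.
pose mu : {measure set (measurableTypeR R) -> \bar R} := @lebesgue_measure R.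
(* Cut off outside the segment, [k] has a primitive [K] that is monotone on the whole line. *)
pose kr := k \_ `[a, b].
have kr0 t : 0 <= kr t.
  rewrite /kr patchE; case: ifPn => // /set_mem /=; rewrite in_itv /=.
  exact: k0.
have ikr : mu.-integrable setT (EFin \o kr).
  by move: ik; rewrite integrable_mkcond //= (restrict_EFin k).
have ikr' y : mu.-integrable [set` Interval (BLeft a) (BRight y)] (EFin \o kr).
  by apply: integrableS ikr.
have locr : locally_integrable setT kr.
  by apply: integrable_locally_restrict.
pose K y := \int[mu]_(t in [set` Interval (BLeft a) (BRight y)]) kr t.
have Kmono s t : s <= t -> K s <= K t.
  move=> st; rewrite /K /Rintegral; apply: fine_le.
  - exact: integrable_fin_num.
  - exact: integrable_fin_num.
  apply: ge0_subset_integral => //=.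
  - by case/integrableP: (ikr' t).
  - by move=> x _; rewrite lee_fin.
  - by apply: subset_itvl; rewrite bnd_simp.
have Kb : K b = \int[mu]_(t in `[a, b]) k t.
  apply: eq_Rintegral => t ht; rewrite /kr patchE ht //.
have Ka : K a = 0.
  rewrite /K set_itv1 /Rintegral integral_set1 //.
have := FTC1 ikr' locr; rewrite -/K => dK.
have {dg dK} : {ae mu, forall t, a < t < b ->
    exists2 d : R, is_derive t 1 (g \- K) d & d <= 0}.
  move: dg dK; apply: filterS2; first exact: (ae_filter_ringOfSetsType mu).
  move=> t h1 h2 /andP[at_ tb].
  have tab : a <= t <= b by rewrite !ltW.
  have [d dd dk] := h1 tab.
  have [|dK1 dK2] := h2; first by rewrite lte_fin.
  exists (d - kr t).
    have dKt : is_derive t 1 K (kr t) by apply: (DeriveDef dK1); rewrite -derive1E dK2.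
    exact: (is_deriveB dd dKt).
  by rewrite /kr patchE mem_set /= ?in_itv //= subr_le0.
move=> [N [mN N0 Nsub]].
rewrite -Kb -[K b]subr0 -Ka.
suff: forall e, 0 < e -> (g b - g a) - (K b - K a) <= e * (b - a) + e.
  move=> H; rewrite -subr_le0; apply/ler_addgt0Pr => e e0; rewrite add0r.
  have c0 : 0 < (b - a) + 1 by rewrite ltr_wpDl // subr_ge0.
  have := H (e / ((b - a) + 1)) (divr_gt0 e0 c0).
  by rewrite -[X in _ <= _ + X]mulr1 -mulrDr divfK // gt_eqF.
move=> e e0.
have [d d0 Hd] := ac_interval_chain acg e0.
(* The slope comparison covers only [a < t < b], so the endpoints join the exceptional set. *)
have [U [oU NU Ud]] : exists U : set R, [/\ open U, N `|` [set a; b] `<=` U &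
    (mu U < d%:E)%E].
  have mNab : measurable (N `|` [set a; b]).
    by apply: measurableU => //; apply: measurableU.
  have N00 : mu (N `|` [set a; b]) = 0%E.
    apply/eqP; rewrite eq_le measure_ge0 andbT; apply: (le_trans (measureU2 _ _ _)) => //.
      exact: measurableU.
    rewrite [X in (X + _)%E]N0 add0e; apply: (le_trans (measureU2 _ _ _)) => //.
    have s1 x : mu [set x] = 0%E := lebesgue_measure_set1 x.
    have s2 : (mu [set a] + mu [set b] <= 0)%E by rewrite !s1 add0e.
    exact: s2.
  have [|U [oU NU Ud]] := lebesgue_regularity_outer mNab _ d0.
    by rewrite N00 ltry.
  exists U; split => //; rewrite -(setDKU NU) (le_lt_trans (measureU2 _ _ _)) //.
    by apply: measurableD => //; exact: open_measurable.
  by rewrite [X in (_ + X)%E]N00 adde0.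
(* The statement to propagate. At a point of [U] the interval crossed joins the chain, at the cost
   of the variation of [g] over it; at any other point the slope of [g - K] is at most [e]. *)
pose Pr t := exists2 s, interval_chain a U t s &
  (g t - g a) - (K t - K a) <= e * (t - a) + \sum_(p <- s) `|g p.2 - g p.1|.
have [s ch hs] : Pr b; last first.
  apply: (le_trans hs); rewrite lerD2l; apply/ltW; exact: Hd ch.
apply: (real_creep ab).
  by exists [::] => //; rewrite big_nil !subrr mulr0 addr0.
move=> t /andP[at_ tb].
have [Ut|nUt] := pselect (U t).
  have [eta /= eta0 etaU] : exists2 eta, 0 < eta & ball t eta `<=` U.
    by apply/nbhs_ballP; exact: open_nbhs_nbhs.
  exists eta => // t0 t1 /andP[at0 t0t] /andP[tt1 t1b] h0 h1 [s ch hs].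
  exists ((t0, t1) :: s).
    split => //=; first exact: le_trans t0t tt1.
    move=> x /=; rewrite in_itv /= => /andP[t0x xt1]; apply: etaU.
    by rewrite /ball /= ltr_distlC; apply/andP; split; lra.
  rewrite big_cons /=.
  have := Kmono t0 t1 (le_trans t0t tt1).
  have := ler_norm (g t1 - g t0).
  have : e * (t0 - a) <= e * (t1 - a).
    by rewrite ler_pM2l //; lra.
  lra.
have tab : a < t < b.
  rewrite !lt_neqAle at_ tb !andbT; apply/andP; split.
    apply/eqP => E; apply: nUt; apply: NU; right; left; by rewrite E.
  by apply/eqP => E; apply: nUt; apply: NU; right; right; rewrite E.
have [d' dd dl0] : exists2 d : R, is_derive t 1 (g \- K) d & d <= 0.
  apply: contrapT => h; apply: nUt; apply: NU; left; apply: Nsub => /= h'.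
  by apply: h; exact: h'.
have [eta eta0 Heta] := derive_le_slope dd (le_lt_trans dl0 e0).
exists eta => // t0 t1 /andP[at0 t0t] /andP[tt1 t1b] h0 h1 [s ch hs].
exists s; first exact: interval_chain_le (le_trans t0t tt1) ch.
have := Heta t0 t1; rewrite h0 t0t tt1 h1 => /(_ isT isT) /=.
lra.
Qed.

(** * Affine changes of variables *)

Section affine_substitution.
Context (R : realType) (p q : R) (q0 : q != 0).
Let phi (u : R) : R := p + q * u.
Let mu : {measure set (measurableTypeR R) -> \bar R} := @lebesgue_measure R.

Let qsgn : 0 < q \/ q < 0.
Proof. by move: q0; rewrite neq_lt => /orP[]; [right|left]. Qed.

Lemma measurable_affine : measurable_fun setT (phi : measurableTypeR R -> measurableTypeR R).
Proof. by apply: measurable_funD => //; exact: measurable_funM. Qed.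

(** The pushforward by [phi], scaled by [|q|], agrees with Lebesgue measure on half-open intervals,
    which determine it. Negative [q] serves time reversal and the symmetry of the logarithmic
    mean. *)
Lemma lebesgue_measure_affine (A : set R) : measurable A ->
  ((`|q|)%:E * @lebesgue_measure R (phi @^-1` A) = @lebesgue_measure R A)%E.
Proof.
have q0' : 0 <= `|q| by [].
pose k := NngNum q0'.
pose mphi_mixin := isMeasurableFun.Build _ _ _ _ _ measurable_affine.
pose mphi : {mfun measurableTypeR R >-> measurableTypeR R} := HB.pack phi mphi_mixin.
have nuE B : mscale k (pushforward mu mphi) B = ((`|q|)%:E * @lebesgue_measure R (phi @^-1` B))%E by [].
move=> mA; rewrite -nuE; apply/esym.
apply: (@lebesgue_measure_unique R (mscale k (pushforward mu mphi))) => //.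
move=> _ [[a b] _ <-] /=.
rewrite [RHS]nuE.
have [qp|qn]:= qsgn.
  have -> : phi @^-1` `]a, b] = `](a - p) / q, (b - p) / q]%classic.
    apply/seteqP; split => x /=; rewrite !in_itv /= ltr_pdivrMr // ler_pdivlMr //;
      rewrite /phi mulrC => /andP[? ?]; apply/andP; split; lra.
  rewrite !lebesgue_measure_itv /= !lte_fin ltr_pM2r ?invr_gt0 // ltrD2r.
  case: ifP => _; last by rewrite mule0.
  by rewrite -!EFinD -EFinM gtr0_norm //; congr (_%:E); field.
have -> : phi @^-1` `]a, b] = `[(b - p) / q, (a - p) / q[%classic.
  apply/seteqP; split => x /=; rewrite !in_itv /= ltr_ndivlMr // ler_ndivrMr //;
    rewrite /phi mulrC => /andP[? ?]; apply/andP; split; lra.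
rewrite !lebesgue_measure_itv /= !lte_fin ltr_nM2r ?invr_lt0 // ltrD2r.
case: ifP => _; last by rewrite mule0.
by rewrite -!EFinD -EFinM ltr0_norm //; congr (_%:E); field.
Qed.

Lemma ge0_integral_affine (D : set R) (f : R -> \bar R) :
  measurable D -> measurable_fun D f -> (forall t, D t -> 0 <= f t)%E ->
  ((`|q|)%:E * \int[lebesgue_measure]_(u in phi @^-1` D) f (phi u) =
   \int[lebesgue_measure]_(t in D) f t)%E.
Proof.
move=> mD mf f0.
have q0' : 0 <= `|q| by [].
pose k := NngNum q0'.
pose mphi_mixin := isMeasurableFun.Build _ _ _ _ _ measurable_affine.
pose mphi : {mfun measurableTypeR R >-> measurableTypeR R} := HB.pack phi mphi_mixin.
rewrite [RHS](eq_measure_integral (mscale k (pushforward mu mphi))); last first.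
  by move=> A mA _; rewrite -[LHS]lebesgue_measure_affine.
rewrite ge0_integral_mscale //=.
rewrite (ge0_integral_pushforward measurable_affine) //.
by move=> x /set_mem; exact: f0.
Qed.

Lemma ae_affine (P : set R) :
  {ae @lebesgue_measure R, forall t, P t} ->
  {ae @lebesgue_measure R, forall u, P (phi u)}.
Proof.
move=> [N [mN N0 NP]]; exists (phi @^-1` N); split.
- by rewrite -[X in measurable X]setTI; apply: measurable_affine.
- have := lebesgue_measure_affine mN; rewrite N0 => /eqP.
  by rewrite mule_eq0 eqe normr_eq0 (negbTE q0) /= => /eqP.
- by move=> u; exact: NP.
Qed.

Lemma measurable_fun_affine (D : set R) (f : R -> R) : measurable D ->
  measurable_fun D f -> measurable_fun (phi @^-1` D) (f \o phi).
Proof.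
move=> mD mf; apply: (measurable_comp mD _ mf); first by move=> _ [x Dx <-].
exact: (measurable_funS measurableT (@subsetT _ _) measurable_affine).
Qed.

Lemma is_derive_affine (f : R -> R) (u d : R) : is_derive (phi u) 1 f d ->
  is_derive u 1 (fun u => f (phi u)) (q * d).
Proof.
move=> df.
have dphi : is_derive u 1 phi q.
  rewrite /phi; apply: is_derive_eq.
  by rewrite add0r; rewrite /GRing.scale /=; lra.
have := is_derive1_comp df dphi.
by rewrite mulrC.
Qed.

Lemma ac_affine (a b c d : R) (f : R -> R) :
  absolutely_continuous a b f ->
  (forall u, c <= u <= d -> a <= phi u <= b) ->
  absolutely_continuous c d (fun u => f (phi u)).
Proof.
move=> acf cd e /acf[dl dl0 H].
have nq : 0 < `|q| by rewrite normr_gt0.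
exists (dl / `|q|); first exact: divr_gt0.
move=> n l r lr tr sm.
have bd i : (a <= phi (l i) <= b) /\ (a <= phi (r i) <= b).
  have [h1 [h2 h3]] := lr i.
  by split; apply: cd; rewrite ?h1 ?h3 ?(le_trans h2) ?(le_trans h1).
have sm' : \sum_i `|q| * (r i - l i) < dl.
  by rewrite -mulr_sumr mulrC -ltr_pdivlMr.
have [qp|qn] := qsgn.
- apply: (H n (phi \o l) (phi \o r)).
  + move=> i; have [/andP[-> _] /andP[_ ->]] := bd i; have [_ [lri _]] := lr i.
    by rewrite /= /phi lerD2l ler_pM2l.
  + move=> i j _ _ [x [/=]]; rewrite !in_itv /= => hi hj; apply: tr => //.
    exists ((x - p) / q); split => /=; rewrite in_itv /= ltr_pdivlMr // ltr_pdivrMr //;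
      [move: hi|move: hj]; rewrite /phi => /andP[? ?]; apply/andP; split; lra.
  + apply: le_lt_trans sm'; apply: ler_sum => i _ /=.
    by rewrite /phi gtr0_norm //; lra.
- under eq_bigr do rewrite distrC.
  apply: (H n (phi \o r) (phi \o l)).
  + move=> i; have [/andP[_ ->] /andP[-> _]] := bd i; have [_ [lri _]] := lr i.
    by rewrite /= /phi lerD2l ler_nM2l.
  + move=> i j _ _ [x [/=]]; rewrite !in_itv /= => hi hj; apply: tr => //.
    exists ((x - p) / q); split => /=; rewrite in_itv /= ltr_ndivlMr // ltr_ndivrMr //;
      [move: hi|move: hj]; rewrite /phi => /andP[? ?]; apply/andP; split; lra.
  + apply: le_lt_trans sm'; apply: ler_sum => i _ /=.
    by rewrite /phi ltr0_norm //; lra.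
Qed.

End affine_substitution.

(** * Operations on absolutely continuous functions *)

Lemma ac_sub (R : realType) (a b c d : R) (f : R -> R) :
  a <= c -> d <= b -> absolutely_continuous a b f -> absolutely_continuous c d f.
Proof.
move=> ac db acf e /acf[dl dl0 H]; exists dl => // n l r lr; apply: H => i.
by have [h1 [h2 h3]] := lr i; rewrite (le_trans ac) // h2 (le_trans h3).
Qed.

Lemma eq_ac (R : realType) (a b : R) (f g : R -> R) :
  (forall t, a <= t <= b -> f t = g t) ->
  absolutely_continuous a b f -> absolutely_continuous a b g.
Proof.
move=> fg acf e /acf[dl dl0 H]; exists dl => // n l r lr tr sm.
apply: le_lt_trans (H n l r lr tr sm); apply: ler_sum => i _.
have [h1 [h2 h3]] := lr i.
by rewrite !fg ?h1 ?h3 ?andbT //; [exact: le_trans h3 | exact: le_trans h2].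
Qed.

Lemma ac_cst (R : realType) (a b c : R) : absolutely_continuous a b (fun=> c).
Proof.
by move=> e e0; exists 1 => // n l r _ _ _; rewrite big1 // => i _; rewrite subrr normr0.
Qed.

Lemma ac_scale (R : realType) (a b c : R) (f : R -> R) :
  absolutely_continuous a b f -> absolutely_continuous a b (fun t => c * f t).
Proof.
move=> acf e e0; have c0 : 0 < `|c| + 1 by rewrite ltr_wpDl.
have [dl dl0 H] := acf _ (divr_gt0 e0 c0).
exists dl => // n l r lr tr sm; have := H n l r lr tr sm.
rewrite ltr_pdivlMr // => /(le_lt_trans _); apply.
rewrite mulr_suml; apply: ler_sum => i _; rewrite -mulrBr normrM mulrC.
by rewrite ler_wpM2l // lerDl.
Qed.

Lemma ac_add (R : realType) (a b : R) (f g : R -> R) :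
  absolutely_continuous a b f -> absolutely_continuous a b g ->
  absolutely_continuous a b (fun t => f t + g t).
Proof.
move=> acf acg e e0; have e2 : 0 < e / 2 by rewrite divr_gt0.
have [d1 d10 H1] := acf _ e2; have [d2 d20 H2] := acg _ e2.
exists (Num.min d1 d2); first by rewrite lt_min d10.
move=> n l r lr tr; rewrite lt_min => /andP[/(H1 n l r lr tr) h1 /(H2 n l r lr tr) h2].
rewrite [e]splitr; apply: le_lt_trans (ltrD h1 h2).
rewrite -big_split /=; apply: ler_sum => i _.
by rewrite opprD addrACA ler_normD.
Qed.

Lemma ac_sum (R : realType) (I : finType) (a b : R) (f : I -> R -> R) :
  (forall i, absolutely_continuous a b (f i)) ->
  absolutely_continuous a b (fun t => \sum_i f i t).
Proof.
move=> acf; elim: (index_enum I) => [|i s IH].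
  by apply: eq_ac (ac_cst a b 0) => t _; rewrite big_nil.
by apply: eq_ac (ac_add (acf i) IH) => t _; rewrite big_cons.
Qed.

Lemma ac_concat (R : realType) (a b c : R) (f g : R -> R) : a <= b <= c ->
  absolutely_continuous a b f -> absolutely_continuous b c g -> f b = g b ->
  absolutely_continuous a c (fun t => if t <= b then f t else g t).
Proof.
move=> /andP[ab bc] acf acg fg e e0; have e2 : 0 < e / 2 by rewrite divr_gt0.
have [d1 d10 H1] := acf _ e2; have [d2 d20 H2] := acg _ e2.
exists (Num.min d1 d2); first by rewrite lt_min d10.
move=> n l r lr tr; rewrite lt_min => /andP[s1 s2].
(* Each interval is cut at [b]: [min] keeps its left part and [max] its right part, one of them
   possibly degenerate. *)
have {}H1 : \sum_i `|f (Num.min (r i) b) - f (Num.min (l i) b)| < e / 2.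
  apply: H1.
  - move=> i; have [h1 [h2 h3]] := lr i.
    by rewrite !le_min !ge_min h1 ab h2 lexx !orbT.
  - move=> i j _ _ [x [/= hi hj]]; apply: tr => //; exists x; split => /=;
      [move: hi|move: hj]; rewrite !in_itv /= gt_min lt_min => /andP[h1 /andP[-> h2]];
      by rewrite andbT; case/orP: h1 => // /lt_trans /(_ h2); rewrite ltxx.
  - apply: le_lt_trans s1; apply: ler_sum => i _; have [h1 [h2 h3]] := lr i.
    by rewrite !minEle; case: (leP (r i) b) => ?; case: (leP (l i) b) => ?; lra.
have {}H2 : \sum_i `|g (Num.max (r i) b) - g (Num.max (l i) b)| < e / 2.
  apply: H2.
  - move=> i; have [h1 [h2 h3]] := lr i.
    by rewrite !ge_max !le_max h3 bc h2 lexx !orbT.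
  - move=> i j _ _ [x [/= hi hj]]; apply: tr => //; exists x; split => /=;
      [move: hi|move: hj]; rewrite !in_itv /= gt_max lt_max => /andP[/andP[-> h1] h2];
      by case/orP: h2 => // /(lt_trans h1); rewrite ltxx.
  - apply: le_lt_trans s2; apply: ler_sum => i _; have [h1 [h2 h3]] := lr i.
    by rewrite !maxEle; case: (leP (r i) b) => ?; case: (leP (l i) b) => ?; lra.
rewrite [e]splitr; apply: le_lt_trans (ltrD H1 H2).
rewrite -big_split /=; apply: ler_sum => i _; have [h1 [h2 h3]] := lr i.
have hE t : (if t <= b then f t else g t) = f (Num.min t b) + g (Num.max t b) - f b.
  by rewrite minEle maxEle; case: ifP => _; rewrite ?fg; lra.
rewrite !hE; apply: le_trans (ler_normD _ _); rewrite le_eqVlt; apply/orP; left.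
by apply/eqP; congr `|_|; ring.
Qed.

Lemma ac_measurable (R : realType) (a b : R) (f : R -> R) :
  absolutely_continuous a b f -> measurable_fun `[a, b] f.
Proof.
move=> acf; have [ba|ab] := ltP b a.
  by rewrite set_itv_ge; [exact: measurable_fun_set0 | rewrite bnd_simp -ltNge].
(* Clamping to [[a, b]] is 1-Lipschitz, so [f \o cl] is continuous on the whole line; families of
   one interval suffice for this. *)
pose cl t := Num.max a (Num.min b t).
have : measurable_fun `[a, b] (f \o cl).
  apply: measurable_funTS; apply: continuous_measurable_fun => t.
  apply/cvgrPdist_lt => e /acf[dl dl0 H].
  near=> s; have st : `|t - s| < dl by near: s; exact: cvgr_dist_lt.
  have := H 1%N (fun=> cl (Num.min s t)) (fun=> cl (Num.max s t)).
  rewrite !big_ord1.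
  have clab u : a <= cl u <= b.
    by rewrite /cl le_max ge_max lexx ge_min lexx ab.
  have clmono u v : u <= v -> cl u <= cl v /\ cl v - cl u <= v - u.
    move=> uv; have E w : cl w = if w <= a then a else if b <= w then b else w.
      rewrite /cl; case: (leP w a) => wa.
        by apply/max_idPl; rewrite ge_min wa orbT.
      case: (leP b w) => wb; first by rewrite (max_idPr ab).
      by rewrite (max_idPr (ltW wa)).
    rewrite !E; case: (leP u a) => ?; case: (leP v a) => ?;
      case: (leP b u) => ?; case: (leP b v) => ?; split; lra.
  have tr : trivIset setT (fun _ : 'I_1 => `](cl (Num.min s t)), (cl (Num.max s t))[%classic).
    by move=> i j _ _ _; rewrite (ord1 i) (ord1 j).
  move=> /(_ _ tr).
  have [h1 h2] : cl (Num.min s t) <= cl (Num.max s t) /\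
      cl (Num.max s t) - cl (Num.min s t) < dl.
    have [? ?] : cl (Num.min s t) <= cl (Num.max s t) /\ cl (Num.max s t) - cl (Num.min s t) <=
      Num.max s t - Num.min s t by apply: clmono; rewrite le_max ge_min lexx.
    split => //; apply: le_lt_trans st; apply: (le_trans (y := Num.max s t - Num.min s t)) => //.
    by case: (leP s t) => ?; rewrite ?ler_norm // distrC ler_norm.
  move=> /(_ _ h2); rewrite distrC /=.
  have -> : `|f (cl (Num.min s t)) - f (cl (Num.max s t))| = `|f (cl t) - f (cl s)|.
    by case: (leP s t) => _ //; rewrite distrC.
  apply => i; have /andP[-> _] := clab (Num.min s t); have /andP[_ ->] := clab (Num.max s t).
  by [].
by apply: eq_measurable_fun => t /set_mem; rewrite /= in_itv /= => /andP[at_ tb];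
  rewrite /cl (min_idPr tb) (max_idPr at_).
Unshelve. all: by end_near.
Qed.

(** * The logarithmic mean *)

(** Written as [x / x ^+ 2], the inverse reduces to a power of a nonnegative number; at 0 both sides
    vanish. *)
Lemma measurable_invr (R : realType) : measurable_fun setT (fun x : R => x^-1).
Proof.
have : measurable_fun setT (fun x : R => x * (x ^+ 2) `^ (-1)).
  apply: measurable_funM => //; apply: (measurableT_comp (measurable_powR (-1))).
  exact: measurable_funX.
apply: eq_measurable_fun => x _; rewrite powR_inv1 ?sqr_ge0 //.
have [->|x0] := eqVneq x 0; first by rewrite mul0r invr0.
by rewrite expr2 invfM mulrA divff // mul1r.
Qed.

Section log_mean_theory.
Context (R : realType).
Implicit Types s t p : R.
Let mu : {measure set (measurableTypeR R) -> \bar R} := @lebesgue_measure R.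
Let lmi s t p := s `^ (1 - p) * t `^ p.

Let lmi_ge0 s t p : 0 <= lmi s t p.
Proof. by rewrite mulr_ge0 ?powR_ge0. Qed.

Let lmi_0 s t : 0 <= s -> lmi s t 0 = s.
Proof. by move=> s0; rewrite /lmi subr0 powRr1 // powRr0 mulr1. Qed.

Let lmi_1 s t : 0 <= t -> lmi s t 1 = t.
Proof. by move=> t0; rewrite /lmi subrr powRr1 // powRr0 mul1r. Qed.

Let lmi_pos s t p : 0 < s -> 0 < t ->
  lmi s t p = expR (ln s + p * (ln t - ln s)).
Proof.
move=> s0 t0; rewrite /lmi /powR !gt_eqF // -expRD; congr expR; ring.
Qed.

Let lmi_amgm s t p : 0 <= s -> 0 <= t -> 0 <= p <= 1 ->
  lmi s t p <= (1 - p) * s + p * t.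
Proof.
move=> s0 t0 /andP[p0 p1].
have [->|pn0] := eqVneq p 0; first by rewrite lmi_0 // subr0 mul1r mul0r addr0.
have [->|pn1] := eqVneq p 1; first by rewrite lmi_1 // subrr mul1r mul0r add0r.
have h0 : 0 <= (1 - p) * s + p * t by rewrite addr_ge0 ?mulr_ge0 // subr_ge0.
have [sz|sn0] := eqVneq s 0.
  by move: h0; rewrite sz => h0; rewrite /lmi powR0 ?mul0r // subr_eq0 eq_sym.
have [tz|tn0] := eqVneq t 0.
  by move: h0; rewrite tz => h0; rewrite /lmi powR0 // [leLHS]mulr0.
have sp : 0 < s by rewrite lt_neqAle eq_sym sn0.
have tp : 0 < t by rewrite lt_neqAle eq_sym tn0.
rewrite lmi_pos //; set u := ln s + _.
(* The tangent of the exponential at the logarithm [u] of the geometric mean. In the weighted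
   average of the two instances the linear terms cancel. *)
have tangent x : 0 < x -> expR u * (1 + (ln x - u)) <= x.
  move=> x0; rewrite -{2}[x]lnK ?posrE // -{2}(subrK u (ln x)) [X in _ <= X]expRD.
  by rewrite [X in _ <= X]mulrC ler_wpM2l ?expR_ge0 ?expR_ge1Dx.
have h1 := tangent _ sp; have h2 := tangent _ tp.
have u0 : (1 - p) * (ln s - u) + p * (ln t - u) = 0 by rewrite /u; ring.
have -> : expR u = (1 - p) * (expR u * (1 + (ln s - u))) +
    p * (expR u * (1 + (ln t - u))).
  transitivity (expR u * (1 + ((1 - p) * (ln s - u) + p * (ln t - u)))).
    by rewrite u0 addr0 mulr1.
  by ring.
by rewrite lerD // ler_wpM2l // subr_ge0.
Qed.

Let lmi_measurable s t : measurable_fun setT (lmi s t).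
Proof.
apply: measurable_funM; last exact: measurable_powRr.
by apply: (measurableT_comp (measurable_powRr s)); exact: measurable_funB.
Qed.

Let lmi_integrable s t : 0 <= s -> 0 <= t ->
  mu.-integrable `[0, 1] (EFin \o lmi s t).
Proof.
move=> s0 t0; apply: measurable_bounded_integrable => //.
- by rewrite [mu _]lebesgue_measure_itv /= lte_fin ltr01 -EFinD ltry.
- exact: measurable_funTS (lmi_measurable s t).
exists (s + t); split; first exact: num_real.
move=> M sM x /=; rewrite in_itv /= => /andP[x0 x1].
rewrite ger0_norm ?lmi_ge0 //; apply: le_trans (lmi_amgm s0 t0 _) _; first by rewrite x0.
apply: le_trans (ltW sM); apply: lerD; rewrite ler_piMl //; lra.
Qed.

Let lmE s t : log_mean s t = \int[mu]_(p in `[0%R, 1%R]) lmi s t p.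
Proof. by []. Qed.

Lemma log_mean_ge0 s t : 0 <= log_mean s t.
Proof. by apply: Rintegral_ge0 => p _; exact: lmi_ge0. Qed.

Lemma log_meanC s t : log_mean s t = log_mean t s.
Proof.
rewrite !lmE /Rintegral; congr fine.
have h := @ge0_integral_affine R 1 (-1) _ `[0, 1] (EFin \o lmi s t).
rewrite -[LHS]h //=.
- rewrite normrN normr1 mul1e.
  have -> : (fun u : R => 1 + -1 * u) @^-1` `[0, 1] = `[0%R, 1%R]%classic.
    by apply/seteqP; split => x /=; rewrite !in_itv /= => /andP[? ?]; apply/andP; split; lra.
  apply: eq_integral => p _; congr (_%:E); rewrite /lmi mulrC.
  by congr (_ `^ _ * _ `^ _); lra.
- by apply/measurable_EFinP; exact: measurable_funTS (lmi_measurable s t).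
- by move=> p _; rewrite lee_fin.
Qed.

Lemma le_log_mean s s' t t' : 0 <= s -> 0 <= t -> s <= s' -> t <= t' ->
  log_mean s t <= log_mean s' t'.
Proof.
move=> s0 t0 ss tt; rewrite !lmE; apply: le_Rintegral => //.
- exact: lmi_integrable.
- by apply: lmi_integrable; [exact: le_trans ss | exact: le_trans tt].
move=> p /=; rewrite in_itv /= => /andP[p0 p1]; apply: ler_pM; rewrite ?powR_ge0 //.
  by apply: ge0_ler_powR; rewrite ?nnegrE ?subr_ge0 // (le_trans s0).
by apply: ge0_ler_powR; rewrite ?nnegrE ?subr_ge0 // (le_trans t0).
Qed.

Lemma log_mean_le s t : 0 <= s -> 0 <= t -> log_mean s t <= s + t.
Proof.
move=> s0 t0; rewrite lmE.
have -> : s + t = \int[mu]_(p in `[0%R, 1%R]) (s + t).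
  by rewrite Rintegral_cst // [mu _]lebesgue_measure_itv /= lte_fin ltr01 /= subr0 mulr1.
apply: le_Rintegral => //; first exact: lmi_integrable.
  apply: measurable_bounded_integrable => //.
    by rewrite [mu _]lebesgue_measure_itv /= lte_fin ltr01 -EFinD ltry.
  exists (s + t); split; first exact: num_real.
  by move=> M sM x /= _; rewrite ger0_norm ?addr_ge0 // ltW.
move=> p /=; rewrite in_itv /= => /andP[p0 p1].
apply: le_trans (lmi_amgm s0 t0 _) _; first by rewrite p0.
by apply: lerD; rewrite ler_piMl //; lra.
Qed.

Lemma log_meanZ c s t : 0 <= c -> 0 <= s -> 0 <= t ->
  log_mean (c * s) (c * t) = c * log_mean s t.
Proof.
move=> c0 s0 t0; rewrite !lmE -RintegralZl //; last exact: lmi_integrable.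
apply: eq_Rintegral => p _; rewrite /lmi !powRM // mulrACA -powRD ?subrK ?powRr1 //.
by rewrite oner_eq0.
Qed.

(** Together with homogeneity this is concavity. It holds under the integral: divided by the totals,
    each of the two terms is bounded by a weighted arithmetic mean, and these two means add up to
    1. *)
Lemma log_mean_superadd s1 t1 s2 t2 : 0 <= s1 -> 0 <= t1 -> 0 <= s2 -> 0 <= t2 ->
  log_mean s1 t1 + log_mean s2 t2 <= log_mean (s1 + s2) (t1 + t2).
Proof.
move=> s10 t10 s20 t20; rewrite !lmE -RintegralD //; try exact: lmi_integrable.
have is1 := lmi_integrable s10 t10; have is2 := lmi_integrable s20 t20.
apply: le_Rintegral => //.
- have -> : EFin \o (fun p => lmi s1 t1 p + lmi s2 t2 p) =
    (EFin \o lmi s1 t1) \+ (EFin \o lmi s2 t2) by apply/funext => p; rewrite /= EFinD.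
  exact: integrableD.
- by apply: lmi_integrable; exact: addr_ge0.
move=> p /=; rewrite in_itv /= => /andP[p0 p1].
have [->|pn0] := eqVneq p 0; first by rewrite !lmi_0 // addr_ge0.
have [->|pn1] := eqVneq p 1; first by rewrite !lmi_1 // addr_ge0.
have pn1' : 1 - p != 0 by rewrite subr_eq0 eq_sym.
have [S0|S0] := eqVneq (s1 + s2) 0.
  have [-> ->] : s1 = 0 /\ s2 = 0 by split; lra.
  by rewrite /lmi addr0 !powR0 // !mul0r addr0.
have [T0|T0] := eqVneq (t1 + t2) 0.
  have [-> ->] : t1 = 0 /\ t2 = 0 by split; lra.
  by rewrite /lmi addr0 !powR0 // !mulr0 addr0.
have SS : 0 < s1 + s2 by rewrite lt_neqAle eq_sym S0 addr_ge0.
have TT : 0 < t1 + t2 by rewrite lt_neqAle eq_sym T0 addr_ge0.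
set S := s1 + s2 in S0 SS *; set T := t1 + t2 in T0 TT *.
have sc s t : 0 <= s -> 0 <= t ->
    lmi s t p <= lmi S T p * ((1 - p) * (s / S) + p * (t / T)).
  move=> s0 t0.
  have -> : lmi s t p = lmi S T p * lmi (s / S) (t / T) p.
    rewrite /lmi mulrACA -!powRM ?divr_ge0 // ?(ltW SS) ?(ltW TT) //.
    by rewrite ![_ * (_ / _)]mulrC !divfK.
  by rewrite ler_wpM2l // lmi_amgm ?divr_ge0 ?(ltW SS) ?(ltW TT) // p0.
apply: le_trans (lerD (sc _ _ s10 t10) (sc _ _ s20 t20)) _.
rewrite -mulrDr -[leRHS]mulr1 ler_wpM2l //.
rewrite le_eqVlt; apply/orP; left; apply/eqP; rewrite /S /T.
by field; apply/andP; split; first [exact: S0 | exact: T0].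
Qed.

Lemma log_mean_concave (I : finType) (a s t : I -> R) :
  (forall i, 0 <= a i) -> (forall i, 0 <= s i) -> (forall i, 0 <= t i) ->
  \sum_i a i * log_mean (s i) (t i) <=
  log_mean (\sum_i a i * s i) (\sum_i a i * t i).
Proof.
move=> a0 s0 t0.
suff [] : [/\ \sum_i a i * log_mean (s i) (t i) <=
  log_mean (\sum_i a i * s i) (\sum_i a i * t i), 0 <= \sum_i a i * s i &
  0 <= \sum_i a i * t i] by [].
elim/big_rec3: _ => [|i x y z _ [h1 h2 h3]]; first by rewrite log_mean_ge0.
split; try by rewrite addr_ge0 ?mulr_ge0.
rewrite -log_meanZ //; apply: le_trans (log_mean_superadd _ _ h2 h3); last 2 first.
- exact: mulr_ge0.
- exact: mulr_ge0.
by rewrite lerD2l.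
Qed.

Lemma log_mean0 t : 0 <= t -> log_mean 0 t = 0.
Proof.
move=> t0; rewrite lmE -Rintegral_itv_bndo_bndc //; last first.
  apply: (integrableS _ _ _ (lmi_integrable (lexx 0) t0)) => //.
  by apply: subset_itvl; rewrite bnd_simp.
rewrite (@eq_Rintegral _ _ _ _ _ (fun=> 0)) ?Rintegral0 //.
  by rewrite Rintegral_cst ?mul0r.
move=> p /set_mem; rewrite /= in_itv /= => /andP[_ p1].
by rewrite /lmi powR0 ?mul0r // subr_eq0 gt_eqF.
Qed.

Lemma log_mean_diag s : 0 <= s -> log_mean s s = s.
Proof.
move=> s0; rewrite lmE (@eq_Rintegral _ _ _ _ _ (fun=> s)); last first.
  by move=> p _; rewrite /lmi -powRD ?subrK ?powRr1 // oner_eq0.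
by rewrite Rintegral_cst // [mu _]lebesgue_measure_itv /= lte_fin ltr01 /= subr0 mulr1.
Qed.

(** The reason for this choice of mean: an edge weight times the difference of [ln rho] is linear in
    [rho], which ties the heat flow to the gradient of the entropy. *)
Lemma log_mean_ln s t : 0 < s -> 0 < t ->
  log_mean s t * (ln s - ln t) = s - t.
Proof.
move=> s0 t0; have [->|st] := eqVneq s t; first by rewrite !subrr mulr0.
pose d := ln t - ln s.
have d0 : d != 0.
  rewrite subr_eq0; apply: contra st => /eqP /(congr1 expR).
  by rewrite !lnK // => ->.
pose f p := expR (ln s + p * d).
pose F p := d^-1 * f p.
have df p : is_derive p 1 f (f p * d).
  rewrite /f; apply: is_derive_eq.
  by rewrite scaler0 !add0r mul1r [d%:A]mulr1.
have dF p : is_derive p 1 F (f p).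
  rewrite /F; apply: is_derive_eq.
  by rewrite /GRing.scale /= mulrCA mulVf // mulr1.
have cf p : {for p, continuous f} by apply/differentiable_continuous/derivable1_diffP; case: (df p).
have cF p : {for p, continuous F} by apply/differentiable_continuous/derivable1_diffP; case: (dF p).
have := @continuous_FTC2 R f F 0 1 ltr01 _ _ _.
move=> /(_ (continuous_subspaceT cf)).
have -> : log_mean s t = fine (\int[lebesgue_measure]_(x in `[0%R, 1%R]) (f x)%:E).
  rewrite lmE /Rintegral; congr fine; apply: eq_integral => p _.
  by rewrite lmi_pos.
move=> ->.
- rewrite -EFinB /= /F /f mul0r addr0 mul1r subrKC ?lnK //.
  by rewrite -mulrBr -[ln s - ln t]opprB -/d mulrC mulNr mulVKf // opprB.
- split; first by move=> x _; case: (dF x).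
  + by apply: cvg_at_right_filter; exact: cF.
  + by apply: cvg_at_left_filter; exact: cF.
- by move=> x _; rewrite derive1E; case: (dF x).
Qed.

End log_mean_theory.

Lemma measurable_log_mean d (T : measurableType d) (R : realType) (D : set T)
    (f g : T -> R) : measurable D -> measurable_fun D f -> measurable_fun D g ->
  (forall x, D x -> 0 <= f x) -> (forall x, D x -> 0 <= g x) ->
  measurable_fun D (fun x => log_mean (f x) (g x)).
Proof.
move=> mD mf mg f0 g0.
(* The closed form of the mean, with its degenerate cases, is visibly measurable in both
   arguments. *)
pose E (z : R * R) := if (z.1 == 0) || (z.2 == 0) then 0 else
  if z.1 == z.2 then z.1 else (z.1 - z.2) * (ln z.1 - ln z.2)^-1.
have mE : measurable_fun setT E.
  have m1 : measurable_fun setT (fst : R * R -> R) by exact: measurable_fst.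
  have m2 : measurable_fun setT (snd : R * R -> R) by exact: measurable_snd.
  apply: measurable_fun_ifT => //.
    by apply: measurable_or; apply: measurable_fun_eqr.
  apply: measurable_fun_ifT => //; first exact: measurable_fun_eqr.
  apply: measurable_funM; first exact: measurable_funB.
  apply: (measurableT_comp (@measurable_invr R)).
  by apply: measurable_funB; apply: (measurableT_comp (@measurable_ln R)).
apply: (eq_measurable_fun (E \o (fun x => ((f \_ D) x, (g \_ D) x)))); last first.
  apply: measurable_funTS; apply: (measurableT_comp mE).
  by apply: measurable_fun_pair; exact/(measurable_restrictT _ mD).
move=> x xD; have /set_mem Dx := xD; rewrite /E /= !patchE xD.
have [->|fn0] := eqVneq (f x) 0; first by rewrite log_mean0 ?g0.
have [->|gn0] := eqVneq (g x) 0; first by rewrite log_meanC log_mean0 ?f0.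
have [->|fg] := eqVneq (f x) (g x); first by rewrite log_mean_diag ?g0.
have fp : 0 < f x by rewrite lt_neqAle eq_sym fn0 f0.
have gp : 0 < g x by rewrite lt_neqAle eq_sym gn0 g0.
rewrite /= -(log_mean_ln fp gp) mulfK // subr_eq0.
by apply: contra fg => /eqP /(congr1 expR); rewrite !lnK // => ->.
Qed.

(** * Weighted graph Laplacians *)

Section laplacian.
Context (R : realType) (X : finType).
Implicit Types (m b u v phi : X -> R) (w : X -> X -> R).

Definition laplacian w u (x : X) : R := \sum_y w x y * (u x - u y).

Lemma green w phi u : (forall x y, w x y = w y x) ->
  \sum_x phi x * laplacian w u x =
  2^-1 * \sum_x \sum_y w x y * ((phi x - phi y) * (u x - u y)).
Proof.
move=> wC.
have e1 : \sum_x phi x * laplacian w u x =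
    \sum_x \sum_y w x y * (phi x * (u x - u y)).
  by apply: eq_bigr => x _; rewrite mulr_sumr; apply: eq_bigr => y _; ring.
have e2 : \sum_x phi x * laplacian w u x =
    \sum_x \sum_y w x y * (- phi y * (u x - u y)).
  rewrite e1 exchange_big /=; apply: eq_bigr => x _; apply: eq_bigr => y _.
  by rewrite wC; ring.
apply: (mulfI (_ : 2 != 0 :> R)); first by rewrite pnatr_eq0.
rewrite mulrA divff ?pnatr_eq0 // mul1r mulrDl mul1r {1}e1 e2 -big_split /=.
apply: eq_bigr => x _; rewrite -big_split /=; apply: eq_bigr => y _; ring.
Qed.

Lemma laplacianD w u v x : laplacian w (fun y => u y + v y) x = laplacian w u x + laplacian w v x.
Proof. by rewrite -big_split /=; apply: eq_bigr => y _; ring. Qed.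

Lemma laplacianZ w (c : R) u x : laplacian w (fun y => c * u y) x = c * laplacian w u x.
Proof. by rewrite mulr_sumr; apply: eq_bigr => y _; ring. Qed.

Lemma laplacian_energy_ge0 w u : (forall x y, 0 <= w x y) -> (forall x y, w x y = w y x) ->
  0 <= \sum_x u x * laplacian w u x.
Proof.
move=> w0 wC; rewrite green // mulr_ge0 ?invr_ge0 //.
apply: sumr_ge0 => x _; apply: sumr_ge0 => y _.
by rewrite mulr_ge0 // -expr2 sqr_ge0.
Qed.

Let vec u : 'cV[R]_#|X| := \col_i u (enum_val i).
Let fct (v : 'cV[R]_#|X|) (x : X) : R := v (enum_rank x) 0.

Let fctK u : fct (vec u) =1 u.
Proof. by move=> x; rewrite /fct mxE enum_rankK. Qed.

Let vecK (v : 'cV[R]_#|X|) : vec (fct v) = v.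
Proof. by apply/matrixP => i j; rewrite mxE /fct enum_valK (ord1 j). Qed.

Definition laplacian_mx m w : 'M[R]_#|X| :=
  \matrix_(i, j) ((m (enum_val i) + \sum_y w (enum_val i) y) *+ (i == j) -
    w (enum_val i) (enum_val j)).

Let laplacian_mxE m w u : laplacian_mx m w *m vec u =
  vec (fun x => m x * u x + laplacian w u x).
Proof.
apply/matrixP => i j; rewrite !mxE.
under eq_bigr do rewrite !mxE mulrBl.
rewrite sumrB (bigD1 i) //= eqxx mulr1n [X in _ + X - _]big1 ?addr0; last first.
  by move=> k ki; rewrite eq_sym (negbTE ki) mulr0n mul0r.
have -> : \sum_(i0 < #|X|) w (enum_val i) (enum_val i0) * u (enum_val i0) =
    \sum_y w (enum_val i) y * u y.
  rewrite [RHS](reindex (@enum_val _ predT)) //=.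
  by apply: onW_bij; exact: enum_val_bij.
rewrite /laplacian mulrDl -addrA; congr (_ + _).
by rewrite mulr_suml -sumrB; apply: eq_bigr => y _; rewrite mulrBr.
Qed.

Let laplacian_mxC m w : (forall x y, w x y = w y x) ->
  (laplacian_mx m w)^T = laplacian_mx m w.
Proof.
move=> wC; apply/matrixP => i j; rewrite !mxE wC eq_sym.
by case: eqVneq => // ->.
Qed.

(** Cramer's rule: an explicit rational expression in [m], [w] and [b], from which measurability can
    be read off. *)
Definition resolvent m w b : X -> R :=
  fct ((\det (laplacian_mx m w))^-1 *: (\adj (laplacian_mx m w) *m vec b)).

Let massive_injective m w u : (forall x, 0 < m x) -> (forall x y, 0 <= w x y) ->
  (forall x y, w x y = w y x) -> (forall x, m x * u x + laplacian w u x = 0) ->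
  forall x, u x = 0.
Proof.
move=> m0 w0 wC h x.
have : \sum_x u x * (m x * u x + laplacian w u x) = 0.
  by rewrite big1 // => y _; rewrite h mulr0.
under eq_bigr do rewrite mulrDr; rewrite big_split /=.
have e0 := @laplacian_energy_ge0 w u w0 wC.
have s0 y : 0 <= u y * (m y * u y).
  by rewrite mulrCA mulr_ge0 ?(ltW (m0 y)) // -expr2 sqr_ge0.
have S0 : 0 <= \sum_y u y * (m y * u y) by exact: sumr_ge0.
move=> /eqP; rewrite (paddr_eq0 S0 e0) => /andP[h1 _].
move: h1; rewrite psumr_eq0 // => /allP /(_ x (mem_index_enum x)) /=.
by rewrite mulrCA mulf_eq0 gt_eqF //= -expr2 expf_eq0 /= => /eqP.
Qed.

Lemma resolventP m w b : (forall x, 0 < m x) -> (forall x y, 0 <= w x y) ->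
  (forall x y, w x y = w y x) ->
  forall x, m x * resolvent m w b x + laplacian w (resolvent m w b) x = b x.
Proof.
move=> m0 w0 wC.
have Au : laplacian_mx m w \in unitmx.
  rewrite -row_free_unit -kermx_eq0; apply/eqP/row_matrixP => i; rewrite row0.
  set v := row i _.
  have : v *m laplacian_mx m w = 0 by rewrite /v -row_mul mulmx_ker row0.
  move=> /(congr1 trmx); rewrite trmx_mul trmx0 laplacian_mxC // -[v^T]vecK laplacian_mxE.
  move=> h; have z : forall x, fct v^T x = 0.
    apply: (massive_injective m0 w0 wC) => x.
    have := congr1 (fun A => fct A x) h; rewrite fctK => ->.
    by rewrite /fct mxE.
  apply/matrixP => k l; rewrite (ord1 k) [RHS]mxE.
  by have := z (enum_val l); rewrite /fct enum_valK mxE.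
move=> x; have := laplacian_mxE m w (resolvent m w b).
rewrite /resolvent vecK -scalemxAr mulmxA mul_mx_adj mul_scalar_mx scalerA mulVf; last first.
  by move: Au; rewrite unitmxE unitfE.
by rewrite scale1r => /(congr1 (fun A => fct A x)); rewrite !fctK => <-.
Qed.

Lemma resolvent_unique m w b u : (forall x, 0 < m x) -> (forall x y, 0 <= w x y) ->
  (forall x y, w x y = w y x) -> (forall x, m x * u x + laplacian w u x = b x) ->
  forall x, u x = resolvent m w b x.
Proof.
move=> m0 w0 wC h x; apply/eqP; rewrite -subr_eq0; apply/eqP.
have -> : u x - resolvent m w b x = u x + (-1) * resolvent m w b x by ring.
apply: (massive_injective m0 w0 wC (u := fun x => u x + (-1) * resolvent m w b x)) => {}x.
rewrite laplacianD laplacianZ; have := resolventP b m0 w0 wC x; have := h x; lra.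
Qed.

(* A symmetric matrix has the same kernel as its square. *)
Lemma laplacian_range_sqr w b : (forall x y, 0 <= w x y) ->
  (forall x y, w x y = w y x) ->
  (forall phi, (forall x, laplacian w phi x = 0) -> \sum_x phi x * b x = 0) ->
  exists c, forall x, b x = laplacian w (laplacian w c) x.
Proof.
move=> w0 wC bK; set A := laplacian_mx (fun=> 0) w.
have AE u : A *m vec u = vec (laplacian w u).
  by rewrite laplacian_mxE; apply/matrixP => i j; rewrite !mxE mul0r add0r.
have AT : A^T = A by exact: laplacian_mxC.
have : ((vec b)^T <= A *m A)%MS.
  rewrite submxE; apply/eqP/matrixP => i j; rewrite [RHS]mxE.
  set K := cokermx (A *m A); set v := col j K.
  have Kv : A *m (A *m v) = 0 by rewrite mulmxA /v colE mulmxA mulmx_coker mul0mx.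
  have -> : ((vec b)^T *m K) i j = \sum_x fct v x * b x.
    rewrite mxE [RHS](reindex (@enum_val _ predT)) /=; last first.
      by apply: onW_bij; exact: enum_val_bij.
    by apply: eq_bigr => k _; rewrite mulrC /fct enum_valK /v [col _ _ _ _]mxE [(vec b)^T _ _]mxE [vec b _ _]mxE.
  apply: bK => x.
  have e : \sum_x laplacian w (fct v) x * laplacian w (fct v) x = 0.
    have E1 x0 : laplacian w (laplacian w (fct v)) x0 = 0.
      have := congr1 (fun M => fct M x0) Kv.
      rewrite -[v]vecK !AE fctK vecK => ->.
      by rewrite /fct mxE.
    transitivity (\sum_x fct v x * laplacian w (laplacian w (fct v)) x).
      by rewrite !green //; congr (_ * _); apply: eq_bigr => ? _; apply: eq_bigr => ? _; congr (_ * _); rewrite mulrC.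
    by rewrite big1 // => ? _; rewrite E1 mulr0.
  move/eqP: e; rewrite psumr_eq0 => [/allP /(_ x (mem_index_enum x)) /=|? _].
    by rewrite -expr2 expf_eq0 /= => /eqP.
  by rewrite -expr2 sqr_ge0.
case/submxP => D /(congr1 trmx); rewrite trmxK !trmx_mul AT -mulmxA -[D^T]vecK !AE => h.
exists (fct D^T) => x.
by have := congr1 (fun M => fct M x) h; rewrite !fctK.
Qed.

(** Testing the equation against [e * r] leaves an energy term of good sign; Young's inequality does
    the rest. *)
Lemma resolvent_contraction w c (e : R) : 0 < e -> (forall x y, 0 <= w x y) ->
  (forall x y, w x y = w y x) ->
  \sum_x (e * resolvent (fun=> e) w c x) ^+ 2 <= \sum_x c x ^+ 2.
Proof.
move=> e0 w0 wC; set r := resolvent _ w c.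
have rP x : e * r x + laplacian w r x = c x by exact: (resolventP c).
have E0 := laplacian_energy_ge0 r w0 wC.
have : \sum_x (e * r x) ^+ 2 <= \sum_x (e * r x) * c x.
  rewrite -subr_ge0 -sumrB.
  have -> : \sum_x (e * r x * c x - (e * r x) ^+ 2) = e * \sum_x r x * laplacian w r x.
    by rewrite mulr_sumr; apply: eq_bigr => x _; rewrite -rP; ring.
  by rewrite mulr_ge0 // ltW.
have : \sum_x (e * r x) * c x <= \sum_x (2^-1 * (e * r x) ^+ 2 + 2^-1 * c x ^+ 2).
  apply: ler_sum => x _; have := sqr_ge0 (e * r x - c x); nra.
rewrite big_split /= -!mulr_sumr; lra.
Qed.

(* Unlike an arbitrary potential with divergence [b], this limit of Cramer
   formulas depends measurably on [w] and [b]. *)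
Definition hodge w b (x : X) : R := lim ((fun n => resolvent (fun=> n.+1%:R^-1) w b x) @ \oo).

(** With [b] equal to the Laplacian applied twice to [c], and [r] the resolvent of [c] for mass [e],
    the resolvent of [b] is exactly [laplacian w c - e (c - e r)]. As [e r] stays bounded, it
    converges to [laplacian w c] at rate [e]. *)
Lemma hodge_spec w b : (forall x y, 0 <= w x y) -> (forall x y, w x y = w y x) ->
  (forall phi, (forall x, laplacian w phi x = 0) -> \sum_x phi x * b x = 0) ->
  (forall x, resolvent (fun=> n.+1%:R^-1) w b x @[n --> \oo] --> hodge w b x) /\
  forall x, laplacian w (hodge w b) x = b x.
Proof.
move=> w0 wC bK; have [c bE] := laplacian_range_sqr w0 wC bK.
have cvg x : resolvent (fun=> n.+1%:R^-1) w b x @[n --> \oo] --> laplacian w c x.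
  pose K := `|c x| + (1 + \sum_y c y ^+ 2).
  have bound n : `|laplacian w c x - resolvent (fun=> n.+1%:R^-1) w b x| <= n.+1%:R^-1 * K.
    set e : R := n.+1%:R^-1; have e0 : 0 < e by rewrite invr_gt0.
    have : laplacian w c x + (- e) * (c x + (-e) * resolvent (fun=> e) w c x) =
        resolvent (fun=> e) w b x.
      apply: (resolvent_unique (u := fun x => laplacian w c x + (- e) * (c x +
         (- e) * resolvent (fun=> e) w c x))) => // y.
      rewrite laplacianD laplacianZ laplacianD laplacianZ bE.
      have := @resolventP (fun=> e) w c (fun=> e0) w0 wC y.
      by move=> <-; ring.
    move=> <-; have := resolvent_contraction c e0 w0 wC.
    set r := resolvent _ _ _ => h.
    have hx : `|e * r x| <= 1 + \sum_y c y ^+ 2.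
      have h1 : (e * r x) ^+ 2 <= \sum_y c y ^+ 2.
        apply: le_trans h; rewrite (bigD1 x) //= lerDl sumr_ge0 // => y _.
        exact: sqr_ge0.
      have := sqr_ge0 (`|e * r x| - 1); rewrite -real_normK ?num_real // in h1.
      have := normr_ge0 (e * r x); nra.
    have -> : laplacian w c x - (laplacian w c x + - e * (c x + - e * r x)) =
      e * (c x - e * r x) by ring.
    rewrite normrM gtr0_norm // ler_pM2l // /K.
    by apply: le_trans (ler_normB _ _) _; rewrite lerD2l.
  apply/cvgrPdist_le => e e0.
  have K0 : 0 < K by rewrite /K ltr_wpDl // ltr_wpDr // sumr_ge0 // => y _; exact: sqr_ge0.
  near=> n; apply: le_trans (bound n) _.
  rewrite -ler_pdivlMr //; near: n.
  have /cvgrPdist_le := @cvg_harmonic R.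
  move=> /(_ (e / K) (divr_gt0 e0 K0)); apply: filterS => n.
  by rewrite sub0r normrN ger0_norm // /harmonic /= invr_ge0.
have hE x : hodge w b x = laplacian w c x by apply/cvg_lim.
by split => x; [rewrite hE | rewrite bE; apply: eq_bigr => y _; rewrite !hE].
Unshelve. all: by end_near.
Qed.

End laplacian.

(** * Measurable dependence of resolvents and potentials on a parameter *)

Section measurability.
Context d (T : measurableType d) (R : realType).

Lemma measurable_det n (D : set T) (M : T -> 'M[R]_n) :
  (forall i j, measurable_fun D (fun t => M t i j)) ->
  measurable_fun D (fun t => \det (M t)).
Proof.
move=> mM; apply: measurable_sum => s; apply: measurable_funM => //.
by apply: measurable_prod => i _.
Qed.

Variable X : finType.

Lemma measurable_resolvent (D : set T) (m b : T -> X -> R) (w : T -> X -> X -> R) x :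
  (forall x, measurable_fun D (fun t => m t x)) ->
  (forall x, measurable_fun D (fun t => b t x)) ->
  (forall x y, measurable_fun D (fun t => w t x y)) ->
  measurable_fun D (fun t => resolvent (m t) (w t) (b t) x).
Proof.
move=> mm mb mw.
have mA i j : measurable_fun D (fun t => laplacian_mx (m t) (w t) i j).
  under eq_fun do rewrite mxE; apply: measurable_funB => //.
  case: eqP => _; last by under eq_fun do rewrite mulr0n; exact: measurable_cst.
  under eq_fun do rewrite mulr1n; apply: measurable_funD => //.
  exact: measurable_sum.
rewrite /resolvent; under eq_fun do rewrite mxE; apply: measurable_funM.
  by apply: (measurableT_comp (@measurable_invr R)); exact: measurable_det.
under eq_fun do rewrite mxE; apply: measurable_sum => i.
apply: measurable_funM; last by under eq_fun do rewrite mxE; exact: mb.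
under eq_fun do rewrite mxE /cofactor; apply: measurable_funM => //.
by apply: measurable_det => k l; under eq_fun do rewrite mxE mxE; exact: mA.
Qed.

Lemma measurable_hodge (D : set T) (b : T -> X -> R) (w : T -> X -> X -> R) x :
  (forall x, measurable_fun D (fun t => b t x)) ->
  (forall x y, measurable_fun D (fun t => w t x y)) ->
  (forall t x y, D t -> 0 <= w t x y) -> (forall t x y, D t -> w t x y = w t y x) ->
  (forall t phi, D t -> (forall x, laplacian (w t) phi x = 0) -> \sum_x phi x * b t x = 0) ->
  measurable_fun D (fun t => hodge (w t) (b t) x).
Proof.
move=> mb mw w0 wC bK.
apply: (measurable_fun_cvg (h := fun n t => resolvent (fun=> n.+1%:R^-1) (w t) (b t) x)).
  by move=> n; exact: measurable_resolvent.
move=> t Dt.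
by have [] := @hodge_spec R X (w t) (b t) (fun x y => w0 t x y Dt)
  (fun x y => wC t x y Dt) (fun phi => bK t phi Dt).
Qed.

End measurability.

(** * Curves of finite action *)

Section chain.
Context (R : realType) (X : finType) (Q : X -> X -> R) (pi : X -> R).
Hypothesis mc : markov_chain Q pi.

Definition edge_weight (rho : X -> R) (x y : X) : R := hat rho x y * Q x y * pi x.

Definition kinetic (rho psi : X -> R) : R :=
  \sum_x \sum_y (psi x - psi y) ^+ 2 * hat rho x y * Q x y * pi x.

Lemma stat_gt0 x : 0 < pi x.
Proof. by case: mc => _ _ []. Qed.

Lemma stat_ge0 x : 0 <= pi x. Proof. exact: ltW (stat_gt0 x). Qed.

Lemma stat_neq0 x : pi x != 0. Proof. by rewrite gt_eqF ?stat_gt0. Qed.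

Lemma sum_stat : \sum_x pi x = 1.
Proof. by case: mc => _ _ []. Qed.

Lemma rate_ge0 x y : 0 <= Q x y.
Proof. by case: mc => [[]]. Qed.

Lemma edge_weightC rho x y : edge_weight rho x y = edge_weight rho y x.
Proof.
have rev : Q x y * pi x = Q y x * pi y by case: mc.
by rewrite /edge_weight -!mulrA rev /hat log_meanC.
Qed.

Lemma edge_weight_ge0 rho x y : 0 <= edge_weight rho x y.
Proof. by rewrite /edge_weight !mulr_ge0 ?log_mean_ge0 ?rate_ge0 ?stat_ge0. Qed.

Lemma kineticE rho psi : kinetic rho psi =
  \sum_x \sum_y edge_weight rho x y * (psi x - psi y) ^+ 2.
Proof.
apply: eq_bigr => x _; apply: eq_bigr => y _; rewrite /edge_weight; ring.
Qed.

Lemma kinetic_ge0 rho psi : 0 <= kinetic rho psi.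
Proof.
rewrite kineticE; apply: sumr_ge0 => x _; apply: sumr_ge0 => y _.
by rewrite mulr_ge0 ?sqr_ge0 ?edge_weight_ge0.
Qed.

Lemma kineticZ (q : R) rho psi : kinetic rho (fun x => q * psi x) = q ^+ 2 * kinetic rho psi.
Proof.
rewrite mulr_sumr; apply: eq_bigr => x _; rewrite mulr_sumr; apply: eq_bigr => y _; ring.
Qed.

Lemma continuity_laplacian rho psi x :
  pi x * (- \sum_y (psi y - psi x) * hat rho x y * Q x y) =
  laplacian (edge_weight rho) psi x.
Proof.
rewrite -sumrN mulr_sumr; apply: eq_bigr => y _; rewrite /edge_weight; ring.
Qed.

(** Time interval and endpoints are left free so that curves can be cut, rescaled and
    concatenated. *)
Definition flow (a b : R) (rho psi : R -> X -> R) :=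
  [/\ forall t, a <= t <= b -> density pi (rho t),
      forall x, absolutely_continuous a b (fun t => rho t x),
      forall x, measurable_fun `[a, b] (fun t => psi t x) &
      {ae @lebesgue_measure R, forall t : R, a <= t <= b -> forall x,
        is_derive t 1 (fun s : R => rho s x)
          (- \sum_y (psi t y - psi t x) * hat (rho t) x y * Q x y)}].

Definition flow_action (a b : R) (rho psi : R -> X -> R) : \bar R :=
  ((2^-1)%:E * \int[lebesgue_measure]_(t in `[a, b]) (kinetic (rho t) (psi t))%:E)%E.

Lemma admissible_flow rho0 rho1 rho psi :
  admissible Q pi rho0 rho1 rho psi <-> [/\ flow 0 1 rho psi, rho 0 = rho0 & rho 1 = rho1].
Proof.
split=> [[[h1 h2] h3 h4 h5 h6]|[[h1 h2 h3 h4] h5 h6]]; split => //.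
Qed.

Lemma measurable_edge_weight (a b : R) rho psi x y : flow a b rho psi ->
  measurable_fun `[a, b] (fun t => edge_weight (rho t) x y).
Proof.
move=> [dens ac _ _]; rewrite /edge_weight; apply: measurable_funM => //.
apply: measurable_funM => //.
have rho0 z t : `[a, b]%classic t -> 0 <= rho t z.
  by rewrite /= in_itv /= => /dens[].
by apply: measurable_log_mean => //; try (exact: ac_measurable); exact: rho0.
Qed.

Lemma measurable_kinetic (a b : R) rho psi : flow a b rho psi ->
  measurable_fun `[a, b] (fun t => kinetic (rho t) (psi t)).
Proof.
move=> fl; apply: (eq_measurable_fun (fun t => \sum_x \sum_y
    edge_weight (rho t) x y * (psi t x - psi t y) ^+ 2)).
  by move=> t _; rewrite kineticE.
apply: measurable_sum => x; apply: measurable_sum => y.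
apply: measurable_funM; first exact: measurable_edge_weight fl.
by case: fl => _ _ mpsi _; apply: measurable_funX; exact: measurable_funB.
Qed.

Lemma flow_action_ge0 (a b : R) rho psi : (0 <= flow_action a b rho psi)%E.
Proof.
apply: mule_ge0; first by rewrite lee_fin invr_ge0.
by apply: integral_ge0 => t _; rewrite lee_fin kinetic_ge0.
Qed.

Lemma flow_affine (a b c d p q : R) rho psi : q != 0 ->
  (forall u, c <= u <= d -> a <= p + q * u <= b) -> flow a b rho psi ->
  flow c d (fun u => rho (p + q * u)) (fun u x => q * psi (p + q * u) x).
Proof.
move=> q0 cd [dens ac mpsi der]; split.
- by move=> u /cd /dens.
- by move=> x; exact: (ac_affine q0 (ac x) cd).
- move=> x; apply: measurable_funM => //.
  have sub : `[c, d] `<=` (fun u => p + q * u) @^-1` `[a, b].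
    by move=> u; rewrite /= !in_itv /=; exact: cd.
  apply: measurable_funS sub _.
    rewrite -[X in measurable X]setTI; exact: (@measurable_affine R p q).
  exact: (@measurable_fun_affine R p q _ _ (measurable_itv `[a, b]) (mpsi x)).
have := ae_affine p q0 der.
apply: filterS; first exact: (ae_filter_ringOfSetsType lebesgue_measure).
move=> u h /cd /h {}h x.
have := is_derive_affine (h x).
rewrite mulrN mulr_sumr; congr is_derive; congr (- _).
by apply: eq_bigr => y _; ring.
Qed.

Lemma flow_action_affine (a b c d p q : R) rho psi : q != 0 ->
  (forall u, c <= u <= d <-> a <= p + q * u <= b) -> flow a b rho psi ->
  flow_action c d (fun u => rho (p + q * u)) (fun u x => q * psi (p + q * u) x) =
  ((`|q|)%:E * flow_action a b rho psi)%E.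
Proof.
move=> q0 cd fl; rewrite /flow_action.
have mk := measurable_kinetic fl.
rewrite -(ge0_integral_affine p q0 (D := `[a, b])) //; last 2 first.
- exact/measurable_EFinP.
- by move=> t _; rewrite lee_fin kinetic_ge0.
have -> : (fun u : R => p + q * u) @^-1` `[a, b] = `[c, d]%classic.
  by apply/seteqP; split => u /=; rewrite !in_itv /= => /cd.
(* The speed contributes [q ^+ 2], and the change of variables takes back one factor [|q|]. *)
under eq_integral do rewrite kineticZ EFinM.
rewrite ge0_integralZl //; last 3 first.
- have := @measurable_fun_affine R p q _ _ (measurable_itv `[a, b]) mk.
  have -> : (fun u : R => p + q * u) @^-1` `[a, b] = `[c, d]%classic.
    by apply/seteqP; split => u /=; rewrite !in_itv /= => /cd.
  by move=> h; apply/measurable_EFinP.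
- by move=> t _; rewrite lee_fin kinetic_ge0.
- by rewrite lee_fin sqr_ge0.
by rewrite -[q ^+ 2]real_normK ?num_real // expr2 EFinM !muleA; congr (_ * _)%E; rewrite muleC muleA.
Qed.

Lemma flow_sub (a b c d : R) rho psi : a <= c -> d <= b -> flow a b rho psi -> flow c d rho psi.
Proof.
move=> ac db [dens acr mpsi der].
have cd t : c <= t <= d -> a <= t <= b.
  by move=> /andP[ct td]; rewrite (le_trans ac ct) (le_trans td db).
split.
- by move=> t /cd /dens.
- by move=> x; apply: ac_sub (acr x).
- move=> x; apply: measurable_funS (mpsi x) => // t /=; rewrite !in_itv /=; exact: cd.
move: der; apply: filterS; first exact: (ae_filter_ringOfSetsType lebesgue_measure).
by move=> t h /cd /h.
Qed.

Lemma integral_itv_split (a b c : R) (f : R -> \bar R) : a <= b <= c ->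
  measurable_fun `[a, c] f -> (forall t, 0 <= f t)%E ->
  (\int[lebesgue_measure]_(t in `[a, c]) f t =
   \int[lebesgue_measure]_(t in `[a, b]) f t + \int[lebesgue_measure]_(t in `]b, c]) f t)%E.
Proof.
move=> /andP[ab bc] mf f0.
have E : `[a, c]%classic = `[a, b]%classic `|` `]b, c]%classic.
  apply/seteqP; split => t /=; rewrite !in_itv /=.
    by case: (leP t b) => tb /andP[-> tc]; [left | right].
  by move=> [/andP[-> /le_trans ->]//|/andP[/ltW /(le_trans ab) -> ->]].
rewrite E ge0_integral_setU //; first by rewrite -E.
by apply/disj_set2P; apply/seteqP; split => // t [] /=; rewrite !in_itv /= => /andP[_ h1] /andP[h2 _];
  move: (le_lt_trans h1 h2); rewrite ltxx.
Qed.

Lemma flow_action_split (a b c : R) rho psi : a <= b <= c -> flow a c rho psi ->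
  flow_action a c rho psi = (flow_action a b rho psi + flow_action b c rho psi)%E.
Proof.
move=> abc fl; have mk := measurable_kinetic fl; have /andP[ab bc] := abc.
have f0 t : (0 <= (kinetic (rho t) (psi t))%:E)%E by rewrite lee_fin kinetic_ge0.
rewrite /flow_action (integral_itv_split abc) //; last exact/measurable_EFinP.
rewrite ge0_muleDr ?integral_ge0 //; congr (_ + _ * _)%E.
rewrite -[RHS]integral_itv_obnd_cbnd //; apply/measurable_EFinP.
by apply: measurable_funS mk => // t /=; rewrite !in_itv /= => /andP[bt ->]; rewrite (le_trans ab (ltW bt)).
Qed.

Definition concat (b : R) (f g : R -> X -> R) (t : R) : X -> R :=
  if t <= b then f t else g t.

Lemma flow_concat (a b c : R) rho1 psi1 rho2 psi2 : a <= b <= c ->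
  flow a b rho1 psi1 -> flow b c rho2 psi2 -> rho1 b = rho2 b ->
  flow a c (concat b rho1 rho2) (concat b psi1 psi2).
Proof.
move=> abc [dens1 ac1 mpsi1 der1] [dens2 ac2 mpsi2 der2] e12; have /andP[ab bc] := abc.
split.
- move=> t /andP[at_ tc]; rewrite /concat; case: leP => tb.
    by apply: dens1; rewrite at_.
  by apply: dens2; rewrite tc ltW.
- move=> x; apply: eq_ac (ac_concat abc (ac1 x) (ac2 x) _); last by rewrite e12.
  by move=> t _; rewrite /concat; case: ifP.
- move=> x; have -> : (fun t => concat b psi1 psi2 t x) =
      (fun t => if t <= b then psi1 t x else psi2 t x).
    by apply/funext => t; rewrite /concat; case: ifP.
  apply: measurable_fun_if => //.
  + by apply: measurable_fun_ler.
  + apply: measurable_funS (mpsi1 x) => // t [] /=; rewrite !in_itv /=.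
    by move=> /andP[-> _] ->.
  + apply: measurable_funS (mpsi2 x) => // t [] /=; rewrite !in_itv /=.
    by move=> /andP[_ ->] /negbT; rewrite -ltNge => /ltW ->.
(* At the junction the derivative may fail to exist; a single time is negligible. *)
have nb : {ae @lebesgue_measure R, forall t, t != b}.
  exists [set b]; split => //; first by rewrite lebesgue_measure_set1.
  by move=> t /= /negP; rewrite negbK => /eqP.
move: der1 der2 nb; apply: filterS3; first exact: (ae_filter_ringOfSetsType lebesgue_measure).
move=> t h1 h2 tb /andP[at_ tc] x.
move: tb; rewrite neq_lt => /orP[] tb.
  have := h1 _ x; rewrite at_ (ltW tb) => /(_ isT).
  rewrite /concat (ltW tb); apply: near_eq_is_derive.
  near=> s; have sb : s < b by near: s; exact: lt_nbhsl.
  by rewrite (ltW sb).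
have := h2 _ x; rewrite tc (ltW tb) => /(_ isT).
rewrite /concat leNgt tb /=; apply: near_eq_is_derive.
near=> s; have sb : b < s by near: s; exact: lt_nbhsr.
by rewrite leNgt sb.
Unshelve. all: by end_near.
Qed.

Lemma flow_action_concat (a b c : R) rho1 psi1 rho2 psi2 : a <= b <= c ->
  flow a b rho1 psi1 -> flow b c rho2 psi2 -> rho1 b = rho2 b ->
  flow_action a c (concat b rho1 rho2) (concat b psi1 psi2) =
  (flow_action a b rho1 psi1 + flow_action b c rho2 psi2)%E.
Proof.
move=> abc f1 f2 e12; have /andP[ab bc] := abc.
have mk := measurable_kinetic (flow_concat abc f1 f2 e12).
pose k t := (kinetic (concat b rho1 rho2 t) (concat b psi1 psi2 t))%:E.
pose k1 t := (kinetic (rho1 t) (psi1 t))%:E.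
pose k2 t := (kinetic (rho2 t) (psi2 t))%:E.
have ge0I (f : R -> X -> R) (g : R -> X -> R) (D : set R) :
    (0 <= \int[lebesgue_measure]_(t in D) (kinetic (f t) (g t))%:E)%E.
  by apply: integral_ge0 => t _; rewrite lee_fin kinetic_ge0.
have E1 : (\int[lebesgue_measure]_(t in `[a, b]) k t =
    \int[lebesgue_measure]_(t in `[a, b]) k1 t)%E.
  by apply: eq_integral => t /set_mem; rewrite /= in_itv /= /k /concat => /andP[_ ->].
have E2 : (\int[lebesgue_measure]_(t in `]b, c]) k t =
    \int[lebesgue_measure]_(t in `[b, c]) k2 t)%E.
  rewrite -[RHS]integral_itv_obnd_cbnd.
    apply: eq_integral => t /set_mem; rewrite /= in_itv /= /k /concat => /andP[bt _].
    by rewrite leNgt bt.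
  have sub : `]b, c]%classic `<=` `[b, c]%classic.
    by move=> t /=; rewrite !in_itv /= => /andP[/ltW -> ->].
  have mk2 := measurable_funS (measurable_itv `[b, c]) sub (measurable_kinetic f2).
  by rewrite /k2; apply/measurable_EFinP.
rewrite /flow_action -[X in (_ * X)%E = _]/(\int[lebesgue_measure]_(t in `[a, c]) k t)%E.
rewrite (integral_itv_split abc); last 2 first.
- exact/measurable_EFinP.
- by move=> t; rewrite lee_fin kinetic_ge0.
rewrite E1 E2; exact: (ge0_muleDr _ (ge0I _ _ _) (ge0I _ _ _)).
Qed.

(** A witness that the squared distance is at most [c]: real-valued costs, and an actual curve to
    operate on. *)
Definition reach (mu nu : X -> R) (c : R) : Prop :=
  exists rho psi, admissible Q pi mu nu rho psi /\ (action Q pi rho psi <= c%:E)%E.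

Lemma flow_reach (a b c : R) rho psi : a < b -> flow a b rho psi ->
  (flow_action a b rho psi <= c%:E)%E -> reach (rho a) (rho b) ((b - a) * c).
Proof.
move=> ab fl le.
have ba : 0 < b - a by rewrite subr_gt0.
exists (fun u => rho (a + (b - a) * u)), (fun u x => (b - a) * psi (a + (b - a) * u) x).
have eqv u : 0 <= u <= 1 <-> a <= a + (b - a) * u <= b.
  rewrite -{3}[b](subrKC a) lerD2l -{3}[b - a]mulr1 ler_pM2l // lerDl pmulr_rge0 //.
split.
  apply/admissible_flow; split; last 2 first.
  - by rewrite mulr0 addr0.
  - by rewrite mulr1 subrKC.
  by apply: (flow_affine _ _ fl); [rewrite gt_eqF | move=> u /eqv].
rewrite -[action _ _ _ _]/(flow_action 0 1 _ _).
rewrite (@flow_action_affine a b 0 1 a (b - a)) ?gt_eqF // gtr0_norm // EFinM.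
by rewrite lee_pmul2l ?lte_fin.
Qed.

Lemma reach_le mu nu (c d : R) : c <= d -> reach mu nu c -> reach mu nu d.
Proof.
move=> cd [rho [psi [h1 h2]]]; exists rho, psi; split => //.
by apply: le_trans h2 _; rewrite lee_fin.
Qed.

Lemma reach_ge0 mu nu c : reach mu nu c -> 0 <= c.
Proof.
move=> [rho [psi [_ h]]]; rewrite -lee_fin; apply: le_trans h.
exact: (flow_action_ge0 0 1).
Qed.

Lemma reach_density mu nu c : reach mu nu c -> density pi mu /\ density pi nu.
Proof.
move=> [rho [psi [[[h _] <- <- _ _] _]]].
by split; apply: h; rewrite lexx ler01.
Qed.

Lemma reach_sym mu nu c : reach mu nu c -> reach nu mu c.
Proof.
move=> [rho [psi [/admissible_flow[fl <- <-] h]]].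
have eqv (u : R) : 0 <= u <= 1 <-> 0 <= 1 + -1 * u <= 1.
  by split=> /andP[? ?]; apply/andP; split; lra.
exists (fun u => rho (1 + -1 * u)), (fun u x => -1 * psi (1 + -1 * u) x); split.
  apply/admissible_flow; split; last 2 first.
  - by rewrite mulr0 addr0.
  - by rewrite mulr1 subrr.
  by apply: (flow_affine _ _ fl); [rewrite oppr_eq0 oner_eq0 | move=> u /eqv].
rewrite -[action _ _ _ _]/(flow_action 0 1 _ _).
by rewrite (@flow_action_affine 0 1 0 1 1 (-1)) ?oppr_eq0 ?oner_eq0 // normrN1 mul1e.
Qed.

Lemma reach_refl mu : density pi mu -> reach mu mu 0.
Proof.
move=> dmu; exists (fun _ => mu), (fun _ _ => 0); split.
  apply/admissible_flow; split => //; split => //.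
  - by move=> x; exact: ac_cst.
  - apply: aeW => t _ x.
    have -> : - (\sum_y (0 - 0) * hat mu x y * Q x y) = 0.
      by rewrite big1 ?oppr0 // => y _; rewrite addr0 !mul0r.
    exact: is_derive_cst.
rewrite -[action _ _ _ _]/(flow_action 0 1 _ _) /flow_action.
rewrite integral0_eq ?mule0 // => t _; rewrite /kinetic big1 // => x _.
by rewrite big1 // => y _; rewrite subrr expr0n /= !mul0r.
Qed.

(** The two curves are run in times [l] and [1 - l], which divides their actions by these times; [l]
    is left free for the triangle inequality to optimize. *)
Lemma reach_trans mu nu sigma (c1 c2 l : R) : 0 < l < 1 ->
  reach mu nu c1 -> reach nu sigma c2 -> reach mu sigma (c1 / l + c2 / (1 - l)).
Proof.
move=> /andP[l0 l1].
move=> [rho1 [psi1 [/admissible_flow[f1 <- e1] a1]]] [rho2 [psi2 [/admissible_flow[f2 e2 <-] a2]]].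
have l1' : 0 < 1 - l by rewrite subr_gt0.
have q1 : l^-1 != 0 by rewrite invr_eq0 gt_eqF.
have q2 : (1 - l)^-1 != 0 by rewrite invr_eq0 gt_eqF.
have eqv1 u : 0 <= u <= l <-> 0 <= 0 + l^-1 * u <= 1.
  by rewrite add0r pmulr_rge0 ?invr_gt0 // mulrC ler_pdivrMr // mul1r.
have eqv2 u : l <= u <= 1 <-> 0 <= - l / (1 - l) + (1 - l)^-1 * u <= 1.
  have -> : - l / (1 - l) + (1 - l)^-1 * u = (u - l) / (1 - l) by ring.
  by rewrite ler_pdivrMr // mul1r lerD2r pmulr_lge0 ?invr_gt0 // subr_ge0.
have g1 := flow_affine q1 (fun u => (eqv1 u).1) f1.
have g2 := flow_affine q2 (fun u => (eqv2 u).1) f2.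
have l01 : 0 <= l <= 1 by rewrite !ltW.
have w1 : 0 + l^-1 * l = 1 by rewrite add0r mulVf // gt_eqF.
have w2 : - l / (1 - l) + (1 - l)^-1 * l = 0 by ring.
have w3 : - l / (1 - l) + (1 - l)^-1 * 1 = 1 by field; rewrite gt_eqF.
have e12' : rho1 (0 + l^-1 * l) = rho2 (- l / (1 - l) + (1 - l)^-1 * l).
  by rewrite w1 w2 e1 e2.
exists (concat l (fun u => rho1 (0 + l^-1 * u)) (fun u => rho2 (- l / (1 - l) + (1 - l)^-1 * u))),
  (concat l (fun u x => l^-1 * psi1 (0 + l^-1 * u) x)
     (fun u x => (1 - l)^-1 * psi2 (- l / (1 - l) + (1 - l)^-1 * u) x)).
split.
  apply/admissible_flow; split; first exact: flow_concat e12'.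
  - by rewrite /concat (ltW l0) mulr0 addr0.
  - by rewrite /concat leNgt l1 /= w3.
rewrite -[action _ _ _ _]/(flow_action 0 1 _ _).
rewrite (flow_action_concat l01 g1 g2 e12').
rewrite (flow_action_affine q1 eqv1 f1) (flow_action_affine q2 eqv2 f2) EFinD.
rewrite !gtr0_norm ?invr_gt0 // [c1 / l]mulrC [c2 / _]mulrC !EFinM.
by apply: leeD; rewrite lee_pmul2l ?lte_fin ?invr_gt0.
Qed.

(** The actions of the pieces add up, and rescaling a piece to unit time multiplies its action by
    its length. Keeping the three pieces together is what pins down all the speeds of a nearly
    minimal curve. *)
Lemma flow_pieces (A s t : R) rho psi : flow 0 1 rho psi ->
  (flow_action 0 1 rho psi <= A%:E)%E -> 0 < s -> s < t -> t < 1 ->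
  exists c1 c2 c3, [/\ reach (rho 0) (rho s) (s * c1),
    reach (rho s) (rho t) ((t - s) * c2), reach (rho t) (rho 1) ((1 - t) * c3) &
    c1 + c2 + c3 <= A].
Proof.
move=> fl le s0 st t1.
have s1 := lt_trans st t1; have t0 := lt_trans s0 st.
have f1 : flow 0 s rho psi by apply: flow_sub fl => //; exact: ltW.
have f2 : flow s 1 rho psi by apply: flow_sub fl => //; exact: ltW.
have f3 : flow s t rho psi by apply: flow_sub f2 => //; exact: ltW.
have f4 : flow t 1 rho psi by apply: flow_sub f2 => //; exact: ltW.
have e1 : flow_action 0 1 rho psi =
    (flow_action 0 s rho psi + (flow_action s t rho psi + flow_action t 1 rho psi))%E.
  rewrite -flow_action_split ?(ltW st) ?(ltW t1) //.
  by rewrite -flow_action_split ?(ltW s0) ?(ltW s1).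
move: le; rewrite e1.
have p1 := flow_action_ge0 0 s rho psi; have p2 := flow_action_ge0 s t rho psi.
have p3 := flow_action_ge0 t 1 rho psi.
move=> le.
have := @flow_reach 0 s _ _ _ s0 f1; have := @flow_reach s t _ _ _ st f3.
have := @flow_reach t 1 _ _ _ t1 f4.
have q1 : (flow_action 0 s rho psi <= A%:E)%E.
  by apply: le_trans le; apply: leeDl; exact: adde_ge0.
have q2 : (flow_action s t rho psi <= A%:E)%E.
  by apply: le_trans le; apply: le_trans (leeDl _ p3) _; exact: leeDr.
have q3 : (flow_action t 1 rho psi <= A%:E)%E.
  by apply: le_trans le; apply: le_trans (leeDr _ p2) _; exact: leeDr.
move: le; case: (flow_action 0 s rho psi) p1 q1 => [c1| |] // _ _.
case: (flow_action s t rho psi) p2 q2 => [c2| |] // _ _.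
case: (flow_action t 1 rho psi) p3 q3 => [c3| |] // _ _.
rewrite -!EFinD lee_fin => le h3 h2 h1; exists c1, c2, c3; split.
- by have := h1 _ (lexx _); rewrite subr0.
- exact: h2.
- exact: h3.
- by rewrite -addrA.
Qed.

End chain.

(** * Joint convexity and duality of the action *)

Lemma ae_forall_fin (R : realType) (I : finType) (P : I -> R -> Prop) :
  (forall i, {ae @lebesgue_measure R, forall t, P i t}) ->
  {ae @lebesgue_measure R, forall t, forall i, P i t}.
Proof.
move=> h; apply: (@filter_forall _ I P); first exact: (ae_filter_ringOfSetsType lebesgue_measure).
exact: h.
Qed.

Lemma is_derive_bigsum (R : realType) (I : Type) (s : seq I) (f : I -> R -> R)
    (t : R) (df : I -> R) : (forall i, is_derive t 1 (f i) (df i)) ->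
  is_derive t 1 (fun u => \sum_(i <- s) f i u) (\sum_(i <- s) df i).
Proof.
move=> h; elim: s => [|i s IH].
  have -> : (fun u => \sum_(i <- [::]) f i u) = cst 0 by apply/funext => u; rewrite big_nil.
  by rewrite big_nil; exact: is_derive_cst.
have -> : (fun u => \sum_(j <- i :: s) f j u) = f i + (fun u => \sum_(j <- s) f j u).
  by apply/funext => u; rewrite big_cons.
by rewrite big_cons; apply: is_deriveD.
Qed.

Lemma is_derive_scale (R : realType) (c : R) (f : R -> R) (t df : R) :
  is_derive t 1 f df -> is_derive t 1 (fun u => c * f u) (c * df).
Proof. by move=> h; exact: (@is_deriveZ R R R f c t 1 df h). Qed.

Section convexity.
Context (R : realType) (X : finType) (Q : X -> X -> R) (pi : X -> R).
Hypothesis mc : markov_chain Q pi.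
Local Notation ew := (edge_weight Q pi).
Local Notation kin := (kinetic Q pi).
Local Notation flw := (flow Q pi).
Local Notation flact := (flow_action Q pi).

Lemma dirichlet_form_green rho phi psi :
  \sum_x phi x * laplacian (ew rho) psi x =
  2^-1 * \sum_x \sum_y ew rho x y * ((phi x - phi y) * (psi x - psi y)).
Proof. by apply: green => x y; exact: edge_weightC. Qed.

Section mixture.
Variables (I : finType) (p : I -> R).
Hypothesis (p0 : forall i, 0 <= p i).

Definition mixture (rho : I -> X -> R) (x : X) : R := \sum_i p i * rho i x.

Lemma edge_weight_mixture (rho : I -> X -> R) x y : (forall i x, 0 <= rho i x) ->
  \sum_i p i * ew (rho i) x y <= ew (mixture rho) x y.
Proof.
move=> rho0; rewrite /edge_weight.
have -> : \sum_i p i * (hat (rho i) x y * Q x y * pi x) =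
    (\sum_i p i * hat (rho i) x y) * (Q x y * pi x).
  by rewrite mulr_suml; apply: eq_bigr => i _; ring.
rewrite -mulrA; apply: ler_wpM2r; first exact: (mulr_ge0 (rate_ge0 mc x y) (stat_ge0 mc x)).
exact: (log_mean_concave p0 (fun i => rho0 i x) (fun i => rho0 i y)).
Qed.

(* A mixture of gradient fluxes need not be a gradient flux; its Hodge projection
   has the same divergence and no larger kinetic energy. *)
Definition mixture_flux (rho psi : I -> X -> R) (x : X) : R :=
  \sum_i p i * laplacian (ew (rho i)) (psi i) x.

Lemma mixture_flux_pair (rho psi : I -> X -> R) phi :
  \sum_x phi x * mixture_flux rho psi x =
  2^-1 * \sum_x \sum_y \sum_i (p i * ew (rho i) x y) *
    ((phi x - phi y) * (psi i x - psi i y)).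
Proof.
have -> : \sum_x phi x * mixture_flux rho psi x =
    \sum_i p i * \sum_x phi x * laplacian (ew (rho i)) (psi i) x.
  under eq_bigr do rewrite mulr_sumr; rewrite exchange_big /=.
  by apply: eq_bigr => i _; rewrite mulr_sumr; apply: eq_bigr => x _; ring.
under eq_bigr do rewrite dirichlet_form_green.
rewrite mulr_sumr; under [RHS]eq_bigr do rewrite mulr_sumr.
under [RHS]eq_bigr do under eq_bigr do rewrite mulr_sumr.
under [RHS]eq_bigr do rewrite exchange_big /=.
rewrite [RHS]exchange_big /=; apply: eq_bigr => i _.
rewrite mulrCA !mulr_sumr; apply: eq_bigr => x _.
by rewrite !mulr_sumr; apply: eq_bigr => y _; ring.
Qed.

(** The solvability condition for the potential of the mixture. A function in the kernel is constant
    across edges of positive mixture weight, and by concavity a component with nonzero coefficient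
    has no weight on the other edges. *)
Lemma mixture_flux_orthogonal (rho psi : I -> X -> R) phi :
  (forall i x, 0 <= rho i x) ->
  (forall x, laplacian (ew (mixture rho)) phi x = 0) ->
  \sum_x phi x * mixture_flux rho psi x = 0.
Proof.
move=> rho0 lap0.
have w0 := edge_weight_ge0 mc.
have : \sum_x phi x * laplacian (ew (mixture rho)) phi x = 0.
  by rewrite big1 // => x _; rewrite lap0 mulr0.
rewrite dirichlet_form_green => /eqP; rewrite mulf_eq0 invr_eq0 pnatr_eq0 /=.
have s0 x y : 0 <= ew (mixture rho) x y * ((phi x - phi y) * (phi x - phi y)).
  by rewrite mulr_ge0 // -expr2 sqr_ge0.
rewrite psumr_eq0 => [|x _]; last by apply: sumr_ge0.
move=> /allP h; rewrite mixture_flux_pair big1 ?mulr0 // => x _.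
rewrite big1 // => y _; rewrite big1 // => i _.
have := h x (mem_index_enum x); rewrite psumr_eq0 => [|z _]; last by [].
move=> /allP /(_ y (mem_index_enum y)) /=.
rewrite mulf_eq0 -expr2 sqrf_eq0 => /orP[/eqP we0|/eqP ->]; last by rewrite mul0r mulr0.
have := edge_weight_mixture x y rho0; rewrite we0 (bigD1 i) //= => le0.
suff -> : p i * ew (rho i) x y = 0 by rewrite mul0r.
apply/eqP; rewrite eq_le mulr_ge0 // andbT; apply: le_trans le0.
by rewrite lerDl sumr_ge0 // => j _; rewrite mulr_ge0.
Qed.

(** A projection argument: [e1] tests the common divergence against [phi], Young's inequality
    separates [phi] from the [psi i], and by [e3], concavity of the edge weights, the part in [phi]
    is absorbed on the left. *)
Lemma kinetic_mixture (rho psi : I -> X -> R) phi : (forall i x, 0 <= rho i x) ->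
  (forall x, laplacian (ew (mixture rho)) phi x = mixture_flux rho psi x) ->
  kin (mixture rho) phi <= \sum_i p i * kin (rho i) (psi i).
Proof.
move=> rho0 lapE.
have w0 := edge_weight_ge0 mc.
have e1 : kin (mixture rho) phi =
   \sum_x \sum_y \sum_i (p i * ew (rho i) x y) *
    ((phi x - phi y) * (psi i x - psi i y)).
  apply: (mulfI (_ : 2^-1 != 0 :> R)); first by rewrite invr_eq0 pnatr_eq0.
  rewrite -mixture_flux_pair kineticE.
  transitivity (\sum_x phi x * laplacian (ew (mixture rho)) phi x).
    by rewrite dirichlet_form_green; congr (_ * _).
  by apply: eq_bigr => x _; rewrite lapE.
have e2 : \sum_i p i * kin (rho i) (psi i) =
   \sum_x \sum_y \sum_i (p i * ew (rho i) x y) * (psi i x - psi i y) ^+ 2.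
  under [RHS]eq_bigr do rewrite exchange_big /=.
  rewrite [RHS]exchange_big /=; apply: eq_bigr => i _; rewrite kineticE.
  rewrite !mulr_sumr; apply: eq_bigr => x _.
  by rewrite !mulr_sumr; apply: eq_bigr => y _; ring.
have e3 : \sum_x \sum_y \sum_i (p i * ew (rho i) x y) * (phi x - phi y) ^+ 2
    <= kin (mixture rho) phi.
  rewrite kineticE; apply: ler_sum => x _; apply: ler_sum => y _.
  by rewrite -mulr_suml ler_wpM2r ?sqr_ge0 // edge_weight_mixture.
have : kin (mixture rho) phi <= 2^-1 *
   (\sum_x \sum_y \sum_i (p i * ew (rho i) x y) * (phi x - phi y) ^+ 2) + 2^-1 *
   \sum_x \sum_y \sum_i (p i * ew (rho i) x y) * (psi i x - psi i y) ^+ 2.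
  rewrite e1 !mulr_sumr -big_split; apply: ler_sum => x _ /=.
  rewrite !mulr_sumr -big_split; apply: ler_sum => y _ /=.
  rewrite !mulr_sumr -big_split; apply: ler_sum => i _ /=.
  have : 0 <= p i * ew (rho i) x y by rewrite mulr_ge0.
  move: (p i * ew (rho i) x y) => w hw.
  have := mulr_ge0 hw (sqr_ge0 ((phi x - phi y) - (psi i x - psi i y))); lra.
rewrite -e2; lra.
Qed.

Hypothesis p1 : \sum_i p i = 1.

Lemma density_mixture (rho : I -> X -> R) : (forall i, density pi (rho i)) ->
  density pi (mixture rho).
Proof.
move=> dens; split=> [x|]; first by apply: sumr_ge0 => i _; rewrite mulr_ge0 //; case: (dens i).
under eq_bigr do rewrite mulr_suml; rewrite exchange_big /= -p1; apply: eq_bigr => i _.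
under eq_bigr do rewrite -mulrA; rewrite -mulr_sumr.
by case: (dens i) => _ ->; rewrite mulr1.
Qed.

Lemma flow_mixture (a b : R) (rho psi : I -> R -> X -> R) :
  (forall i, flw a b (rho i) (psi i)) ->
  exists phi, flw a b (fun t => mixture (fun i => rho i t)) phi /\
    forall t, a <= t <= b -> kin (mixture (fun i => rho i t)) (phi t) <=
      \sum_i p i * kin (rho i t) (psi i t).
Proof.
move=> fl.
have rho0 i t x : a <= t <= b -> 0 <= rho i t x.
  by case: (fl i) => dens _ _ _ /dens[].
pose rh t := mixture (fun i => rho i t).
pose bf t := mixture_flux (fun i => rho i t) (fun i => psi i t).
pose phi t := hodge (ew (rh t)) (bf t).
have w0 := edge_weight_ge0 mc.
have wC := edge_weightC mc.
have orth t : a <= t <= b -> forall phi, (forall x, laplacian (ew (rh t)) phi x = 0) ->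
    \sum_x phi x * bf t x = 0.
  by move=> tab f; apply: mixture_flux_orthogonal => i x; exact: rho0.
have lapE t : a <= t <= b -> forall x, laplacian (ew (rh t)) (phi t) x = bf t x.
  by move=> tab; have [] := hodge_spec (w0 (rh t)) (wC (rh t)) (orth t tab).
exists phi; split; last first.
  by move=> t tab; apply: kinetic_mixture => [i x|]; [exact: rho0 | exact: lapE].
have mrh x : measurable_fun `[a, b] (fun t => rh t x).
  apply: measurable_sum => i; apply: measurable_funM => //.
  by case: (fl i) => _ ac _ _; exact: ac_measurable.
have mbf x : measurable_fun `[a, b] (fun t => bf t x).
  apply: measurable_sum => i; apply: measurable_funM => //.
  apply: measurable_sum => y; apply: measurable_funM.
    exact: (measurable_edge_weight _ _ (fl i)).
  by case: (fl i) => _ _ mpsi _; exact: measurable_funB.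
have mw x y : measurable_fun `[a, b] (fun t => ew (rh t) x y).
  apply: measurable_funM => //; apply: measurable_funM => //.
  have rh0 z t : `[a, b]%classic t -> 0 <= rh t z.
    rewrite /= in_itv /= => tab; apply: sumr_ge0 => i _; rewrite mulr_ge0 //.
    exact: rho0.
  by apply: measurable_log_mean => //; exact: rh0.
split.
- move=> t tab; apply: density_mixture => i.
  by case: (fl i) => dens _ _ _; exact: dens.
- move=> x; apply: ac_sum => i; apply: ac_scale.
  by case: (fl i).
- move=> x; apply: (measurable_hodge x mbf mw) => [t x' y _|t x' y _|t f] //.
  by rewrite /= in_itv /= => /orth; exact.
have : {ae @lebesgue_measure R, forall t : R, forall i, a <= t <= b -> forall x,
        is_derive t 1 (fun s : R => rho i s x)
          (- \sum_y (psi i t y - psi i t x) * hat (rho i t) x y * Q x y)}.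
  by apply: ae_forall_fin => i; case: (fl i).
apply: filterS; first exact: (ae_filter_ringOfSetsType lebesgue_measure).
move=> t h tab x.
have := is_derive_bigsum (index_enum I) (fun i => is_derive_scale (p i) (h i tab x)).
congr is_derive; apply: (mulfI (stat_neq0 mc x)).
rewrite continuity_laplacian lapE // mulr_sumr; apply: eq_bigr => i _.
by rewrite mulrCA continuity_laplacian.
Qed.

(** Joint convexity of the squared distance, at the level of curves. *)
Lemma reach_mixture (mu nu : I -> X -> R) (c : I -> R) :
  (forall i, reach Q pi (mu i) (nu i) (c i)) ->
  reach Q pi (mixture mu) (mixture nu) (\sum_i p i * c i).
Proof.
move=> h.
have /choice[z hz] : forall i, exists z : (R -> X -> R) * (R -> X -> R),
    admissible Q pi (mu i) (nu i) z.1 z.2 /\ (action Q pi z.1 z.2 <= (c i)%:E)%E.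
  by move=> i; have [rho [psi hh]] := h i; exists (rho, psi).
have fl i : flw 0 1 (z i).1 (z i).2 by have [/admissible_flow[]] := hz i.
have [phi [flphi le]] := flow_mixture fl.
exists (fun t => mixture (fun i => (z i).1 t)), phi; split.
  apply/admissible_flow; split => //; apply/funext => x; apply: eq_bigr => i _;
  by have [/admissible_flow[_ e0 e1]] := hz i; rewrite ?e0 ?e1.
rewrite -[action _ _ _ _]/(flact 0 1 _ _) /flow_action.
have mk i : measurable_fun `[0 : R, 1] (fun t : R => (kin ((z i).1 t) ((z i).2 t))%:E).
  by apply/measurable_EFinP; exact: (measurable_kinetic (fl i)).
have mk' i : measurable_fun `[0 : R, 1] (fun t : R => (p i * kin ((z i).1 t) ((z i).2 t))%:E).
  apply/measurable_EFinP; apply: measurable_funM => //.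
  exact: (measurable_kinetic (fl i)).
have k0 i (t : R) : (0 <= (p i * kin ((z i).1 t) ((z i).2 t))%:E)%E.
  by rewrite lee_fin mulr_ge0 // kinetic_ge0.
apply: (@le_trans _ _ ((2^-1)%:E * \int[lebesgue_measure]_(t in `[0%R, 1%R])
    (\sum_i (p i * kin ((z i).1 t) ((z i).2 t))%:E))%E).
  apply: lee_wpmul2l; first by rewrite lee_fin invr_ge0.
  apply: ge0_le_integral => //.
  - by move=> t _; rewrite lee_fin kinetic_ge0.
  - by apply/measurable_EFinP; exact: (measurable_kinetic flphi).
  - by apply: emeasurable_sum => i; exact: mk'.
  - move=> t; rewrite /= in_itv /= => t01; rewrite sumEFin lee_fin; exact: le.
rewrite ge0_integral_sum //.
rewrite ge0_sume_distrr; last by move=> i _; apply: integral_ge0 => t _.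
rewrite -sumEFin; apply: lee_sum => i _.
under eq_integral do rewrite EFinM.
rewrite ge0_integralZl ?lee_fin //; [|exact: mk|by move=> t _; rewrite lee_fin kinetic_ge0].
rewrite muleCA EFinM; apply: lee_wpmul2l; first by rewrite lee_fin.
by have [_] := hz i.
Qed.

End mixture.

(** Weak duality: the mean of [phi] along the curve grows at the rate of the energy pairing of [phi]
    and [psi], which Young's inequality splits with weight [l]. The energy of [phi] changes with the
    density, hence the uniform bound [M]. *)
Lemma flow_duality (a b A M l : R) rho psi (phi : X -> R) : a <= b -> 0 < l ->
  flw a b rho psi -> (flact a b rho psi <= A%:E)%E ->
  (forall t, a <= t <= b -> 2^-1 * kin (rho t) phi <= M) ->
  \sum_x phi x * (rho b x - rho a x) * pi x <= l / 2 * (M * (b - a)) + (2 * l)^-1 * A.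
Proof.
move=> ab l0 fl le hM.
have mk := measurable_kinetic fl.
pose g t := \sum_x (phi x * pi x) * rho t x.
have acg : absolutely_continuous a b g.
  by apply: ac_sum => x; apply: ac_scale; case: fl.
have M0 : 0 <= M.
  apply: le_trans (hM a _); last by rewrite lexx.
  by rewrite mulr_ge0 ?invr_ge0 // kinetic_ge0.
(* [kinetic] lacks the factor 1/2 of the action: hence [4 * l] here and [2 * l] in the
   conclusion. *)
pose k t := l / 2 * M + (4 * l)^-1 * kin (rho t) (psi t).
have k0 t : a <= t <= b -> 0 <= k t.
  move=> _; have l4 : 0 <= (4 * l)^-1 by rewrite invr_ge0 mulr_ge0 // ltW.
  by rewrite addr_ge0 ?mulr_ge0 ?kinetic_ge0 // ltW.
have ikin : (@lebesgue_measure R).-integrable `[a, b] (EFin \o (fun t => kin (rho t) (psi t))).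
  apply/integrableP; split; first exact/measurable_EFinP.
  apply: (@le_lt_trans _ _ (2%:E * flact a b rho psi)%E); last first.
    by apply: (@le_lt_trans _ _ (2%:E * A%:E)%E); [apply: lee_wpmul2l; rewrite ?lee_fin | rewrite -EFinM ltry].
  rewrite /flow_action muleA -EFinM divff ?pnatr_eq0 // mul1e.
  apply: ge0_le_integral => //.
  - by apply: measurableT_comp => //; exact/measurable_EFinP.
  - exact/measurable_EFinP.
  - by move=> u _; rewrite /= ger0_norm ?kinetic_ge0.
have leb_ab : @lebesgue_measure R `[a, b] = (b - a)%:E.
  rewrite lebesgue_measure_itv /= lte_fin; move: ab; rewrite le_eqVlt.
  by move=> /orP[/eqP ->|->]; rewrite ?ltxx ?subrr.
have icst (c : R) : (@lebesgue_measure R).-integrable `[a, b] (EFin \o (fun=> c)).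
  apply: continuous_compact_integrable; first exact: segment_compact.
  by move=> x; exact: cvg_cst.
have ik2 : (@lebesgue_measure R).-integrable `[a, b]
    (EFin \o (fun t => (4 * l)^-1 * kin (rho t) (psi t))).
  exact: (integrableZl _ _ ikin).
have ik : (@lebesgue_measure R).-integrable `[a, b] (EFin \o k).
  exact: (integrableD _ (icst _) ik2).
have dg : {ae @lebesgue_measure R, forall t, a <= t <= b ->
    exists2 d : R, is_derive t 1 g d & d <= k t}.
  case: (fl) => _ _ _; apply: filterS; first exact: (ae_filter_ringOfSetsType lebesgue_measure).
  move=> t h tab.
  exists (\sum_x phi x * laplacian (ew (rho t)) (psi t) x).
    have := is_derive_bigsum (index_enum X) (fun x => is_derive_scale (phi x * pi x) (h tab x)).
    by congr is_derive; apply: eq_bigr => x _; rewrite -mulrA continuity_laplacian.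
  rewrite dirichlet_form_green.
  have : 2^-1 * \sum_x \sum_y ew (rho t) x y * ((phi x - phi y) * (psi t x - psi t y)) <=
      l / 2 * (2^-1 * kin (rho t) phi) + (4 * l)^-1 * kin (rho t) (psi t).
    rewrite !kineticE !mulr_sumr -big_split; apply: ler_sum => x _ /=.
    rewrite !mulr_sumr -big_split; apply: ler_sum => y _ /=.
    have w0 := edge_weight_ge0 mc (rho t) x y.
    have key := mulr_ge0 w0 (sqr_ge0 (l * (phi x - phi y) - (psi t x - psi t y))).
    have l4 : 0 < 4 * l by rewrite mulr_gt0.
    rewrite -(ler_pM2l l4).
    have -> : 4 * l * (l / 2 * (2^-1 * (ew (rho t) x y * (phi x - phi y) ^+ 2)) +
      (4 * l)^-1 * (ew (rho t) x y * (psi t x - psi t y) ^+ 2)) =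
      l ^+ 2 * (ew (rho t) x y * (phi x - phi y) ^+ 2) +
      ew (rho t) x y * (psi t x - psi t y) ^+ 2 by field; rewrite gt_eqF.
    lra.
  move/le_trans; apply; rewrite /k lerD2r ler_wpM2l ?divr_ge0 ?(ltW l0) //.
  exact: hM.
have := ac_increment ab acg ik k0 dg.
have -> : g b - g a = \sum_x phi x * (rho b x - rho a x) * pi x.
  by rewrite -sumrB; apply: eq_bigr => x _; ring.
move/le_trans; apply.
rewrite RintegralD // Rintegral_cst // RintegralZl //.
rewrite (_ : fine _ = b - a); last exact: (congr1 fine leb_ab).
have : fine (flact a b rho psi) <= A.
  rewrite -lee_fin fineK //; rewrite ge0_fin_numE ?flow_action_ge0 //.
  exact: le_lt_trans le (ltry _).
rewrite /flow_action fineM //; last first.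
  exact: (integrable_fin_num _ ikin).
rewrite -[fine (\int[_]_(_ in _) _)]/(\int[lebesgue_measure]_(t in `[a, b]) kin (rho t) (psi t)).
move: (\int[lebesgue_measure]_(t in `[a, b]) kin (rho t) (psi t)) => J /= hJ.
rewrite -mulrA lerD2l.
have -> : (4 * l)^-1 * J = (2 * l)^-1 * (2^-1 * J) by field; rewrite gt_eqF.
by rewrite ler_wpM2l // invr_ge0 mulr_ge0 // ltW.
Qed.

End convexity.

(** * The transport distance *)

Section distance.
Context (R : realType) (X : finType) (Q : X -> X -> R) (pi : X -> R).
Hypothesis mc : markov_chain Q pi.

Let action_inf_ge0 mu nu : (0 <= ereal_inf [set action Q pi c.1 c.2 |
    c in [set c | admissible Q pi mu nu c.1 c.2]])%E.
Proof.
apply: le_ereal_inf_tmp => _ [c _ <-].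
exact: (flow_action_ge0 mc 0 1).
Qed.

Lemma transport_dist_ge0 mu nu : (0 <= transport_dist Q pi mu nu)%E.
Proof. exact: sqrte_ge0. Qed.

Lemma reach_transport_dist mu nu c : reach Q pi mu nu c ->
  (transport_dist Q pi mu nu ^+ 2 <= c%:E)%E.
Proof.
move=> [rho [psi [adm le]]].
rewrite /transport_dist sqr_sqrte //; apply: le_trans le.
by apply: ereal_inf_lbound; exists (rho, psi).
Qed.

Lemma transport_dist_reach mu nu c : (transport_dist Q pi mu nu ^+ 2 < c%:E)%E ->
  reach Q pi mu nu c.
Proof.
rewrite /transport_dist sqr_sqrte // => /ereal_inf_lt[_ [[rho psi] /= adm <-] lt].
by exists rho, psi; split => //; exact: ltW.
Qed.

Lemma transport_dist_lty mu nu : (transport_dist Q pi mu nu < +oo)%E ->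
  exists c, reach Q pi mu nu c.
Proof.
have := transport_dist_ge0 mu nu; have := @transport_dist_reach mu nu.
case: (transport_dist Q pi mu nu) => [r| |] // h r0 _.
by exists (r ^+ 2 + 1); apply: h; rewrite -EFin_expe lte_fin ltrDl.
Qed.

(** * The real-valued distance, under a bound on the diameter that the Gaussian moment will
    supply *)

Section finite_diameter.
Variable D2 : R.
Hypothesis diam : forall mu nu, density pi mu -> density pi nu -> reach Q pi mu nu D2.

Definition dist mu nu : R := fine (transport_dist Q pi mu nu).

Lemma dist_ge0 mu nu : 0 <= dist mu nu.
Proof. exact: fine_ge0 (transport_dist_ge0 mu nu). Qed.

Lemma distE mu nu : density pi mu -> density pi nu ->
  transport_dist Q pi mu nu = (dist mu nu)%:E.
Proof.
move=> dmu dnu; rewrite fineK // ge0_fin_numE ?transport_dist_ge0 //.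
have := reach_transport_dist (diam dmu dnu).
have := transport_dist_ge0 mu nu.
by case: (transport_dist Q pi mu nu) => [r| |] //; rewrite ltry.
Qed.

Lemma dist_le mu nu c : reach Q pi mu nu c -> dist mu nu ^+ 2 <= c.
Proof.
move=> h; have [dmu dnu] := reach_density h.
by have := reach_transport_dist h; rewrite distE // -EFin_expe lee_fin.
Qed.

Lemma dist_reach mu nu c : density pi mu -> density pi nu ->
  dist mu nu ^+ 2 < c -> reach Q pi mu nu c.
Proof.
by move=> dmu dnu h; apply: transport_dist_reach; rewrite distE // -EFin_expe lte_fin.
Qed.

Lemma dist_refl mu : density pi mu -> dist mu mu = 0.
Proof.
move=> dmu; have := dist_le (reach_refl Q dmu).
by move=> h; apply/eqP; rewrite -sqrf_eq0 eq_le h sqr_ge0.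
Qed.

Lemma distC mu nu : density pi mu -> density pi nu -> dist mu nu = dist nu mu.
Proof.
have le mu' nu' : density pi mu' -> density pi nu' -> dist mu' nu' <= dist nu' mu'.
  move=> dmu dnu; rewrite -ler_sqr ?nnegrE ?dist_ge0 //.
  apply/ler_addgt0Pr => e e0; apply: dist_le; apply: reach_sym => //.
  by apply: dist_reach => //; rewrite ltrDl.
by move=> dmu dnu; apply/eqP; rewrite eq_le !le.
Qed.

Lemma dist_triangle mu nu sigma : density pi mu -> density pi nu -> density pi sigma ->
  dist mu sigma <= dist mu nu + dist nu sigma.
Proof.
move=> d1 d2 d3; apply/ler_addgt0Pr => e e0.
pose u := dist mu nu + e / 2; pose v := dist nu sigma + e / 2.
have e2 : 0 < e / 2 by rewrite divr_gt0.
have u0 : 0 < u by rewrite ltr_wpDl ?dist_ge0.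
have v0 : 0 < v by rewrite ltr_wpDl ?dist_ge0.
have -> : dist mu nu + dist nu sigma + e = u + v by rewrite /u /v; lra.
have uv0 : 0 < u + v by rewrite addr_gt0.
rewrite -ler_sqr ?nnegrE ?dist_ge0 ?(ltW uv0) //; apply: dist_le.
have ru : reach Q pi mu nu (u ^+ 2).
  by apply: dist_reach => //; rewrite ltr_sqr ?nnegrE ?dist_ge0 ?(ltW u0) // ltrDl.
have rv : reach Q pi nu sigma (v ^+ 2).
  by apply: dist_reach => //; rewrite ltr_sqr ?nnegrE ?dist_ge0 ?(ltW v0) // ltrDl.
(* This share of time minimizes [u^2 / l + v^2 / (1 - l)], with minimum [(u + v)^2]; the added
   [e / 2] keeps [u] and [v] positive. *)
have l01 : 0 < u / (u + v) < 1.
  by rewrite divr_gt0 //= ltr_pdivrMr // mul1r ltrDl.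
have := reach_trans mc l01 ru rv.
congr reach; field.
by rewrite !gt_eqF //; lra.
Qed.

(* [nu] is a mixture of [mu] and another density, with weights [1 - e] and [e]. *)
Lemma dist_squeeze mu nu e : density pi mu -> density pi nu -> 0 < e < 1 ->
  (forall x, (1 - e) * mu x <= nu x) -> dist nu mu ^+ 2 <= e * D2.
Proof.
move=> dmu dnu /andP[e0 e1] le; rewrite distC //.
pose sigma x := (nu x - (1 - e) * mu x) / e.
have dsigma : density pi sigma.
  case: dmu dnu => mu0 mu1 [nu0 nu1].
  split=> [x|]; first by rewrite divr_ge0 ?(ltW e0) // subr_ge0.
  have -> : \sum_x sigma x * pi x = (\sum_x nu x * pi x - (1 - e) * \sum_x mu x * pi x) / e.
    rewrite mulr_sumr -sumrB mulr_suml; apply: eq_bigr => x _; rewrite /sigma; ring.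
  by rewrite mu1 nu1 mulr1 subKr divff // gt_eqF.
pose p (b : bool) := if b then 1 - e else e.
have p0 b : 0 <= p b by case: b; rewrite /p ?subr_ge0 ltW.
have p1 : \sum_b p b = 1 by rewrite big_bool /= subrK.
have h b : reach Q pi ((fun=> mu) b) ((fun b => if b then mu else sigma) b)
    ((fun b => if b then 0 else D2) b).
  by case: b => /=; [exact: reach_refl | exact: diam].
have := reach_mixture mc p0 p1 h.
have -> : mixture p (fun=> mu) = mu.
  by apply/funext => x; rewrite /mixture big_bool /= -mulrDl subrK mul1r.
have -> : mixture p (fun b => if b then mu else sigma) = nu.
  apply/funext => x; rewrite /mixture big_bool /= /sigma mulrC [e * _]mulrC divfK ?gt_eqF //.
  by rewrite mulrC; ring.
by rewrite big_bool /= mulr0 add0r => /dist_le.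
Qed.

End finite_diameter.
End distance.

(** * Existence of geodesics *)

Section geodesics.
Context (R : realType) (X : finType) (Q : X -> X -> R) (pi : X -> R).
Hypothesis mc : markov_chain Q pi.
Variable D2 : R.
Hypothesis diam : forall mu nu, density pi mu -> density pi nu -> reach Q pi mu nu D2.
Local Notation W := (dist Q pi).

Lemma density_le mu x : density pi mu -> mu x <= (pi x)^-1.
Proof.
move=> [mu0 mu1]; rewrite -[leRHS]mul1r ler_pdivlMr ?(stat_gt0 mc) // -mu1.
rewrite (bigD1 x) //= lerDl sumr_ge0 // => y _.
by rewrite mulr_ge0 // (stat_ge0 mc).
Qed.

Lemma density_cvg (F : set_system nat) (f : nat -> X -> R) (g : X -> R) :
  ProperFilter F -> (forall n, density pi (f n)) ->
  (forall x, f n x @[n --> F] --> g x) -> density pi g.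
Proof.
move=> FF df cvg; split=> [x|].
  by apply: (cvgr_to_ge (cvg x)); near=> n; case: (df n).
have c1 : \sum_x f n x * pi x @[n --> F] --> \sum_x g x * pi x.
  apply: cvg_big => [|x _]; first exact: add_continuous.
  by apply: cvgM => //; exact: cvg_cst.
have c2 : \sum_x f n x * pi x @[n --> F] --> (1 : R).
  have -> : (fun n => \sum_x f n x * pi x) = cst 1.
    by apply/funext => n; case: (df n).
  exact: cvg_cst.
exact: (cvg_unique _ c1 c2).
Unshelve. all: by end_near.
Qed.

(** Pointwise convergence eventually gives [(1 - e') g <= f n], trivially so where [g] vanishes, and
    [dist_squeeze] needs no more than this lower bound. *)
Lemma dist_cvg (F : set_system nat) (f : nat -> X -> R) (g : X -> R) :
  ProperFilter F -> (forall n, density pi (f n)) ->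
  (forall x, f n x @[n --> F] --> g x) -> W (f n) g @[n --> F] --> (0 : R).
Proof.
move=> FF df cvg.
have dg := density_cvg FF df cvg.
have D20 : 0 <= D2 by exact: (reach_ge0 mc (diam dg dg)).
apply/cvgrPdist_lt => e e0.
have ee : 0 < e ^+ 2 by rewrite exprn_gt0.
have den : 0 < D2 + 1 + e ^+ 2 by lra.
(* Chosen so that [e' < 1] and [e' * D2 < e ^+ 2]. *)
pose e' := e ^+ 2 / (D2 + 1 + e ^+ 2).
have e'0 : 0 < e' by rewrite divr_gt0.
have e'1 : e' < 1 by rewrite ltr_pdivrMr // mul1r; lra.
have nearx : \forall n \near F, forall x, (1 - e') * g x <= f n x.
  apply: filter_forall => x; have [g0|gn0] := eqVneq (g x) 0.
    by near=> n; rewrite g0 mulr0; case: (df n).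
  have gp : 0 < g x by rewrite lt_neqAle eq_sym gn0; case: dg => h _; exact: h.
  have lt : (1 - e') * g x < g x by rewrite gtr_pMl // gtrBl.
  by near=> n; apply: ltW; near: n; exact: (cvgr_gt _ (cvg x) _ lt).
near=> n; rewrite sub0r normrN ger0_norm ?dist_ge0 //.
rewrite -ltr_sqr ?nnegrE ?dist_ge0 ?(ltW e0) //.
have le : forall x, (1 - e') * g x <= f n x by near: n.
apply: (@le_lt_trans _ _ (e' * D2)).
  by apply: (dist_squeeze mc diam) => //; rewrite e'0.
by rewrite /e' mulrAC ltr_pdivrMr // ltr_pM2l //; lra.
Unshelve. all: by end_near.
Qed.

Lemma dist_cvg2 (F : set_system nat) (f f' : nat -> X -> R) (g g' : X -> R) :
  ProperFilter F -> (forall n, density pi (f n)) -> (forall n, density pi (f' n)) ->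
  (forall x, f n x @[n --> F] --> g x) -> (forall x, f' n x @[n --> F] --> g' x) ->
  W (f n) (f' n) @[n --> F] --> W g g'.
Proof.
move=> FF df df' cvg cvg'.
have dg := density_cvg FF df cvg; have dg' := density_cvg FF df' cvg'.
have c := dist_cvg FF df cvg; have c' := dist_cvg FF df' cvg'.
have cc : W (f n) g + W (f' n) g' @[n --> F] --> (0 : R).
  by rewrite -[0 : R]addr0; exact: cvgD.
apply: (@squeeze_cvgr _ F _ R (fun n => W g g' - (W (f n) g + W (f' n) g'))
  (fun n => W g g' + (W (f n) g + W (f' n) g'))).
- near=> n.
  have t1 := dist_triangle mc diam dg (df n) dg'.
  have t2 := dist_triangle mc diam (df n) (df' n) dg'.
  have t3 := dist_triangle mc diam (df n) dg (df' n).
  have t4 := dist_triangle mc diam dg dg' (df' n).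
  move: t1 t4; rewrite (distC mc diam dg (df n)) (distC mc diam dg' (df' n)) => t1 t4.
  by apply/andP; split; lra.
- by rewrite -[X in _ --> X]subr0; apply: cvgB => //; exact: cvg_cst.
- by rewrite -[X in _ --> X]addr0; apply: cvgD => //; exact: cvg_cst.
Unshelve. all: by end_near.
Qed.

(* Equality case of the Cauchy-Schwarz inequality behind the restriction of a minimizing curve. *)
Lemma equal_speeds (a b c w s t : R) : 0 < s -> s < t -> t < 1 ->
  w <= a + b + c -> 0 <= w -> a ^+ 2 / s + b ^+ 2 / (t - s) + c ^+ 2 / (1 - t) <= w ^+ 2 ->
  [/\ a = s * w, b = (t - s) * w & c = (1 - t) * w].
Proof.
move=> s0 st t1 le w0 h.
have ts : 0 < t - s by rewrite subr_gt0.
have t1' : 0 < 1 - t by rewrite subr_gt0.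
have e : (a - s * w) ^+ 2 / s + (b - (t - s) * w) ^+ 2 / (t - s) +
    (c - (1 - t) * w) ^+ 2 / (1 - t) =
    a ^+ 2 / s + b ^+ 2 / (t - s) + c ^+ 2 / (1 - t) - 2 * w * (a + b + c) + w ^+ 2.
  by field; rewrite !gt_eqF.
have p1 : 0 <= (a - s * w) ^+ 2 / s by rewrite divr_ge0 ?sqr_ge0 // ltW.
have p2 : 0 <= (b - (t - s) * w) ^+ 2 / (t - s) by rewrite divr_ge0 ?sqr_ge0 // ltW.
have p3 : 0 <= (c - (1 - t) * w) ^+ 2 / (1 - t) by rewrite divr_ge0 ?sqr_ge0 // ltW.
have ww : w * w <= w * (a + b + c) by rewrite ler_wpM2l.
have le0 : (a - s * w) ^+ 2 / s + (b - (t - s) * w) ^+ 2 / (t - s) +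
    (c - (1 - t) * w) ^+ 2 / (1 - t) <= 0 by rewrite e; lra.
have z (u v : R) : 0 < v -> u ^+ 2 / v <= 0 -> u = 0.
  move=> v0 huv; apply/eqP; rewrite -sqrf_eq0 eq_le sqr_ge0 andbT.
  by move: huv; rewrite ler_pdivrMr // mul0r.
have nonpos (u v r : R) : 0 <= u -> 0 <= v -> 0 <= r -> u + v + r <= 0 ->
  [/\ u <= 0, v <= 0 & r <= 0] by move=> *; split; lra.
have [q1 q2 q3] := nonpos _ _ _ p1 p2 p3 le0.
by split; apply/eqP; rewrite -subr_eq0; apply/eqP;
  [exact: (z _ s) | exact: (z _ (t - s)) | exact: (z _ (1 - t))].
Qed.

Lemma dist_div_le (mu nu : X -> R) (l c : R) : 0 < l -> reach Q pi mu nu (l * c) ->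
  W mu nu ^+ 2 / l <= c.
Proof. by move=> l0 /(dist_le mc diam); rewrite ler_pdivrMr // [c * l]mulrC. Qed.

(* The geodesic is the limit, along an ultrafilter, of curves of almost minimal action. *)
Lemma geodesic_exists mu nu : density pi mu -> density pi nu ->
  exists2 rho, constant_speed_geodesic Q pi rho & rho 0 = mu /\ rho 1 = nu.
Proof.
move=> dmu dnu; pose w := W mu nu.
have w0 : 0 <= w by exact: dist_ge0.
have /choice[z hz] : forall n, exists z : (R -> X -> R) * (R -> X -> R),
    admissible Q pi mu nu z.1 z.2 /\ (action Q pi z.1 z.2 <= (w ^+ 2 + n.+1%:R^-1)%:E)%E.
  move=> n; have [|rho [psi h]] := @dist_reach R X Q pi mc D2 diam mu nu (w ^+ 2 + n.+1%:R^-1) dmu dnu.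
    by rewrite ltrDl invr_gt0.
  by exists (rho, psi).
pose f n := (z n).1.
have fl n : flow Q pi 0 1 (f n) (z n).2 by have [/admissible_flow[]] := hz n.
have f0 n : f n 0 = mu by have [/admissible_flow[]] := hz n.
have f1 n : f n 1 = nu by have [/admissible_flow[]] := hz n.
have df n t : 0 <= t <= 1 -> density pi (f n t) by case: (fl n) => d _ _ _; exact: d.
(* Bounded sequences converge along an ultrafilter, so the limits exist at all times at once,
   without extracting subsequences. *)
have [U [UU ooU]] := @ultraFilterLemma nat \oo _.
have UF : ProperFilter U by exact: ultra_proper.
have cl t x : 0 <= t <= 1 -> exists l : R, f n t x @[n --> U] --> l.
  move=> t01.
  have [|l [_ hl]] := @segment_compact R 0 (pi x)^-1 (f n t x @[n --> U]) _.
    suff : U ((fun n => f n t x) @^-1` `[0, (pi x)^-1]) by [].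
    apply: (filterS _ (@filterT _ U _)) => n _ /=; have d := df n t t01.
    by rewrite /= in_itv /= (density_le x d) andbT; case: d => h _; exact: h.
  exists l => A Al; have [//|UC] := in_ultra_setVsetC ((fun n => f n t x) @^-1` A) UU.
  by have [y []] := hl (~` A) A UC Al.
pose g t x := lim (f n t x @[n --> U]).
have cg t x : 0 <= t <= 1 -> f n t x @[n --> U] --> g t x.
  by move=> /(cl t x)[l hl]; apply/cvg_ex; exists l.
have cgd t : 0 <= t <= 1 -> density pi (g t).
  move=> t01; apply: (@density_cvg U (fun n => f n t) _ UF) => [n|x]; first exact: df.
  exact: cg.
have z01 : 0 <= (0 : R) <= 1 by rewrite lexx ler01.
have o01 : 0 <= (1 : R) <= 1 by rewrite lexx ler01.
have g0 : g 0 = mu.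
  apply/funext => x.
  suff c : f n 0 x @[n --> U] --> mu x by exact: (cvg_unique _ (cg 0 x z01) c).
  have -> : (fun n => f n 0 x) = cst (mu x) by apply/funext => n; rewrite f0.
  exact: cvg_cst.
have g1 : g 1 = nu.
  apply/funext => x.
  suff c : f n 1 x @[n --> U] --> nu x by exact: (cvg_unique _ (cg 1 x o01) c).
  have -> : (fun n => f n 1 x) = cst (nu x) by apply/funext => n; rewrite f1.
  exact: cvg_cst.
have Wc s t : 0 <= s <= 1 -> 0 <= t <= 1 -> W (f n s) (f n t) @[n --> U] --> W (g s) (g t).
  move=> hs ht; apply: (@dist_cvg2 U (fun n => f n s) (fun n => f n t) _ _ UF) => *;
  by [exact: df | exact: cg].
(* Only the distances pass to the limit, by continuity of [W] under pointwise convergence; the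
   potentials need no limit. *)
have key s t : 0 < s -> s < t -> t < 1 -> [/\ W mu (g s) = s * w,
    W (g s) (g t) = (t - s) * w & W (g t) nu = (1 - t) * w].
  move=> s0 st t1; have s1 := lt_trans st t1; have t0 := lt_trans s0 st.
  have hs : 0 <= s <= 1 by rewrite !ltW.
  have ht : 0 <= t <= 1 by rewrite !ltW.
  apply: equal_speeds => //.
    apply: le_trans (dist_triangle mc diam dmu (cgd _ ht) dnu) _; rewrite lerD2r.
    exact: (dist_triangle mc diam dmu (cgd _ hs) (cgd _ ht)).
  have c1 := Wc _ _ z01 hs; have c2 := Wc _ _ hs ht; have c3 := Wc _ _ ht o01.
  have C : W (f n 0) (f n s) ^+ 2 / s + W (f n s) (f n t) ^+ 2 / (t - s) +
      W (f n t) (f n 1) ^+ 2 / (1 - t) @[n --> U] -->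
      W (g 0) (g s) ^+ 2 / s + W (g s) (g t) ^+ 2 / (t - s) + W (g t) (g 1) ^+ 2 / (1 - t).
    by apply: cvgD; [apply: cvgD|]; (apply: cvgM; [exact: cvgM | exact: cvg_cst]).
  have C' : w ^+ 2 + n.+1%:R^-1 @[n --> U] --> w ^+ 2 + 0.
    apply: cvgD; first exact: cvg_cst.
    by apply: cvg_trans (@cvg_harmonic R); exact: cvg_app.
  move: C; rewrite g0 g1 => C; rewrite -[w ^+ 2]addr0.
  apply: (ler_cvg_to C C'); near=> n.
  have [_ le] := hz n.
  have [k1 [k2 [k3 [r1 r2 r3 ks]]]] := flow_pieces mc (fl n) le s0 st t1.
  apply: le_trans ks; apply: lerD; [apply: lerD|]; apply: dist_div_le => //; by rewrite subr_gt0.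
exists g => //; split => // s t.
have dE a b : 0 <= a <= 1 -> 0 <= b <= 1 ->
    transport_dist Q pi (g a) (g b) = (W (g a) (g b))%:E.
  by move=> ha hb; apply: (distE mc diam); exact: cgd.
suff main a b : 0 <= a -> a <= b -> b <= 1 -> W (g a) (g b) = (b - a) * w.
  move=> hs ht; rewrite !dE // -EFinM g0 g1 -/w; congr EFin.
  case: (leP s t) => st.
    by rewrite distrC ger0_norm ?subr_ge0 // main //; [case/andP: hs|case/andP: ht].
  rewrite gtr0_norm ?subr_gt0 // (distC mc diam) //; try exact: cgd.
  by rewrite main ?(ltW st) //; [case/andP: ht|case/andP: hs].
move=> a0 ab b1.
have [ab'|abn] := eqVneq a b.
  by rewrite ab' subrr mul0r (dist_refl mc diam) //; apply: cgd; rewrite b1 -ab' a0.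
have {}ab : a < b by rewrite lt_neqAle abn.
have [az|an0] := eqVneq a 0; have [bo|bn1] := eqVneq b 1.
- by rewrite az bo g0 g1 subr0 mul1r.
- have b0 : 0 < b by rewrite -az.
  have {}b1 : b < 1 by rewrite lt_neqAle bn1.
  (* [key] asks for two interior times; the second one is arbitrary. *)
  rewrite az g0 subr0; have [|||//] := @key b ((b + 1) / 2); lra.
- have {}a0 : 0 < a by rewrite lt_neqAle eq_sym an0.
  rewrite bo g1; have [|||//] := @key (a / 2) a; lra.
have {}a0 : 0 < a by rewrite lt_neqAle eq_sym an0.
have {}b1 : b < 1 by rewrite lt_neqAle bn1.
by have [] := key a b a0 ab b1.
Unshelve. all: by end_near.
Qed.

End geodesics.

(** * The HWI inequality and Gaussian moments *)

Lemma entropy_tangent (R : realType) (s t : R) : 0 <= s -> 0 < t ->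
  s * ln t + (s - t) <= s * ln s.
Proof.
move=> s0 t0; have [->|sn0] := eqVneq s 0; first by rewrite !mul0r; lra.
have sp : 0 < s by rewrite lt_neqAle eq_sym sn0.
have := expR_ge1Dx (ln t - ln s).
rewrite expRD expRN !lnK ?posrE // => h.
have := ler_wpM2l s0 h; rewrite [s * (t / s)]mulrC divfK // => {}h.
by rewrite mulrDr mulr1 mulrBr in h; lra.
Qed.

Section hwi.
Context (R : realType) (X : finType) (Q : X -> X -> R) (pi : X -> R).
Hypothesis mc : markov_chain Q pi.

(** Convexity of the entropy at a positive density. It serves for the slope in [hwi], for the
    dissipation along the Euler step and, at an exponential density, as the Gibbs variational
    principle. *)
Lemma entropy_tangent_sum mu nu : density pi mu -> density pi nu ->
  (forall x, 0 < mu x) ->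
  entropy pi mu + \sum_x ln (mu x) * (nu x - mu x) * pi x <= entropy pi nu.
Proof.
move=> [_ mu1] [nu0 nu1] mup; rewrite /entropy -big_split /=.
have -> : \sum_x pi x * (nu x * ln (nu x)) =
    \sum_x (pi x * (nu x * ln (nu x)) - (nu x * pi x - mu x * pi x)).
  by rewrite sumrB sumrB mu1 nu1 subrr subr0.
apply: ler_sum => x _.
have := ler_wpM2l (stat_ge0 mc x) (entropy_tangent (nu0 x) (mup x)); lra.
Qed.

(* By [log_mean_ln] this is the Dirichlet form of [mu] and [ln mu]. *)
Definition fisher (mu : X -> R) : R := 2^-1 * kinetic Q pi mu (fun x => ln (mu x)).

Lemma fisher_ge0 mu : 0 <= fisher mu.
Proof. by rewrite mulr_ge0 ?invr_ge0 // kinetic_ge0. Qed.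

Lemma density1 : density pi (fun=> 1).
Proof. by split => [//|]; under eq_bigr do rewrite mul1r; exact: sum_stat mc. Qed.

Lemma entropy1 : entropy pi (fun=> 1) = 0.
Proof. by rewrite /entropy big1 // => x _; rewrite ln1 !mulr0. Qed.

Lemma kinetic_le (rho nu phi : X -> R) (c : R) : 0 <= c ->
  (forall x, 0 <= rho x) -> (forall x, 0 <= nu x) -> (forall x, rho x <= c * nu x) ->
  kinetic Q pi rho phi <= c * kinetic Q pi nu phi.
Proof.
move=> c0 rho0 nu0 le; rewrite !kineticE mulr_sumr; apply: ler_sum => x _.
rewrite mulr_sumr; apply: ler_sum => y _; rewrite mulrA ler_wpM2r ?sqr_ge0 //.
rewrite /edge_weight !mulrA ler_wpM2r ?(stat_ge0 mc) // ler_wpM2r ?(rate_ge0 mc) //.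
by have := le_log_mean (rho0 x) (rho0 y) (le x) (le y); rewrite (log_meanZ c0 (nu0 x) (nu0 y)).
Qed.

(** Bounds the energy of an indicator uniformly over densities, since the logarithmic mean is at
    most the sum of its arguments and a density at most [(pi x)^-1]. *)
Let K : R := \sum_x \sum_y ((pi x)^-1 + (pi y)^-1) * Q x y * pi x.

Lemma kinetic_indicator rho (e : R) z : density pi rho -> e ^+ 2 = 1 ->
  2^-1 * kinetic Q pi rho (fun x => e * (x == z)%:R) <= K.
Proof.
move=> drho e1.
have kK : kinetic Q pi rho (fun x => e * (x == z)%:R) <= K.
  rewrite kineticE; apply: ler_sum => x _; apply: ler_sum => y _.
  have h1 : (e * (x == z)%:R - e * (y == z)%:R) ^+ 2 <= 1.
    rewrite -mulrBr exprMn e1 mul1r.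
    by case: (x == z); case: (y == z) => /=; rewrite ?subrr ?subr0 ?sub0r ?sqrrN ?expr1n ?expr0n.
  have w0 := edge_weight_ge0 mc rho x y.
  apply: (@le_trans _ _ (edge_weight Q pi rho x y)).
    by rewrite -[leRHS]mulr1 ler_wpM2l.
  rewrite /edge_weight ler_wpM2r ?(stat_ge0 mc) // ler_wpM2r ?(rate_ge0 mc) //.
  have [rho0 _] := drho.
  apply: le_trans (log_mean_le (rho0 x) (rho0 y)) _.
  by apply: lerD; exact: (density_le mc).
have := kinetic_ge0 mc rho (fun x => e * (x == z)%:R); lra.
Qed.

Let K_ge0 : 0 <= K.
Proof.
apply: sumr_ge0 => x _; apply: sumr_ge0 => y _.
by rewrite !mulr_ge0 ?addr_ge0 ?invr_ge0 ?(stat_ge0 mc) ?(rate_ge0 mc).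
Qed.

(** Duality against the indicator of [x], with weight [l = r]. The upper bound is the useful side:
    it keeps the edge weights along a short curve from growing. *)
Lemma flow_stays_close (rho psi : R -> X -> R) (r u : R) x : 0 < r -> 0 <= u <= 1 ->
  flow Q pi 0 1 rho psi -> (flow_action Q pi 0 1 rho psi <= (r ^+ 2)%:E)%E ->
  rho u x * pi x - rho 0 x * pi x <= r * (K + 1).
Proof.
move=> r0 /andP[u0 u1] fl le.
have flu : flow Q pi 0 u rho psi by apply: flow_sub fl.
have leu : (flow_action Q pi 0 u rho psi <= (r ^+ 2)%:E)%E.
  apply: le_trans le; rewrite (@flow_action_split _ _ _ _ mc 0 u 1) ?u0 //.
  by apply: leeDl; exact: flow_action_ge0.
have := flow_duality (phi := fun y => 1 * (y == x)%:R) mc u0 r0 flu leu.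
move=> /(_ K) h.
have {}h : \sum_y 1 * (y == x)%:R * (rho u y - rho 0 y) * pi y <=
   r / 2 * (K * (u - 0)) + (2 * r)^-1 * r ^+ 2.
  apply: h => t /andP[t0 tu]; apply: kinetic_indicator; last by rewrite expr1n.
  by case: flu => d _ _ _; apply: d; rewrite t0.
move: h; rewrite (bigD1 x) //= big1 ?addr0; last first.
  by move=> y yx; rewrite (negbTE yx) mulr0 !mul0r.
rewrite eqxx !mul1r mulrBl => /le_trans; apply.
have -> : (2 * r)^-1 * r ^+ 2 = r / 2 by field; rewrite gt_eqF.
have : r * (K * u) <= r * K by rewrite ler_wpM2l ?(ltW r0) // ler_piMr.
have := mulr_ge0 (ltW r0) K_ge0; lra.
Qed.

Variable D2 : R.
Hypothesis diam : forall mu nu, density pi mu -> density pi nu -> reach Q pi mu nu D2.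
Local Notation W := (dist Q pi).

(** The first variation of the entropy in integrated form: [flow_duality] with [phi = - ln mu] along
    a nearly optimal curve. The curve is so short that its density stays below [(1 + eps) mu], so by
    monotonicity of the logarithmic mean the energy of [ln mu] grows at most by this factor. *)
Lemma log_slope_le mu nu (r m eps : R) : density pi mu -> density pi nu ->
  (forall x, 0 < mu x) -> 0 < r -> 0 < m -> 0 < eps -> W mu nu < r ->
  (forall x, r * (K + 1) <= eps * (mu x * pi x)) ->
  \sum_x ln (mu x) * (mu x - nu x) * pi x <=
    m / 2 * ((1 + eps) * fisher mu) + (2 * m)^-1 * r ^+ 2.
Proof.
move=> dmu dnu mup r0 m0 eps0 Wr rK.
have [|rho [psi [/admissible_flow[fl rho0 rho1] le]]] :=
    @dist_reach R X Q pi mc D2 diam mu nu (r ^+ 2) dmu dnu.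
  by rewrite ltr_sqr ?nnegrE ?dist_ge0 // ltW.
have := flow_duality (phi := fun x => - ln (mu x)) mc ler01 m0 fl le.
move=> /(_ ((1 + eps) * fisher mu)) h.
have -> : \sum_x ln (mu x) * (mu x - nu x) * pi x =
    \sum_x - ln (mu x) * (rho 1 x - rho 0 x) * pi x.
  by rewrite rho0 rho1; apply: eq_bigr => x _; ring.
rewrite subr0 mulr1 in h; apply: h => t t01.
rewrite /fisher mulrCA ler_wpM2l ?invr_ge0 //.
have -> : kinetic Q pi mu (fun x => ln (mu x)) = kinetic Q pi mu (fun x => - ln (mu x)).
  by apply: eq_bigr => x _; apply: eq_bigr => y _; rewrite -opprD sqrrN.
have dt : density pi (rho t) by case: fl => d _ _ _; exact: d.
apply: kinetic_le => //; first by lra.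
- by case: dt.
- by case: dmu.
move=> x; rewrite -(ler_pM2r (stat_gt0 mc x)).
have := @flow_stays_close rho psi r t x r0 t01 fl le; rewrite rho0.
have := rK x; lra.
Qed.

Lemma hwi mu (m : R) : ricci_ge Q pi 0 -> density pi mu -> (forall x, 0 < mu x) -> 0 < m ->
  entropy pi mu <= m / 2 * fisher mu + (2 * m)^-1 * W mu (fun=> 1) ^+ 2.
Proof.
move=> ric dmu mup m0.
set w := W mu _; have w0 : 0 <= w by exact: dist_ge0.
have [g geo [g0 g1]] := geodesic_exists mc diam dmu density1.
(* Curvature bounds the entropy at time [s] above by [(1 - s)] times that of [mu], and the tangent
   at [mu] bounds it below; comparing them avoids differentiating along the geodesic. *)
have slope s : 0 < s <= 1 ->
    s * entropy pi mu <= \sum_x ln (mu x) * (mu x - g s x) * pi x.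
  move=> /andP[s0 s1]; have s01 : 0 <= s <= 1 by rewrite ltW.
  have := ric g geo s s01; rewrite g0 g1 entropy1 mul0r !mul0r mul0e sube0 lee_fin.
  rewrite mulr0 addr0 => h1.
  have dgs : density pi (g s) by case: geo => d _; exact: d.
  have := entropy_tangent_sum dmu dgs mup.
  have -> : \sum_x ln (mu x) * (g s x - mu x) * pi x =
     - \sum_x ln (mu x) * (mu x - g s x) * pi x.
    by rewrite -sumrN; apply: eq_bigr => x _; ring.
  lra.
have [kap kap0 hkap] : exists2 kap, 0 < kap & forall x, kap <= mu x * pi x.
  pose S := \sum_x (mu x * pi x)^-1.
  have t0 x : 0 < (mu x * pi x)^-1 by rewrite invr_gt0 mulr_gt0 // (stat_gt0 mc).
  have Sx x : (mu x * pi x)^-1 <= S.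
    by rewrite /S (bigD1 x) //= lerDl sumr_ge0 // => y _; exact: ltW.
  exists (1 + S)^-1.
    by rewrite invr_gt0 ltr_wpDr // sumr_ge0 // => x _; exact: ltW.
  move=> x; rewrite -[leRHS]invrK lef_pV2 ?posrE //; first by have := Sx x; lra.
  by have := Sx x; have := t0 x; lra.
have approx eps : 0 < eps ->
    entropy pi mu <= m / 2 * ((1 + eps) * fisher mu) + (2 * m)^-1 * (w + eps) ^+ 2.
  move=> eps0; pose k := (w + eps) * (K + 1).
  have k0 : 0 < k by rewrite mulr_gt0 //; have := K_ge0; lra.
  (* Small enough that a curve of action [r ^+ 2] raises no site by more than a fraction [eps]. *)
  pose s := Num.min 1 (eps * kap / k).
  have s0 : 0 < s by rewrite lt_min ltr01 divr_gt0 // mulr_gt0.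
  have s1 : s <= 1 by rewrite ge_min lexx.
  have sk : s * k <= eps * kap by rewrite -ler_pdivlMr // ge_min lexx orbT.
  have s01 : 0 <= s <= 1 by rewrite (ltW s0).
  have dgs : density pi (g s) by case: geo => d _; exact: d.
  have Ws : W mu (g s) = s * w.
    have [_ sp] := geo; have := sp 0 s; rewrite lexx ler01 s01 => /(_ isT isT).
    rewrite g0 g1 !(distE mc diam) //; last exact: density1.
    by rewrite sub0r normrN gtr0_norm // -EFinM => -[].
  (* Slightly more than [W mu (g s) = s * w]. With the Young weight [s * m] every term becomes
     proportional to [s], which then divides out. *)
  pose r := s * (w + eps).
  have r0 : 0 < r by rewrite mulr_gt0 //; lra.
  have sm0 : 0 < s * m by rewrite mulr_gt0.
  have h := @log_slope_le mu (g s) r (s * m) eps dmu dgs mup.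
  have rk : r * (K + 1) = s * k by rewrite /r /k mulrA.
  have {}h := h r0 sm0 eps0.
  have {}h : \sum_x ln (mu x) * (mu x - g s x) * pi x <=
      s * m / 2 * ((1 + eps) * fisher mu) + (2 * (s * m))^-1 * r ^+ 2.
    apply: h => [|x]; first by rewrite Ws /r ltr_pM2l // ltrDl.
    by rewrite rk; apply: le_trans sk _; rewrite ler_wpM2l ?(ltW eps0) // hkap.
  rewrite -(ler_pM2l s0).
  have /le_trans : s * entropy pi mu <= \sum_x ln (mu x) * (mu x - g s x) * pi x.
    by apply: slope; rewrite s0.
  apply; apply: (le_trans h); rewrite le_eqVlt; apply/orP; left; apply/eqP.
  by rewrite /r; field; rewrite !gt_eqF.
(* The coefficient of [eps] in the error of [approx], once [eps ^+ 2] is replaced by [eps]. *)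
pose C := m / 2 * fisher mu + (2 * m)^-1 * (2 * w + 1).
have m2 : 0 <= (2 * m)^-1 by rewrite invr_ge0 mulr_ge0 // ltW.
have C0 : 0 <= C.
  apply: addr_ge0; apply: mulr_ge0 => //; [by rewrite divr_ge0 // ltW|exact: fisher_ge0|lra].
apply/ler_addgt0Pr => e e0.
pose eps := Num.min 1 (e / (C + 1)).
have C1 : 0 < C + 1 by rewrite ltr_wpDl.
have eps0 : 0 < eps by rewrite lt_min ltr01 divr_gt0.
have eps1 : eps <= 1 by rewrite ge_min lexx.
have epsC : eps * (C + 1) <= e by rewrite -ler_pdivlMr // ge_min lexx orbT.
apply: le_trans (approx eps eps0) _.
have -> : m / 2 * ((1 + eps) * fisher mu) + (2 * m)^-1 * (w + eps) ^+ 2 =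
    m / 2 * fisher mu + (2 * m)^-1 * w ^+ 2 +
    (eps * C - (2 * m)^-1 * (eps * (1 - eps))).
  rewrite /C; ring.
have : 0 <= (2 * m)^-1 * (eps * (1 - eps)).
  by rewrite !mulr_ge0 ?subr_ge0 // ltW.
lra.
Qed.

Lemma dist_mixture (nu0 : X -> R) (p : X -> R) (nu : X -> X -> R) :
  (forall x, 0 <= p x) -> \sum_x p x = 1 -> (forall x, density pi (nu x)) ->
  density pi nu0 -> W (mixture p nu) nu0 ^+ 2 <= \sum_x p x * W (nu x) nu0 ^+ 2.
Proof.
move=> p0 p1 dnu dnu0; apply/ler_addgt0Pr => e e0.
have h x : reach Q pi (nu x) ((fun=> nu0) x) (W (nu x) nu0 ^+ 2 + e).
  by apply: (dist_reach mc diam) => //; rewrite ltrDl.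
have := dist_le mc diam (reach_mixture mc p0 p1 h).
have -> : mixture p (fun=> nu0) = nu0.
  by apply/funext => x; rewrite /mixture -mulr_suml p1 mul1r.
under [X in _ <= X]eq_bigr do rewrite mulrDr.
by rewrite big_split /= -mulr_suml p1 mul1r.
Qed.

Lemma density_delta x : density pi (delta_density pi x).
Proof.
split=> [y|]; first by rewrite divr_ge0 ?ler0n // (stat_ge0 mc).
rewrite (bigD1 x) //= big1 ?addr0 => [|y yx].
  by rewrite /delta_density eqxx mul1r mulVf // (stat_neq0 mc).
by rewrite /delta_density (negbTE yx) !mul0r.
Qed.

Lemma mixture_delta mu : mixture (fun x => mu x * pi x) (delta_density pi) = mu.
Proof.
apply/funext => y; rewrite /mixture (bigD1 y) //= big1 ?addr0 => [|x xy].
  by rewrite /delta_density eqxx mul1r mulfK // (stat_neq0 mc).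
by rewrite /delta_density eq_sym (negbTE xy) mul0r mulr0.
Qed.

Lemma gaussian_transport mu (x0 : X) (al D : R) : 0 < al -> density pi mu ->
  \sum_x expR (al * W (delta_density pi x) (delta_density pi x0) ^+ 2) * pi x <= D ->
  al * W mu (delta_density pi x0) ^+ 2 <= entropy pi mu + ln D.
Proof.
move=> al0 dmu hD; set d := fun x => W (delta_density pi x) (delta_density pi x0) in hD *.
have [mu0 mu1] := dmu.
have D0 : 0 < D.
  apply: lt_le_trans hD; rewrite (bigD1 x0) //= ltr_wpDr //.
    by apply: sumr_ge0 => x _; rewrite mulr_ge0 ?expR_ge0 ?(stat_ge0 mc).
  by rewrite mulr_gt0 ?expR_gt0 ?(stat_gt0 mc).
have hW : W mu (delta_density pi x0) ^+ 2 <= \sum_x (mu x * pi x) * d x ^+ 2.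
  rewrite -{1}(mixture_delta mu); apply: dist_mixture => //; try exact: density_delta.
    by move=> x; rewrite mulr_ge0 // (stat_ge0 mc).
(* Tangent at the reference density [expR (al * d x ^+ 2) / D]. Its mass is at most 1, as [D] only
   bounds the moment, and the missing mass has the favourable sign. *)
have key x : mu x * (al * d x ^+ 2 - ln D) + (mu x - expR (al * d x ^+ 2) / D) <= mu x * ln (mu x).
  have e0 : 0 < expR (al * d x ^+ 2) / D by rewrite divr_gt0 ?expR_gt0.
  have := entropy_tangent (mu0 x) e0.
  by rewrite ln_div ?posrE ?expR_gt0 // expRK.
have : \sum_x pi x * (mu x * (al * d x ^+ 2 - ln D) + (mu x - expR (al * d x ^+ 2) / D)) <=
    entropy pi mu.
  by apply: ler_sum => x _; rewrite ler_wpM2l ?(stat_ge0 mc).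
have -> : \sum_x pi x * (mu x * (al * d x ^+ 2 - ln D) + (mu x - expR (al * d x ^+ 2) / D)) =
    al * (\sum_x (mu x * pi x) * d x ^+ 2) - ln D * (\sum_x mu x * pi x) +
    (\sum_x mu x * pi x - (\sum_x expR (al * d x ^+ 2) * pi x) / D).
  rewrite !mulr_sumr mulr_suml -!sumrB -big_split /=; apply: eq_bigr => x _; ring.
rewrite mu1 mulr1.
have : (\sum_x expR (al * d x ^+ 2) * pi x) / D <= 1 by rewrite ler_pdivrMr // mul1r.
have := ler_wpM2l (ltW al0) hW; lra.
Qed.

(** The triangle inequality passes through the point mass at [x0]; the constant density, of entropy
    0, obeys the previous bound as well. *)
Lemma gaussian_transport_equilibrium mu (x0 : X) (al D : R) : 0 < al -> density pi mu ->
  \sum_x expR (al * W (delta_density pi x) (delta_density pi x0) ^+ 2) * pi x <= D ->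
  al * W mu (fun=> 1) ^+ 2 <= 2 * entropy pi mu + 4 * ln D.
Proof.
move=> al0 dmu hD.
have h1 := gaussian_transport al0 dmu hD.
have := gaussian_transport al0 density1 hD; rewrite entropy1 add0r => h2.
set a := W mu (delta_density pi x0) in h1 *.
set b := W (fun=> 1) (delta_density pi x0) in h2 *.
have le : W mu (fun=> 1) <= a + b.
  rewrite /b (distC mc diam density1 (density_delta x0)).
  exact: (dist_triangle mc diam dmu (density_delta x0) density1).
have le2 : W mu (fun=> 1) ^+ 2 <= (a + b) ^+ 2.
  by rewrite ler_sqr ?nnegrE ?addr_ge0 ?dist_ge0.
have le3 : (a + b) ^+ 2 <= 2 * a ^+ 2 + 2 * b ^+ 2.
  by have := sqr_ge0 (a - b); lra.
have := ler_wpM2l (ltW al0) (le_trans le2 le3); lra.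
Qed.

End hwi.

(** * Finiteness of all distances from the Gaussian moment *)

Section finite_moment.
Context (R : realType) (X : finType) (Q : X -> X -> R) (pi : X -> R).
Hypothesis mc : markov_chain Q pi.
Variables (al : R) (x0 : X).
Hypothesis (al0 : 0 < al) (moment : (gauss_moment Q pi al x0 < +oo)%E).

Let point_finite x : (point_dist Q pi x x0 < +oo)%E.
Proof.
rewrite ltey; apply/negP => /eqP h; move: moment; rewrite /gauss_moment.
rewrite (bigD1 x) //= h.
have -> : (expeR (al%:E * (+oo ^+ 2)) * (pi x)%:E = +oo)%E.
  by rewrite expe2 mulyy gt0_muley ?lte_fin //= gt0_mulye // lte_fin (stat_gt0 mc).
have s0 : (0 <= \sum_(y | y != x) expeR (al%:E * point_dist Q pi y x0 ^+ 2) * (pi y)%:E)%E.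
  apply: sume_ge0 => y _; apply: mule_ge0; first exact: expeR_ge0.
  by rewrite lee_fin (stat_ge0 mc).
by rewrite addye // gt_eqF // (lt_le_trans _ s0) // ltNyr.
Qed.

(** Every density is a mixture of point masses, so curves from the point masses to the one at [x0]
    mix into a curve from any density; two densities are then joined through [x0], in equal
    times. *)
Lemma finite_diameter : exists D2, forall mu nu, density pi mu -> density pi nu ->
  reach Q pi mu nu D2.
Proof.
have /choice[c hc] : forall x, exists c, reach Q pi (delta_density pi x) (delta_density pi x0) c.
  by move=> x; exact: (transport_dist_lty mc (point_finite x)).
pose C := \sum_x c x.
have hC x : reach Q pi (delta_density pi x) ((fun=> delta_density pi x0) x) C.
  apply: reach_le (hc x); rewrite /C (bigD1 x) //= lerDl sumr_ge0 // => y _.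
  exact: (reach_ge0 mc (hc y)).
have to0 mu : density pi mu -> reach Q pi mu (delta_density pi x0) C.
  move=> [mu0 mu1].
  have p0 x : 0 <= mu x * pi x by rewrite mulr_ge0 // (stat_ge0 mc).
  have := reach_mixture mc p0 mu1 hC.
  rewrite (mixture_delta mc) -mulr_suml mu1 mul1r; congr reach.
  by apply/funext => x; rewrite /mixture -mulr_suml mu1 mul1r.
exists (C / 2^-1 + C / (1 - 2^-1)) => mu nu dmu dnu.
apply: (reach_trans mc _ (to0 mu dmu) (reach_sym mc (to0 nu dnu))).
by apply/andP; split; lra.
Qed.

Lemma fine_gauss_moment D2 :
  (forall mu nu, density pi mu -> density pi nu -> reach Q pi mu nu D2) ->
  fine (gauss_moment Q pi al x0) =
  \sum_x expR (al * dist Q pi (delta_density pi x) (delta_density pi x0) ^+ 2) * pi x.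
Proof.
move=> diam; rewrite /gauss_moment /point_dist.
under eq_bigr => x _ do rewrite (distE mc diam (density_delta mc x) (density_delta mc x0)).
by rewrite /= sumEFin.
Qed.

End finite_moment.

(** * Cheeger's inequality for reversible kernels *)

Section cheeger.
Context (R : realType) (X : finType).
Variables (p : X -> R) (K : X -> X -> R) (delta : R).
Hypotheses (p0 : forall x, 0 <= p x) (p1 : \sum_x p x = 1).
Hypotheses (K0 : forall x y, 0 <= K x y) (KC : forall x y, K x y = K y x).
Hypothesis (Kp : forall x, \sum_y K x y = p x).
Hypothesis (delta0 : 0 < delta).
Hypothesis escape : forall S : {set X}, \sum_(x in S) p x <= 2^-1 ->
  delta * \sum_(x in S) p x <= \sum_(x in S) \sum_(y in ~: S) K x y.

Let pos (a : R) : R := Num.max 0 a.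

(** The layer-cake formula by induction on the size of the support [S]: lowering [g] on [S] by its
    smallest value there, [g z], shrinks the support and removes [g z] times the escape inequality
    for [S]. *)
Lemma coarea (g : X -> R) : (forall x, 0 <= g x) ->
  \sum_(x | 0 < g x) p x <= 2^-1 ->
  delta * \sum_x g x * p x <= \sum_x \sum_y pos (g x - g y) * K x y.
Proof.
have [n] := ubnP #|[set x | 0 < g x]%SET|; elim: n g => // n IH g; rewrite ltnS => cardg g0 supp.
have [S0|[x0 x0S]] := set_0Vmem [set x | 0 < g x]%SET.
  rewrite big1 ?mulr0 => [|x _].
    by apply: sumr_ge0 => x _; apply: sumr_ge0 => y _; rewrite mulr_ge0 // le_max lexx.
  have : x \notin [set x | 0 < g x]%SET by rewrite S0 inE.
  rewrite inE -leNgt => gx; have -> : g x = 0 by apply/eqP; rewrite eq_le gx g0.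
  by rewrite mul0r.
set S := [set x | 0 < g x]%SET in cardg x0S.
have SE x : (x \in S) = (0 < g x) by rewrite /S inE.
have [z zS0 zmin0] := arg_minP g x0S.
have zS : z \in S by exact: zS0.
have zmin y : y \in S -> g z <= g y by exact: zmin0.
have gz : 0 < g z by rewrite -SE.
pose g' x := if x \in S then g x - g z else 0.
have gout x : x \notin S -> g x = 0.
  by rewrite SE -leNgt => gx; apply/eqP; rewrite eq_le gx g0.
have g'0 x : 0 <= g' x.
  by rewrite /g'; case: ifP => // xS; rewrite subr_ge0 zmin.
have sub : [set x | 0 < g' x]%SET \proper S.
  apply/fintype.properP; split; last by exists z => //; rewrite inE /g' zS subrr ltxx.
  by apply/fintype.subsetP => x; rewrite inE /g'; case: ifP => //; rewrite ltxx.
have supp' : \sum_(x | 0 < g' x) p x <= 2^-1.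
  apply: le_trans supp; rewrite !(big_mkcond (fun x => 0 < _)); apply: ler_sum => x _.
  case: ifP => h; case: ifP => h' //.
  have : x \in [set x | 0 < g' x]%SET by rewrite inE.
  by move/(fintype.subsetP (proper_sub sub)); rewrite SE h'.
have := IH g' (leq_trans (proper_card sub) cardg) g'0 supp'.
have e1 : \sum_x g x * p x = \sum_x g' x * p x + g z * \sum_(x in S) p x.
  rewrite mulr_sumr (big_mkcond (fun x => x \in S)) -big_split /=; apply: eq_bigr => x _.
  by rewrite /g'; case: ifPn => xS; [ring | rewrite gout // !mul0r addr0].
have e2 : \sum_x \sum_y pos (g x - g y) * K x y =
    \sum_x \sum_y pos (g' x - g' y) * K x y + g z * \sum_(x in S) \sum_(y in ~: S) K x y.
  rewrite mulr_sumr (big_mkcond (fun x => x \in S)) -big_split /=; apply: eq_bigr => x _.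
  case: ifPn => xS.
    rewrite mulr_sumr (big_mkcond (fun x => x \in ~: S)) -big_split /=; apply: eq_bigr => y _.
    rewrite inE /g' xS; case: ifPn => yS /=.
      by rewrite addr0; congr (pos _ * _); ring.
    rewrite (gout y) // !subr0 /pos !max_r ?subr_ge0 ?zmin // ?g0 //; ring.
  rewrite addr0; apply: eq_bigr => y _; rewrite /g' (negbTE xS) gout //.
  by case: ifPn => yS; rewrite /pos ?(gout y yS) // !max_l ?oppr_le0 ?sub0r ?oppr_le0 ?subr_ge0 ?zmin ?g0.
rewrite e1 e2 mulrDr => h; apply: lerD => //.
rewrite mulrCA ler_wpM2l ?(ltW gz) // escape //.
by move: supp; rewrite (eq_bigl (fun x => x \in S)) // => x; rewrite SE.
Qed.

Definition kernel_form (f : X -> R) : R := 2^-1 * \sum_x \sum_y (f x - f y) ^+ 2 * K x y.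

Let sumK (f : X -> R) : \sum_x \sum_y f x * K x y = \sum_x f x * p x.
Proof. by apply: eq_bigr => x _; rewrite -mulr_sumr Kp. Qed.

Let sumK' (f : X -> R) : \sum_x \sum_y f y * K x y = \sum_x f x * p x.
Proof.
by rewrite exchange_big /= -sumK; apply: eq_bigr => x _; apply: eq_bigr => y _; rewrite KC.
Qed.

Lemma kernel_form_sqr f : kernel_form f =
  \sum_x f x ^+ 2 * p x - \sum_x \sum_y f x * f y * K x y.
Proof.
have -> : \sum_x f x ^+ 2 * p x = 2^-1 * (\sum_x f x ^+ 2 * p x + \sum_x f x ^+ 2 * p x) by lra.
rewrite -{1}(sumK (fun x => f x ^+ 2)) -(sumK' (fun x => f x ^+ 2)) -big_split /=.
rewrite /kernel_form !mulr_sumr -sumrB; apply: eq_bigr => x _.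
rewrite -big_split !mulr_sumr -sumrB; apply: eq_bigr => y _ /=; lra.
Qed.

Lemma cheeger_nonneg (f : X -> R) : (forall x, 0 <= f x) ->
  \sum_(x | 0 < f x) p x <= 2^-1 ->
  \sum_x f x ^+ 2 * p x <= 2 / delta ^+ 2 * kernel_form f.
Proof.
move=> f0 supp.
have supp2 : \sum_(x | 0 < f x ^+ 2) p x <= 2^-1.
  rewrite (eq_bigl (fun x => 0 < f x)) // => x.
  by rewrite !lt_neqAle !f0 sqr_ge0 !andbT eq_sym sqrf_eq0 eq_sym.
have := coarea (fun x => sqr_ge0 (f x)) supp2.
set N := \sum_x f x ^+ 2 * p x.
have e1 : \sum_x \sum_y pos (f x ^+ 2 - f y ^+ 2) * K x y =
    2^-1 * \sum_x \sum_y `|f x ^+ 2 - f y ^+ 2| * K x y.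
  have e : \sum_x \sum_y pos (f x ^+ 2 - f y ^+ 2) * K x y =
      \sum_x \sum_y pos (f y ^+ 2 - f x ^+ 2) * K x y.
    rewrite exchange_big /=; apply: eq_bigr => x _; apply: eq_bigr => y _; by rewrite KC.
  have -> : \sum_x \sum_y `|f x ^+ 2 - f y ^+ 2| * K x y =
    \sum_x \sum_y pos (f x ^+ 2 - f y ^+ 2) * K x y + \sum_x \sum_y pos (f y ^+ 2 - f x ^+ 2) * K x y.
    rewrite -big_split; apply: eq_bigr => x _; rewrite -big_split; apply: eq_bigr => y _ /=.
    rewrite -mulrDl; congr (_ * _); rewrite /pos -[f y ^+ 2 - f x ^+ 2]opprB.
    case: (leP 0 (f x ^+ 2 - f y ^+ 2)) => h.
      by rewrite ger0_norm // max_l ?oppr_le0 // addr0.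
    by rewrite ltr0_norm // add0r max_r // oppr_ge0 ltW.
  rewrite -e; lra.
have e2 : \sum_x \sum_y `|f x ^+ 2 - f y ^+ 2| * K x y <=
    2 / delta * kernel_form f + delta * N.
  (* Young's inequality takes the place of Cauchy-Schwarz. The extra squared differences complete
     those of [f x + f y] to [2 (f x^2 + f y^2)], whose sum is [4 N]; half of the resulting
     [delta * N] is then absorbed by the left side of [coarea]. *)
  have -> : 2 / delta * kernel_form f + delta * N =
     \sum_x \sum_y (delta^-1 * (f x - f y) ^+ 2 + delta / 4 * (f x + f y) ^+ 2) * K x y
     + delta / 4 * \sum_x \sum_y (f x - f y) ^+ 2 * K x y.
    have -> : delta * N = delta / 2 * (\sum_x \sum_y f x ^+ 2 * K x y + \sum_x \sum_y f y ^+ 2 * K x y).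
      by rewrite (sumK (fun x => f x ^+ 2)) (sumK' (fun x => f x ^+ 2)) -/N; field.
    rewrite /kernel_form -big_split /= !mulr_sumr -!big_split; apply: eq_bigr => x _ /=.
    rewrite -!big_split !mulr_sumr -!big_split; apply: eq_bigr => y _ /=.
    by field; rewrite gt_eqF.
  apply: (@le_trans _ _ (\sum_x \sum_y (delta^-1 * (f x - f y) ^+ 2 + delta / 4 * (f x + f y) ^+ 2) * K x y)).
    apply: ler_sum => x _; apply: ler_sum => y _; rewrite ler_wpM2r //.
    rewrite subr_sqr normrM (ger0_norm (addr_ge0 (f0 x) (f0 y))).
    rewrite -[(f x - f y) ^+ 2]real_normK ?num_real //.
    move: `|f x - f y| (f x + f y) => u v; rewrite -(ler_pM2l delta0).
    have -> : delta * (delta^-1 * u ^+ 2 + delta / 4 * v ^+ 2) =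
        u ^+ 2 + delta ^+ 2 / 4 * v ^+ 2 by field; rewrite gt_eqF.
    have := sqr_ge0 (u - delta / 2 * v); lra.
  rewrite lerDl mulr_ge0 ?divr_ge0 ?(ltW delta0) //.
  by apply: sumr_ge0 => x _; apply: sumr_ge0 => y _; rewrite mulr_ge0 ?sqr_ge0.
rewrite e1 => h.
have {}h : delta / 2 * N <= delta^-1 * kernel_form f.
  have e3 : 2 / delta * kernel_form f = 2 * (delta^-1 * kernel_form f) by rewrite mulrA.
  rewrite e3 in e2; lra.
have -> : 2 / delta ^+ 2 * kernel_form f = 2 / delta * (delta^-1 * kernel_form f).
  by field; rewrite gt_eqF.
rewrite mulrAC ler_pdivlMr // -ler_pdivrMl //; lra.
Qed.

(** The median is the least value of [f] whose strict upper tail has mass at most 1/2. The next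
    smaller value fails this, so its strict upper tail, disjoint from the lower tail of the median,
    has mass above 1/2. *)
Lemma median_exists (f : X -> R) : exists m,
  \sum_(x | m < f x) p x <= 2^-1 /\ \sum_(x | f x < m) p x <= 2^-1.
Proof.
have [x0 _] : exists x : X, True.
  apply: contrapT => h; have := p1; rewrite big1 => [/eqP|x _]; last by exfalso; apply: h; exists x.
  by rewrite eq_sym oner_eq0.
pose P x := \sum_(z | f x < f z) p z <= 2^-1.
have [xm _ xmax] := @arg_maxP _ R X x0 predT f isT.
have Pm : P xm.
  rewrite /P big_pred0 ?invr_ge0 // => z; apply/negbTE; rewrite -leNgt; exact: xmax.
have [xs Ps xmin] := @arg_minP _ R X xm P f Pm.
exists (f xs); split => //; rewrite leNgt; apply/negP => h.
have [y1 y1s] : exists y, f y < f xs.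
  apply: contrapT => no; have z0 : \sum_(x | f x < f xs) p x = 0.
    by apply: big_pred0 => z; apply/negbTE/negP => hz; apply: no; exists z.
  by move: h; rewrite z0 ltNge invr_ge0 ler0n.
have [y ys ymax] := @arg_maxP _ R X y1 (fun y => f y < f xs) f y1s.
have nPy : 2^-1 < \sum_(z | f y < f z) p z.
  by rewrite ltNge; apply/negP => /xmin; rewrite leNgt ys.
have : \sum_(x | f x < f xs) p x + \sum_(z | f y < f z) p z <= 1.
  rewrite -p1 !(big_mkcond (fun x => _ < _)) -big_split /=; apply: ler_sum => x _.
  case: ifP => h1; case: ifP => h2; rewrite ?addr0 ?add0r //.
  have le : f x <= f y by exact: (ymax x h1).
  by rewrite leNgt h2 in le.
lra.
Qed.

(** The positive and negative parts of [f - m] at a median [m] both have support of mass at most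
    1/2. Their squares add up to that of [f - m], and their forms add up to at most that of [f]. *)
Lemma cheeger (f : X -> R) :
  \sum_x f x ^+ 2 * p x - (\sum_x f x * p x) ^+ 2 <= 2 / delta ^+ 2 * kernel_form f.
Proof.
have [m [h1 h2]] := median_exists f.
pose fp x := pos (f x - m); pose fn x := pos (m - f x).
have fp0 x : 0 <= fp x by rewrite le_max lexx.
have fn0 x : 0 <= fn x by rewrite le_max lexx.
have Hp : \sum_(x | 0 < fp x) p x <= 2^-1.
  by rewrite (eq_bigl (fun x => m < f x)) // => x; rewrite lt_max ltxx subr_gt0.
have Hn : \sum_(x | 0 < fn x) p x <= 2^-1.
  by rewrite (eq_bigl (fun x => f x < m)) // => x; rewrite lt_max ltxx subr_gt0.
have c1 := cheeger_nonneg fp0 Hp; have c2 := cheeger_nonneg fn0 Hn.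
have var : \sum_x f x ^+ 2 * p x - (\sum_x f x * p x) ^+ 2 <= \sum_x (f x - m) ^+ 2 * p x.
  have -> : \sum_x (f x - m) ^+ 2 * p x =
      \sum_x f x ^+ 2 * p x - 2 * m * \sum_x f x * p x + m ^+ 2 * \sum_x p x.
    rewrite !mulr_sumr -sumrB -big_split /=; apply: eq_bigr => x _; ring.
  have := sqr_ge0 (\sum_x f x * p x - m); rewrite p1; lra.
apply: (le_trans var).
have -> : \sum_x (f x - m) ^+ 2 * p x = \sum_x fp x ^+ 2 * p x + \sum_x fn x ^+ 2 * p x.
  rewrite -big_split; apply: eq_bigr => x _ /=; rewrite -mulrDl; congr (_ * _).
  rewrite /fp /fn /pos; case: (leP (f x) m) => h.
    by rewrite max_l ?subr_le0 // max_r ?subr_ge0 // expr0n add0r -sqrrN opprB.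
  by rewrite max_r ?subr_ge0 ?(ltW h) // max_l ?subr_le0 ?(ltW h) // expr0n addr0.
apply: le_trans (lerD c1 c2) _; rewrite -mulrDr ler_wpM2l ?divr_ge0 ?sqr_ge0 //.
rewrite /kernel_form -mulrDr ler_wpM2l ?invr_ge0 // -big_split; apply: ler_sum => x _ /=.
rewrite -big_split; apply: ler_sum => y _ /=; rewrite -mulrDl ler_wpM2r //.
rewrite /fp /fn /pos.
case: (leP (f x) m) => hx; case: (leP (f y) m) => hy.
- rewrite !(max_l (_ : _ - m <= 0)) ?subr_le0 // !max_r ?subr_ge0 //; nra.
- rewrite (max_l (_ : f x - m <= 0)) ?subr_le0 // (max_r (_ : 0 <= f y - m)) ?subr_ge0 ?(ltW hy) //.
  rewrite (max_r (_ : 0 <= m - f x)) ?subr_ge0 // (max_l (_ : m - f y <= 0)) ?subr_le0 ?(ltW hy) //; nra.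
- rewrite (max_l (_ : f y - m <= 0)) ?subr_le0 // (max_r (_ : 0 <= f x - m)) ?subr_ge0 ?(ltW hx) //.
  rewrite (max_r (_ : 0 <= m - f y)) ?subr_ge0 // (max_l (_ : m - f x <= 0)) ?subr_le0 ?(ltW hx) //; nra.
- rewrite !(max_r (_ : 0 <= _ - m)) ?subr_ge0 ?(ltW hx) ?(ltW hy) // !max_l ?subr_le0 ?(ltW hx) ?(ltW hy) //; nra.
Qed.

End cheeger.

(** * The implicit Euler step and the spectral gap *)

Section implicit_euler.
Context (R : realType) (X : finType) (Q : X -> X -> R) (pi : X -> R).
Hypothesis mc : markov_chain Q pi.
Variable h : R.
Hypothesis h0 : 0 < h.

Let w x y : R := h * (Q x y * pi x).

Let w_ge0 x y : 0 <= w x y.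
Proof. by rewrite !mulr_ge0 ?(ltW h0) ?(rate_ge0 mc) ?(stat_ge0 mc). Qed.

Let wC x y : w x y = w y x.
Proof. by rewrite /w; have -> : Q x y * pi x = Q y x * pi y by case: mc. Qed.

(* [heat f] is [(1 - h L)^-1 f], one implicit Euler step of the heat flow. *)
Definition heat (f : X -> R) : X -> R := resolvent pi w (fun x => pi x * f x).

Lemma heatP f x : pi x * heat f x + laplacian w (heat f) x = pi x * f x.
Proof. exact: (resolventP (fun x => pi x * f x) (stat_gt0 mc) w_ge0 wC). Qed.

Lemma heat_unique f u : (forall x, pi x * u x + laplacian w u x = pi x * f x) ->
  forall x, u x = heat f x.
Proof. exact: (resolvent_unique (stat_gt0 mc) w_ge0 wC). Qed.

Lemma heat_ge0 f : (forall x, 0 <= f x) -> forall x, 0 <= heat f x.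
Proof.
move=> f0 x; have [z _ zmin] := @arg_minP _ R X x predT (heat f) isT.
apply: le_trans (zmin x isT); rewrite -(pmulr_rge0 _ (stat_gt0 mc z)).
have -> : pi z * heat f z = pi z * f z - laplacian w (heat f) z by rewrite -(heatP f z) addrK.
rewrite subr_ge0; apply: (@le_trans _ _ 0); last by rewrite mulr_ge0 ?(stat_ge0 mc).
by apply: sumr_le0 => y _; rewrite mulr_ge0_le0 // subr_le0; exact: zmin.
Qed.

(** Strong minimum principle: at a zero of [heat f] also [f] vanishes, and the zero spreads along
    the edges up to [x0] by irreducibility. Logarithms of the new density are then harmless. *)
Lemma heat_gt0 f x0 : (forall x, 0 <= f x) -> 0 < f x0 -> forall x, 0 < heat f x.
Proof.
move=> f0 fx0 x; have u0 := heat_ge0 f0.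
rewrite lt_neqAle u0 andbT eq_sym; apply/eqP => ux.
have step a : heat f a = 0 -> f a = 0 /\ forall b, 0 < Q a b -> heat f b = 0.
  move=> ua; have := heatP f a; rewrite ua mulr0 add0r => e.
  have l0 y : w a y * (heat f a - heat f y) <= 0.
    by rewrite mulr_ge0_le0 // ua subr_le0.
  have fa : f a = 0.
    apply/eqP; rewrite eq_le f0 andbT -(pmulr_rle0 _ (stat_gt0 mc a)) -e.
    by apply: sumr_le0.
  split=> // b Qab.
  move: e; rewrite fa mulr0 => /eqP; rewrite /laplacian.
  rewrite -oppr_eq0 -sumrN psumr_eq0 => [|y _]; last by rewrite oppr_ge0.
  move=> /allP /(_ b (mem_index_enum b)); rewrite oppr_eq0 ua sub0r mulf_eq0 oppr_eq0.
  have wab : 0 < w a b by rewrite mulr_gt0 // mulr_gt0 // (stat_gt0 mc).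
  by rewrite (gt_eqF wab) /= => /eqP.
have conn a b : connect [rel a b | 0 < Q a b] a b -> heat f a = 0 -> heat f b = 0.
  move=> /connectP[s sp ->]; elim: s a sp => //= c s IH a /andP[ac sp] ua.
  by apply: (IH c sp); have [_] := step a ua; apply.
have [_ irr _ _] := mc.
have [fz _] := step x0 (conn x x0 (irr x x0) ux).
by rewrite fz ltxx in fx0.
Qed.

Lemma sum_laplacian u : \sum_x laplacian w u x = 0.
Proof.
have := green (fun=> 1) u wC; under eq_bigr do rewrite mul1r; move=> ->.
by rewrite big1 ?mulr0 // => x _; rewrite big1 // => y _; rewrite subrr mul0r mulr0.
Qed.

Lemma heat_mass f : \sum_x heat f x * pi x = \sum_x f x * pi x.
Proof.
have := sum_laplacian (heat f).
have -> : \sum_x laplacian w (heat f) x = \sum_x f x * pi x - \sum_x heat f x * pi x.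
  by rewrite -sumrB; apply: eq_bigr => x _; have := heatP f x; lra.
lra.
Qed.

Lemma heat_sym f g : \sum_x pi x * g x * heat f x = \sum_x pi x * f x * heat g x.
Proof.
have e f' g' : \sum_x pi x * g' x * heat f' x =
    \sum_x pi x * heat g' x * heat f' x +
    2^-1 * \sum_x \sum_y w x y * ((heat g' x - heat g' y) * (heat f' x - heat f' y)).
  rewrite -(green _ _ wC).
  have -> : \sum_x heat g' x * laplacian w (heat f') x = \sum_x heat f' x * laplacian w (heat g') x.
    rewrite !(green _ _ wC); congr (_ * _); apply: eq_bigr => x _; apply: eq_bigr => y _.
    by rewrite [X in _ * X]mulrC.
  by rewrite -big_split; apply: eq_bigr => x _ /=; rewrite -(heatP g' x); ring.
rewrite (e f g) (e g f).
have -> : \sum_x pi x * heat g x * heat f x = \sum_x pi x * heat f x * heat g x.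
  by apply: eq_bigr => x _; ring.
have -> : \sum_x \sum_y w x y * ((heat g x - heat g y) * (heat f x - heat f y)) =
    \sum_x \sum_y w x y * ((heat f x - heat f y) * (heat g x - heat g y)).
  by apply: eq_bigr => x _; apply: eq_bigr => y _; rewrite [X in _ * X]mulrC.
by [].
Qed.

Lemma density_heat f : density pi f -> density pi (heat f).
Proof. by move=> [f0 f1]; split; [exact: heat_ge0 | rewrite heat_mass]. Qed.

(** The tangent is taken at the new density [mu]: there [rho - mu] is the Laplacian of [mu] over
    [pi], and its pairing with [ln mu] is the Fisher information by [log_mean_ln]. *)
Lemma entropy_dissipation rho : density pi rho -> (forall x, 0 < heat rho x) ->
  entropy pi (heat rho) + h * fisher Q pi (heat rho) <= entropy pi rho.
Proof.
move=> drho mup; set mu := heat rho in mup *.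
have := entropy_tangent_sum mc (density_heat drho) drho mup; rewrite -/mu.
have -> : \sum_x ln (mu x) * (rho x - mu x) * pi x = h * fisher Q pi mu.
  transitivity (\sum_x ln (mu x) * laplacian w mu x).
    by apply: eq_bigr => x _; have := heatP rho x; rewrite -/mu => e; rewrite -mulrA; congr (_ * _); lra.
  rewrite (green _ _ wC) /fisher mulrCA; congr (_ * _).
  rewrite kineticE mulr_sumr; apply: eq_bigr => x _; rewrite mulr_sumr; apply: eq_bigr => y _.
  rewrite /edge_weight /w -(log_mean_ln (mup x) (mup y)) /hat; ring.
by [].
Qed.

(** With the weight [pi x] this is the joint law of two successive states in equilibrium, hence
    symmetric with marginal [pi]. *)
Definition heat_kernel (x y : X) : R := pi x * heat (fun z => (z == y)%:R) x.

(** Superposition: the combination of the solutions for point sources solves the equation for [f],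
    whose solution is unique. *)
Lemma heat_kernelE f x : \sum_y heat_kernel x y * f y = pi x * heat f x.
Proof.
have <- : \sum_y heat (fun z => (z == y)%:R) x * f y = heat f x.
  apply: (heat_unique (u := fun x => \sum_y heat (fun z => (z == y)%:R) x * f y)) => {}x.
  have -> : laplacian w (fun x => \sum_y heat (fun z => (z == y)%:R) x * f y) x =
      \sum_y laplacian w (heat (fun z => (z == y)%:R)) x * f y.
    rewrite /laplacian; under eq_bigr do rewrite -sumrB mulr_sumr.
    rewrite exchange_big /=; apply: eq_bigr => y _; rewrite mulr_suml.
    by apply: eq_bigr => z _; ring.
  rewrite mulr_sumr -big_split /=.
  transitivity (\sum_y pi x * ((x == y)%:R * f y)).
    apply: eq_bigr => y _; have := heatP (fun z => (z == y)%:R) x => /= e.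
    by rewrite [RHS]mulrA -e; ring.
  rewrite (bigD1 x) //= big1 ?addr0 => [|y yx]; first by rewrite eqxx mul1r.
  by rewrite eq_sym (negbTE yx) mul0r mulr0.
by rewrite mulr_sumr; apply: eq_bigr => y _; rewrite mulrA.
Qed.

Lemma heat_kernel_ge0 x y : 0 <= heat_kernel x y.
Proof. by rewrite mulr_ge0 ?(stat_ge0 mc) // heat_ge0 // => z; rewrite ler0n. Qed.

Lemma heat_kernelC x y : heat_kernel x y = heat_kernel y x.
Proof.
have e a b : heat_kernel a b = \sum_z pi z * (z == a)%:R * heat (fun u => (u == b)%:R) z.
  rewrite (bigD1 a) //= big1 ?addr0 => [|z za]; first by rewrite eqxx mulr1.
  by rewrite (negbTE za) mulr0 mul0r.
by rewrite !e heat_sym.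
Qed.

Lemma heat_kernel_mass x : \sum_y heat_kernel x y = pi x.
Proof.
have -> : \sum_y heat_kernel x y = \sum_y heat_kernel x y * 1 by apply: eq_bigr => y _; rewrite mulr1.
rewrite (heat_kernelE (fun=> 1)) -(heat_unique (u := fun=> 1)) ?mulr1 // => y.
by rewrite /laplacian big1 ?addr0 // => z _; rewrite subrr mulr0.
Qed.

(** With A = - h L and J = (1 + A)^-1 this is 1 - J = A J <= A. Writing [f = heat f + v] with v = A
    J f, the difference of the two forms is the squared norm of [v] plus its energy. *)
Lemma kernel_form_dirichlet f : kernel_form heat_kernel f <= h * dirichlet Q pi f.
Proof.
have -> : kernel_form heat_kernel f = \sum_x f x * laplacian w (heat f) x.
  rewrite (kernel_form_sqr (p := pi) heat_kernelC heat_kernel_mass) -sumrB; apply: eq_bigr => x _.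
  have -> : \sum_y f x * f y * heat_kernel x y = f x * (pi x * heat f x).
    by rewrite -heat_kernelE mulr_sumr; apply: eq_bigr => y _; ring.
  by have := heatP f x => e; rewrite expr2 -mulrA -mulrBr; congr (_ * _); lra.
have -> : h * dirichlet Q pi f = \sum_x f x * laplacian w f x.
  rewrite (green _ _ wC) /dirichlet mulrCA; congr (_ * _).
  rewrite mulr_sumr; apply: eq_bigr => x _; rewrite mulr_sumr; apply: eq_bigr => y _.
  by rewrite /w; ring.
pose v x := laplacian w (heat f) x / pi x.
have fE x : f x = heat f x + v x.
  have := heatP f x => e; apply: (mulfI (stat_neq0 mc x)).
  by rewrite -e mulrDr /v [pi x * (_ / _)]mulrC divfK // (stat_neq0 mc).
have fE' : f = fun x => heat f x + v x by apply/funext.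
have -> : \sum_x f x * laplacian w f x =
    \sum_x f x * laplacian w (heat f) x + \sum_x f x * laplacian w v x.
  rewrite -big_split; apply: eq_bigr => x _ /=; rewrite -mulrDr; congr (_ * _).
  by rewrite {1}fE' laplacianD.
rewrite lerDl.
have -> : \sum_x f x * laplacian w v x =
    \sum_x v x * laplacian w (heat f) x + \sum_x v x * laplacian w v x.
  have -> : \sum_x v x * laplacian w (heat f) x = \sum_x heat f x * laplacian w v x.
    rewrite !(green _ _ wC); congr (_ * _); apply: eq_bigr => x _; apply: eq_bigr => y _.
    by rewrite [X in _ * X]mulrC.
  by rewrite -big_split; apply: eq_bigr => x _ /=; rewrite -mulrDl -fE.
rewrite addr_ge0 ?laplacian_energy_ge0 //; apply: sumr_ge0 => x _.
by rewrite /v mulrAC -expr2 divr_ge0 ?sqr_ge0 ?(stat_ge0 mc).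
Qed.

End implicit_euler.

(* This is [8 m], where [m] is such that the HWI inequality with parameter [m]
   yields [H <= m I] whenever [H >= ln 2 / 8]. *)
Definition mixing_step (R : realType) (alpha D : R) : R :=
  16 * (1 + 16 * ln D / ln 2) / alpha.

Lemma ln2_gt0 (R : realType) : 0 < ln 2 :> R.
Proof. by apply: ln_gt0; rewrite ltr1n. Qed.

Lemma mixing_step_gt0 (R : realType) (alpha D : R) : 0 < alpha -> 1 <= D ->
  0 < mixing_step alpha D.
Proof.
move=> al0 D1; rewrite divr_gt0 // mulr_gt0 // ltr_pwDl //.
by apply: divr_ge0; [rewrite mulr_ge0 // ln_ge0 | exact: (ltW (ln2_gt0 R))].
Qed.

(** * From the HWI inequality to the Poincare inequality *)

Section mixing.
Context (R : realType) (X : finType) (Q : X -> X -> R) (pi : X -> R).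
Hypotheses (mc : markov_chain Q pi) (ric : ricci_ge Q pi 0).
Variables (alpha : R) (x0 : X).
Hypothesis (alpha0 : 0 < alpha) (moment : (gauss_moment Q pi alpha x0 < +oo)%E).

Let D := fine (gauss_moment Q pi alpha x0).

Lemma gauss_moment_ge1 : 1 <= D.
Proof.
have [D2 diam] := finite_diameter mc alpha0 moment.
rewrite /D (fine_gauss_moment mc alpha x0 diam) -(sum_stat mc); apply: ler_sum => x _.
rewrite ler_peMl ?(stat_ge0 mc) // -expR0 ler_expR.
by rewrite mulr_ge0 ?sqr_ge0 // ltW.
Qed.

Let h := mixing_step alpha D.

Let h0 : 0 < h. Proof. exact: mixing_step_gt0 alpha0 gauss_moment_ge1. Qed.

(** If the new entropy [H] exceeded [L / 8], hence [ln 2 / 8], the transport term of [hwi] would be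
    at most [H / 2], so that [H <= m * F]; as [h = 8 * m], dissipation would give [9 * H <= L]. *)
Lemma entropy_heat_le rho (L : R) : density pi rho -> (forall x, 0 < heat Q pi h rho x) ->
  ln 2 <= L -> entropy pi rho <= L -> entropy pi (heat Q pi h rho) <= L / 8.
Proof.
move=> drho mup L2 HL; rewrite leNgt; apply/negP => lt.
have [D2 diam] := finite_diameter mc alpha0 moment.
set mu := heat Q pi h rho in mup lt *.
have dmu : density pi mu by exact: (density_heat mc h0).
have hD : \sum_x expR (alpha * dist Q pi (delta_density pi x) (delta_density pi x0) ^+ 2) * pi x <= D.
  by rewrite /D (fine_gauss_moment mc alpha x0 diam).
have tr := gaussian_transport_equilibrium mc diam alpha0 dmu hD.
have diss := entropy_dissipation mc h0 drho mup; rewrite -/mu in diss.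
have l20 := ln2_gt0 R.
have lD : 0 <= ln D by rewrite ln_ge0 // gauss_moment_ge1.
pose m := h / 8.
have m0 : 0 < m by rewrite divr_gt0.
have key := hwi mc diam ric dmu mup m0.
set H := entropy pi mu in lt tr diss key *.
set F := fisher Q pi mu in diss key *.
set W2 := dist Q pi mu _ ^+ 2 in tr key *.
have H8 : ln 2 / 8 < H by lra.
(* The constant in [mixing_step] makes [alpha * m * H] at least [2 * H + 4 * ln D] as soon as
   [H >= ln 2 / 8]. *)
have am : alpha * m = 2 * (1 + 16 * ln D / ln 2).
  by rewrite /m /h /mixing_step; field; rewrite !gt_eqF.
have le1 : 2 * ln D <= 16 * ln D / ln 2 * H.
  have -> : 16 * ln D / ln 2 * H = 16 * ln D * (H / ln 2) by rewrite mulrAC mulrA.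
  have : 8^-1 <= H / ln 2 by rewrite ler_pdivlMr //; lra.
  have l16 : 0 <= 16 * ln D by rewrite mulr_ge0.
  move=> /(ler_wpM2l l16); lra.
have le2 : (2 * m)^-1 * W2 <= H / 2.
  have m2 : 0 < 2 * m by rewrite mulr_gt0.
  rewrite (ler_pdivrMl _ _ m2) -(ler_pM2l alpha0).
  have -> : alpha * (2 * m * (H / 2)) = alpha * m * H by field.
  rewrite am; lra.
have hF : h * F = 8 * (m * F) by rewrite /m; field.
rewrite hF in diss.
rewrite mulrAC in key; move: (m * F) key diss => mF key diss; lra.
Qed.

Lemma heat_escape (S : {set X}) : \sum_(x in S) pi x <= 2^-1 ->
  8^-1 * \sum_(x in S) pi x <= \sum_(x in S) \sum_(y in ~: S) heat_kernel Q pi h x y.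
Proof.
set p := \sum_(x in S) pi x => ple.
have [S0|[z zS]] := set_0Vmem S.
  by rewrite /p S0 !big_set0 mulr0.
have p0 : 0 < p.
  rewrite /p (bigD1 z) //= ltr_pwDl ?(stat_gt0 mc) // sumr_ge0 // => x _.
  exact: (stat_ge0 mc).
pose one x : R := (x \in S)%:R.
pose rho x := one x / p.
have onep : \sum_x one x * pi x = p.
  rewrite /p [RHS]big_mkcond; apply: eq_bigr => x _; rewrite /one.
  by case: (x \in S); rewrite ?mul1r ?mul0r.
have drho : density pi rho.
  split=> [x|]; first by rewrite divr_ge0 ?ler0n // ltW.
  under eq_bigr do rewrite /rho mulrAC; by rewrite -mulr_suml onep divff // gt_eqF.
pose L := - ln p.
have L2 : ln 2 <= L.
  by rewrite /L -lnV ?posrE // ler_ln ?posrE ?invr_gt0 // -[2]invrK lef_pV2 ?posrE ?invr_gt0.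
have HL : entropy pi rho = L.
  have -> : entropy pi rho = \sum_x one x * pi x * (p^-1 * L).
    apply: eq_bigr => x _; rewrite /rho /one; case: (x \in S); rewrite ?mul0r ?mulr0 // !mul1r.
    by rewrite lnV ?posrE.
  by rewrite -mulr_suml onep mulrA divff ?mul1r // gt_eqF.
have rho_pos : 0 < rho z by rewrite /rho /one zS mul1r invr_gt0.
have mup := heat_gt0 mc h0 drho.1 rho_pos.
have := entropy_heat_le drho mup L2; rewrite HL => /(_ (lexx _)).
set mu := heat Q pi h rho in mup * => Hmu.
have [mu0 mu1] := density_heat mc h0 drho; rewrite -/mu in mu0 mu1.
pose q := \sum_x one x * mu x * pi x.
(* The Gibbs principle for [mu] against [expR (L * one x) / (2 - p)]: since [expR L = 1 / p], the
   normalization is [p / p + (1 - p)]. *)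
have gibbs : L * q <= L / 8 + ln (2 - p).
  have p2 : 0 < 2 - p by lra.
  pose Z := 2 - p.
  have := @entropy_tangent_sum R X Q pi mc (fun x => expR (L * one x) / Z) mu.
  have eS x : expR (L * one x) = one x / p + (1 - one x).
    rewrite /one; case: (x \in S).
      by rewrite mulr1 subrr addr0 mul1r /L expRN lnK ?posrE.
    by rewrite mulr0 expR0 mul0r subr0 add0r.
  have dt : density pi (fun x => expR (L * one x) / Z).
    split=> [x|]; first by rewrite divr_ge0 ?expR_ge0 // ltW.
    have -> : \sum_x expR (L * one x) / Z * pi x =
      ((\sum_x one x * pi x) / p + (\sum_x pi x - \sum_x one x * pi x)) / Z.
      rewrite mulr_suml -sumrB -big_split /= mulr_suml; apply: eq_bigr => x _.
      by rewrite eS; ring.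
    rewrite onep (sum_stat mc) divff ?gt_eqF //.
    have -> : 1 + (1 - p) = Z by rewrite /Z; lra.
    by rewrite divff // gt_eqF.
  have tpos x : 0 < expR (L * one x) / Z by rewrite divr_gt0 ?expR_gt0.
  have dmu : density pi mu by [].
  move=> /(_ dt dmu tpos).
  have lnt x : ln (expR (L * one x) / Z) = L * one x - ln Z.
    by rewrite ln_div ?posrE ?expR_gt0 // expRK.
  have -> : entropy pi (fun x => expR (L * one x) / Z) +
      \sum_x ln (expR (L * one x) / Z) * (mu x - expR (L * one x) / Z) * pi x =
      L * q - ln Z * \sum_x mu x * pi x.
    rewrite /entropy /q !mulr_sumr -sumrB -big_split; apply: eq_bigr => x _ /=.
    by rewrite lnt; ring.
  rewrite mu1 mulr1 -/Z; lra.
(* Amounts to [(2 - p)^4 p^3 <= 1], a consequence of [p (2 - p) <= 3 / 4] for [p <= 1 / 2]. The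
   slope 3/4 is the gap between 1/8 and the 7/8 wanted for [q]. *)
have lnp : ln (2 - p) <= 3 / 4 * L.
  have p2 : 0 < 2 - p by lra.
  have : ln ((2 - p) ^+ 4 * p ^+ 3) <= 0.
    apply: ln_le0; have -> : (2 - p) ^+ 4 * p ^+ 3 = (p * (2 - p)) ^+ 3 * (2 - p) by ring.
    have a0 : 0 <= p * (2 - p) by rewrite mulr_ge0 // ltW.
    have a34 : p * (2 - p) <= 3 / 4.
      have : 0 <= (2^-1 - p) * (3 / 2 - p) by apply: mulr_ge0; lra.
      lra.
    have a3 : (p * (2 - p)) ^+ 3 <= (3 / 4) ^+ 3 by apply: lerXn2r => //; rewrite nnegrE.
    have /le_trans : (p * (2 - p)) ^+ 3 * (2 - p) <= (3 / 4) ^+ 3 * 2.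
      by apply: ler_pM => //; [rewrite exprn_ge0 | exact: ltW | lra].
    apply; lra.
  rewrite lnM ?posrE ?exprn_gt0 // !lnXn // /L.
  rewrite -[ln (2 - p) *+ 4]mulr_natl -[ln p *+ 3]mulr_natl; lra.
have q78 : q <= 7 / 8.
  have L0 : 0 < L by apply: lt_le_trans L2; exact: ln2_gt0.
  rewrite -(ler_pM2l L0); lra.
(* The indicator of [S] is [p * rho], which the step sends to [p * mu]: of the mass [p] of [S], the
   part [q * p] stays inside. *)
have inner : \sum_(x in S) \sum_(y in S) heat_kernel Q pi h x y = q * p.
  rewrite /q mulr_suml [LHS]big_mkcond; apply: eq_bigr => x _.
  have -> : \sum_(y in S) heat_kernel Q pi h x y = \sum_y heat_kernel Q pi h x y * (rho y * p).
    rewrite big_mkcond; apply: eq_bigr => y _; rewrite /rho divfK ?gt_eqF // /one.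
    by case: (y \in S); rewrite ?mulr1 ?mulr0.
  have -> : \sum_y heat_kernel Q pi h x y * (rho y * p) = (\sum_y heat_kernel Q pi h x y * rho y) * p.
    by rewrite mulr_suml; apply: eq_bigr => y _; rewrite mulrA.
  rewrite (heat_kernelE mc h0) -/mu /one; case: (x \in S) => /=; ring.
have split : p = \sum_(x in S) \sum_(y in S) heat_kernel Q pi h x y +
    \sum_(x in S) \sum_(y in ~: S) heat_kernel Q pi h x y.
  rewrite -big_split; apply: eq_bigr => x _ /=; rewrite -(heat_kernel_mass mc h0 x).
  rewrite (bigID (fun y => y \in S)) /=; congr (_ + _).
  by apply: eq_bigl => y; rewrite !inE.
have := ler_wpM2r (ltW p0) q78; rewrite inner in split; lra.
Qed.

Lemma poincare_mixing : poincare Q pi (128 * h)^-1.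
Proof.
move=> f; rewrite invrK /fin_variance /expect.
have d0 : 0 < 8^-1 :> R by [].
have := cheeger (stat_ge0 mc) (sum_stat mc) (heat_kernel_ge0 mc h0) (heat_kernelC mc h0)
  (heat_kernel_mass mc h0) d0 heat_escape f.
move=> /le_trans; apply.
(* The Cheeger constant [2 / delta ^+ 2] at [delta = 1 / 8]. *)
have -> : 2 / 8^-1 ^+ 2 * kernel_form (heat_kernel Q pi h) f = 128 * kernel_form (heat_kernel Q pi h) f.
  by congr (_ * _); field.
by rewrite -mulrA ler_pM2l // (kernel_form_dirichlet mc h0).
Qed.

End mixing.

Theorem theorem5p8 (R : realType) :
  exists Lambda : R -> R -> R,
    (forall alpha D : R, 0 < alpha -> 1 <= D -> 0 < Lambda alpha D) /\
    forall (X : finType) (Q : X -> X -> R) (pi : X -> R),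
      markov_chain Q pi ->
      ricci_ge Q pi 0 ->
      forall (alpha : R) (x0 : X),
        0 < alpha ->
        (gauss_moment Q pi alpha x0 < +oo)%E ->
        poincare Q pi (Lambda alpha (fine (gauss_moment Q pi alpha x0))).
Proof.
exists (fun alpha D => (128 * mixing_step alpha D)^-1); split=> [alpha D al0 D1|].
  by rewrite invr_gt0 mulr_gt0 // mixing_step_gt0.
by move=> X Q pi mc ric alpha x0 al0 mom; exact: poincare_mixing.
Qed.
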